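(* Let $n,\rho\ge 1$ be integers, and let $V_{\mathbb{Z}}=\mathbb{Z}^{\rho}$ be a lattice inside the vector space $V_{\mathbb{R}}=V_{\mathbb{Z}}\otimes_{\mathbb{Z}}\mathbb{R}$. Then there exist countably many functions $f_j:V_{\mathbb{R}}\rightarrow\mathbb{R}_+$, $j\in\mathbb{N}$, such that for any irreducible projective variety $X$ over $\mathbb{C}$ of dimension $n$ and Picard number $\rho$ there is an integral linear isomorphism $$\pi_X: V_{\mathbb{R}}\rightarrow N^1(X)_{\mathbb{R}}$$ with the property that $\mathrm{vol}_X\circ\pi_X=f_j$ for some $j\in\mathbb{N}$.
   Context: $\mathbb{R}_+$ denotes the non-negative reals. For an irreducible projective variety $X$ over $\mathbb{C}$, $N^1(X)_{\mathbb{Z}}$ is the group of Cartier divisors modulo numerical equivalence, $N^1(X)_{\mathbb{R}}=N^1(X)_{\mathbb{Z}}\otimes\mathbb{R}$ is the finite-dimensional real vector space of numerical equivalence classes of $\mathbb{R}$-divisors, and the Picard number is $\dim_{\mathbb{R}}N^1(X)_{\mathbb{R}}$. For a Cartier divisor $D$ on $X$ with $\dim X=n$, $$\mathrm{vol}_X(D)=\limsup_{k\to\infty}\frac{\dim_{\mathbb{C}}H^0(X,\mathcal{O}_X(kD))}{k^n/n!}.$$ This depends only on the numerical class of $D$, and extends uniquely to a continuous function $\mathrm{vol}_X:N^1(X)_{\mathbb{R}}\to\mathbb{R}_+$ that is homogeneous of degree $n$. An integral linear isomorphism $V_{\mathbb{R}}\to N^1(X)_{\mathbb{R}}$ is an $\mathbb{R}$-linear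 isomorphism mapping the lattice $V_{\mathbb{Z}}$ into $N^1(X)_{\mathbb{Z}}$ (it need not map onto $N^1(X)_{\mathbb{Z}}$). *)

(* Defs.v *)
From HB Require Import structures.
From mathcomp Require Import all_boot all_order all_algebra.
From mathcomp Require Import generic_quotient ring_quotient fraction.
From mathcomp Require Import all_classical all_reals all_analysis.
From mathcomp Require Import complex.
(* The notations of mpoly clash with those of MathComp-Analysis. *)
From mathcomp Require Import -(notations) mpoly.

Set Implicit Arguments.
Unset Strict Implicit.
Unset Printing Implicit Defensive.

Import Order.TTheory GRing.Theory Num.Theory.
Import numFieldNormedType.Exports.

Local Open Scope classical_set_scope.
Local Open Scope quotient_scope.
Local Open Scope ring_scope.

(* The real numbers are an arbitrary R : realType, the complex numbers R[i]. *)

(* dim_k ((W + U) / U), in \bar R because it may be infinite.  With U = 0 this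
   is dim_k W; with U contained in W it is dim_k (W / U). *)
Definition ldim (R : realType) (k : fieldType) (V : lmodType k)
    (W U : set V) : \bar R :=
  ereal_sup [set (m%:R)%:E | m in [set m : nat |
    exists2 v : 'I_m -> V, (forall i, W (v i)) &
      forall c : 'I_m -> k, U (\sum_(i < m) c i *: v i) -> forall i, c i = 0]].

Section Projective.
Variables (R : realType) (N : nat).

Local Notation A := (mpoly N.+1 R[i]).

Definition homog (d : nat) (a : A) : bool := a \is ishomog1 d mdeg.

(* An integral closed subscheme of P^N over R[i], i.e. an irreducible (reduced)
   projective variety with an embedding in P^N, given by its homogeneous prime
   ideal, which must not contain the irrelevant ideal.  Such ideals are also
   the points of the scheme P^N, a subvariety corresponding to its generic
   point; below, points of a variety always appear in this form. *)
Record pvar := PVar {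
  ideal : A -> bool;
  ideal_closed : idealr_closed ideal;
  ideal_prime : prime_idealr_closed ideal;
  ideal_homog : forall a d, a \in ideal -> pihomog mdeg d a \in ideal;
  ideal_relevant : exists i : 'I_N.+1, mpolyX R[i] (mnm1 i) \notin ideal }.

HB.instance Definition _ := gen_eqMixin pvar.
HB.instance Definition _ := gen_choiceMixin pvar.

HB.instance Definition _ (X : pvar) := isIdealr.Build A (ideal X)
  (ideal_closed X).
HB.instance Definition _ (X : pvar) := isPrimeIdealrClosed.Build A (ideal X)
  (@ideal_prime X).

(* Z is contained in X; inclusion of ideals is reversed. *)
Definition subvar (Z X : pvar) : Prop := {subset ideal X <= ideal Z}.

Definition coord_ring (X : pvar) : Type := {ideal_quot (ideal X : {pred A})}.

HB.instance Definition _ X := GRing.ComNzRing.on (coord_ring X).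

Section CoordRing.
Variable X : pvar.

Let unit : {pred coord_ring X} := fun x => `[< exists y, y * x = 1 >].
Let inv (x : coord_ring X) : coord_ring X :=
  if unit x then xget x [set y | y * x = 1] else x.

Fact coord_ring_mulVr : {in unit, left_inverse 1 inv *%R}.
Proof.
move=> x; rewrite /inv -[unit x]/(x \in unit) => ux; rewrite ux.
by move: ux => /asboolP /xgetPex; apply.
Qed.

Fact coord_ring_unitP (x y : coord_ring X) : y * x = 1 -> unit x.
Proof. by move=> yx; apply/asboolP; exists y. Qed.

Fact coord_ring_invr_out : {in [predC unit], inv =1 id}.
Proof. by move=> x; rewrite inE /inv -[unit x]/(x \in unit) => /negbTE ->. Qed.

HB.instance Definition _ := GRing.ComNzRing_hasMulInverse.Build (coord_ring X)
  coord_ring_mulVr coord_ring_unitP coord_ring_invr_out.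

Fact coord_ring_idomain (x y : coord_ring X) :
  x * y = 0 -> (x == 0) || (y == 0).
Proof. exact: (@Quotient.rquot_IdomainAxiom A (ideal X)). Qed.

HB.instance Definition _ := GRing.ComUnitRing_isIntegral.Build (coord_ring X)
  coord_ring_idomain.

End CoordRing.

(* The fraction field of the homogeneous coordinate ring; the function field
   of X is its subfield of elements of degree 0. *)
Definition hfrac (X : pvar) : Type := {fraction (coord_ring X)}.

HB.instance Definition _ X := GRing.Field.on (hfrac X).

Definition hcls (X : pvar) (a : A) : hfrac X :=
  tofrac (\pi_({ideal_quot (ideal X : {pred A})}) a : coord_ring X).

Section HfracModule.
Variable X : pvar.

Fact hcls_is_zmod_morphism : zmod_morphism (hcls X).
Proof. by move=> a b; rewrite /hcls rmorphB /= tofracB. Qed.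

Fact hcls_is_monoid_morphism : monoid_morphism (hcls X).
Proof.
split=> [|a b]; rewrite /hcls; first by rewrite rmorph1 /= tofrac1.
by rewrite rmorphM /= tofracM.
Qed.

HB.instance Definition _ :=
  GRing.isZmodMorphism.Build A (hfrac X) (hcls X) hcls_is_zmod_morphism.
HB.instance Definition _ :=
  GRing.isMonoidMorphism.Build A (hfrac X) (hcls X) hcls_is_monoid_morphism.

Definition hfrac_scale (c : R[i]) (phi : hfrac X) : hfrac X :=
  hcls X (mpolyC N.+1 c) * phi.

Fact hfrac_scaleA c d phi :
  hfrac_scale c (hfrac_scale d phi) = hfrac_scale (c * d) phi.
Proof. by rewrite /hfrac_scale mulrA !rmorphM. Qed.

Fact hfrac_scale1 : left_id 1 hfrac_scale.
Proof. by move=> phi; rewrite /hfrac_scale !rmorph1 mul1r. Qed.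

Fact hfrac_scaleDr : right_distributive hfrac_scale +%R.
Proof. by move=> c phi psi; rewrite /hfrac_scale mulrDr. Qed.

Fact hfrac_scaleDl phi :
  {morph hfrac_scale^~ phi : c d / c + d >-> c + d}.
Proof. by move=> c d; rewrite /hfrac_scale !rmorphD mulrDl. Qed.

HB.instance Definition _ := GRing.Zmodule_isLmodule.Build R[i] (hfrac X)
  hfrac_scaleA hfrac_scale1 hfrac_scaleDr hfrac_scaleDl.

End HfracModule.

(* phi = a / b on X with a, b homogeneous of the same degree and b not
   identically zero on Z *)
Definition is_quot (X Z : pvar) (a b : A) (phi : hfrac X) : Prop :=
  [/\ exists d, homog d a && homog d b, b \notin ideal Z &
      phi = hcls X a / hcls X b].

(* For Z contained in X, the local ring of X at (the generic point of) Z, as a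
   subring of the function field. *)
Definition local_ring (X Z : pvar) : set (hfrac X) :=
  [set phi | exists a b, is_quot Z a b phi].

Definition fun_field (X : pvar) : set (hfrac X) := @local_ring X X.

Definition local_unit (X Z : pvar) (phi : hfrac X) : Prop :=
  [/\ phi != 0, local_ring Z phi & local_ring Z phi^-1].

(* A global section of K^* / O^*, through representatives in K^* of its germs
   at all points of X: every point Z has a basic open neighbourhood, the
   non-vanishing locus of a form h, on which the germs are those of
   local_eq Z.  Two such records define the same Cartier divisor when their
   local equations differ by units of the local rings. *)
Record cartier (X : pvar) := Cartier {
  local_eq : pvar -> hfrac X;
  local_eq_neq0 : forall Z, subvar Z X -> local_eq Z != 0;
  local_eq_fun : forall Z, subvar Z X -> fun_field (local_eq Z);
  local_eq_compat : forall Z, subvar Z X ->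
    exists h, [/\ exists d, homog d h, h \notin ideal Z &
      forall W, subvar W X -> h \notin ideal W ->
        local_unit W (local_eq Z / local_eq W)] }.

HB.instance Definition _ X := gen_eqMixin (cartier X).
HB.instance Definition _ X := gen_choiceMixin (cartier X).

(* H^0(X, O_X(k D)); the divisor k D has local equations f_Z ^+ k. *)
Definition sections (X : pvar) (D : cartier X) (k : nat) : set (hfrac X) :=
  [set phi | fun_field phi /\
    forall Z, subvar Z X -> local_ring Z (phi * local_eq D Z ^+ k)].

Definition chain (X : pvar) (m : nat) : Prop :=
  exists c : nat -> pvar, (forall i, (i <= m)%N -> subvar (c i) X) /\
    forall i, (i < m)%N -> subvar (c i) (c i.+1) /\ ~ subvar (c i.+1) (c i).

(* Krull dimension; the default value 0 is never used since a longest chain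
   of irreducible closed subsets always exists. *)
Definition pdim (X : pvar) : nat :=
  xget 0%N [set n | chain X n /\ forall m, chain X m -> (m <= n)%N].

Definition closed_point (P : pvar) : Prop :=
  forall Q, subvar Q P -> subvar P Q.

Definition vol_cartier (X : pvar) (D : cartier X) : \bar R :=
  limn_esup (fun k : nat => (ldim R (sections D k) [set 0%R] *
    ((k%:R ^+ pdim X / (pdim X)`!%:R)^-1)%:E)%E).

Definition colength (C P : pvar) (a : hfrac C) : R :=
  fine (ldim R (@local_ring C P) [set a * x | x in @local_ring C P]).

(* The order at the closed point P of a nonzero rational function on the curve
   C, that is dim (O / a O) - dim (O / b O) for phi = a / b with a, b in the
   local ring O of C at P; this does not depend on a and b. *)
Definition ord (C P : pvar) (phi : hfrac C) : R :=
  xget 0 [set r | exists a b, [/\ local_ring P a /\ a != 0,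
    local_ring P b /\ b != 0, phi = a / b &
    r = colength P a - colength P b]].

(* The restriction to C of a rational function on X that is regular at the
   generic point of C, where C is a subvariety of X. *)
Definition restr (X C : pvar) (phi : hfrac X) : hfrac C :=
  xget 0 [set psi | exists a b, is_quot C a b phi /\ is_quot C a b psi].

(* (D . C) = deg (O_X(D) restricted to C) for an irreducible curve C in X.
   Dividing all local equations by the one at the generic point of C gives a
   linearly equivalent divisor whose support does not contain C; its
   restriction to C is a Cartier divisor on C, of which we take the degree.
   The sum over the closed points of C has finitely many nonzero terms. *)
Definition inum (X : pvar) (D : cartier X) (C : pvar) : R :=
  \sum_(P \in [set P | subvar P C /\ closed_point P])
    ord P (restr C (local_eq D P / local_eq D C)).

(* Formal real linear combinations of Cartier divisors.  Two sequences that
   represent the same R-divisor are in particular numerically equivalent. *)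
Definition rdivisor (X : pvar) : Type := seq (R * cartier X).

HB.instance Definition _ X := Choice.on (rdivisor X).

Definition rinum (X : pvar) (D : rdivisor X) (C : pvar) : R :=
  \sum_(t <- D) t.1 * inum t.2 C.

Definition num_equiv (X : pvar) (D E : rdivisor X) : bool :=
  `[< forall C, subvar C X -> pdim C = 1%N -> rinum D C = rinum E C >].

Fact num_equiv_is_equiv X : equiv_class_of (@num_equiv X).
Proof.
split=> [D|D E|E D F].
- exact/asboolP.
- by apply/asboolP/asboolP => DE C CX C1; rewrite DE.
- by move=> /asboolP DE /asboolP EF; apply/asboolP => C CX C1; rewrite DE ?EF.
Qed.

Canonical num_equiv_equiv X := EquivRelPack (num_equiv_is_equiv X).
Canonical num_equiv_encModRel X := defaultEncModRel (@num_equiv X).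

(* N^1(X)_R *)
Definition N1 (X : pvar) : Type := {eq_quot (@num_equiv X)}.

HB.instance Definition _ X : EqQuotient _ (@num_equiv X) (N1 X) :=
  EqQuotient.on (N1 X).
HB.instance Definition _ X := Choice.on (N1 X).

Section N1Module.
Variable X : pvar.
Implicit Types (D E : rdivisor X) (x y z : N1 X).

Definition rscale (c : R) D : rdivisor X := [seq (c * t.1, t.2) | t <- D].

Lemma rinum_nil C : rinum ([::] : rdivisor X) C = 0.
Proof. by rewrite /rinum big_nil. Qed.

Lemma rinum_cat D E C : rinum (D ++ E) C = rinum D C + rinum E C.
Proof. by rewrite /rinum big_cat. Qed.

Lemma rinum_scale c D C : rinum (rscale c D) C = c * rinum D C.
Proof.
by rewrite /rinum big_map mulr_sumr; apply: eq_bigr => t _; rewrite mulrA.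
Qed.

Definition N1_class D : N1 X := \pi_(N1 X) D.

Lemma N1_classK x : N1_class (repr x) = x.
Proof. exact: reprK. Qed.

Lemma N1_classP D E :
  (forall C, subvar C X -> pdim C = 1%N -> rinum D C = rinum E C) <->
  N1_class D = N1_class E.
Proof.
by split=> [DE|/eqmodP/asboolP//]; apply/eqmodP/asboolP.
Qed.

Lemma rinum_repr D C : subvar C X -> pdim C = 1%N ->
  rinum (repr (N1_class D)) C = rinum D C.
Proof. by move=> CX C1; apply: (N1_classP _ _).2 CX C1; exact: N1_classK. Qed.

Definition N1_add x y : N1 X := N1_class (repr x ++ repr y).
Definition N1_scale c x : N1 X := N1_class (rscale c (repr x)).
Definition N1_zero : N1 X := N1_class [::].
Definition N1_opp x : N1 X := N1_scale (-1) x.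

Let rinumE :=
  (rinum_repr, rinum_cat, rinum_scale, rinum_nil).

Fact N1_addA : associative N1_add.
Proof.
by move=> x y z; apply/N1_classP => C CX C1; rewrite !rinumE// addrA.
Qed.
Fact N1_addC : commutative N1_add.
Proof. by move=> x y; apply/N1_classP => C CX C1; rewrite !rinumE// addrC. Qed.
Fact N1_add0 : left_id N1_zero N1_add.
Proof.
move=> x; rewrite -[RHS]N1_classK; apply/N1_classP => C CX C1.
by rewrite !rinumE// add0r.
Qed.
Fact N1_addN : left_inverse N1_zero N1_opp N1_add.
Proof.
by move=> x; apply/N1_classP => C CX C1; rewrite !rinumE// mulN1r addNr.
Qed.

HB.instance Definition _ :=
  GRing.isZmodule.Build (N1 X) N1_addA N1_addC N1_add0 N1_addN.

Fact N1_scaleA c d x : N1_scale c (N1_scale d x) = N1_scale (c * d) x.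
Proof. by apply/N1_classP => C CX C1; rewrite !rinumE// mulrA. Qed.
Fact N1_scale1 : left_id 1 N1_scale.
Proof.
move=> x; rewrite -[RHS]N1_classK; apply/N1_classP => C CX C1.
by rewrite !rinumE// mul1r.
Qed.
Fact N1_scaleDr : right_distributive N1_scale +%R.
Proof.
by move=> c x y; apply/N1_classP => C CX C1; rewrite !rinumE// mulrDr.
Qed.
Fact N1_scaleDl x : {morph N1_scale^~ x : c d / c + d >-> c + d}.
Proof. by move=> c d; apply/N1_classP => C CX C1; rewrite !rinumE// mulrDl. Qed.

HB.instance Definition _ := GRing.Zmodule_isLmodule.Build R (N1 X)
  N1_scaleA N1_scale1 N1_scaleDr N1_scaleDl.

End N1Module.

Definition cartier_class (X : pvar) (D : cartier X) : N1 X :=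
  N1_class [:: (1, D)].

(* N^1(X)_Z is torsion-free, so it is identified with the group of classes of
   Cartier divisors in N^1(X)_R. *)
Definition N1Z (X : pvar) : set (N1 X) := range (@cartier_class X).

Definition picard_number (X : pvar) : \bar R :=
  ldim R [set: N1 X] [set 0].

(* v is the extension of the volume of Cartier divisors to a continuous
   function N^1(X)_R -> R_+ that is homogeneous of degree dim X.  Continuity is
   for the canonical topology of the finite-dimensional space N^1(X)_R, for
   which v is continuous if and only if its composite with every linear map
   R^m -> N^1(X)_R is. *)
Definition is_volume (X : pvar) (v : N1 X -> R) : Prop :=
  [/\ forall x, 0 <= v x,
      forall (m : nat) (phi : {linear 'rV[R]_m -> N1 X}), continuous (v \o phi),
      forall t x, 0 <= t -> v (t *: x) = t ^+ pdim X * v x &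
      forall D : cartier X, (v (cartier_class D))%:E = vol_cartier D].

(* vol_X is the unique v such that is_volume v; the default value 0 is never
   used since the extension always exists. *)
Definition vol (X : pvar) : N1 X -> R := xget (fun=> 0) [set v | is_volume v].

End Projective.

Arguments local_ring {R N} X Z _.
Arguments fun_field {R N} X _.
Arguments vol {R N} X _.

(* Main.v *)
(* The automorphism group of the field of complex numbers acts on embedded
   projective varieties by conjugating the coefficients of their equations, and
   all the data entering the volume function - function fields, local rings,
   Cartier divisors, intersection numbers, dimensions of spaces of sections -
   are compatible with this action, so that conjugate varieties have the same
   volume function.  There are only countably many varieties up to this action:
   an ideal is generated by finitely many polynomials, and any finite family of
   complex numbers can be moved by an automorphism into a fixed countable
   algebraically closed subfield of infinite transcendence degree.

   For each variety, Cartier divisors whose classes form a basis of N^1(X)_R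
   give an integral isomorphism.  That integral combinations of classes of
   Cartier divisors are again such classes rests on the additivity of orders of
   rational functions on curves, for which one needs that the local rings of a
   curve have finite-dimensional quotients and that a form has finitely many
   zeros on a curve; both follow by noetherian induction on homogeneous ideals
   from the Nullstellensatz.  Since an isomorphism only has to identify volume
   functions up to conjugation, existence of the volume function is never used:
   it suffices that it is determined by its values on Cartier divisors. *)
From HB Require Import structures.
From mathcomp Require Import all_boot all_order all_algebra.
From mathcomp Require Import finmap.
From mathcomp Require Import generic_quotient ring_quotient fraction.
From mathcomp Require Import all_classical all_reals all_analysis.
From mathcomp Require Import complex.
From mathcomp Require Import -(notations) mpoly.
From mathcomp Require Import zify ring lra.
Require Import Defs.

Set Implicit Arguments.
Unset Strict Implicit.
Unset Printing Implicit Defensive.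

Import Order.TTheory GRing.Theory Num.Theory.
Import numFieldNormedType.Exports.

Local Open Scope classical_set_scope.
Local Open Scope quotient_scope.
Local Open Scope ring_scope.

(** * Noetherianity of polynomial rings *)

(** The isomorphism attached to [X] does not come from divisors chosen on [X]. The basis is chosen
    on a conjugate model, which is determined by the ambient dimension and a code for generators of
    its ideal, and it is carried back to [X] by the inverse of conjugation; so the resulting
    function depends on the code alone. The automorphisms come from Zorn's lemma and have no
    continuity, so every invariant must be reduced to algebra. Orders and spaces of sections enter
    as dimensions, which survive a bijection that twists complex scalars, while the real
    coefficients of an R-divisor are left alone; conjugation of numerical classes is therefore
    linear over the reals. Infinite transcendence degree lets coefficients be moved one at a time:
    those already moved lie in a proper algebraically closed subfield, and the next one is exchanged
    with an element outside that subfield, which stays fixed. *)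

Definition is_ideal (A : comNzRingType) (J : set A) : Prop :=
  [/\ J 0, forall a b, J a -> J b -> J (a + b) & forall a b, J b -> J (a * b)].

Inductive igen (A : comNzRingType) (S : set A) : set A :=
| igen0 : igen S 0
| igenD c g a : S g -> igen S a -> igen S (c * g + a).

Lemma igen_sub (A : comNzRingType) (S J : set A) :
  is_ideal J -> S `<=` J -> igen S `<=` J.
Proof.
move=> [J0 JD JM] SJ a; elim=> // c g b Sg _ Jb.
by apply: JD => //; apply: JM; apply: SJ.
Qed.

Lemma igenT (A : comNzRingType) (S : set A) : S `<=` igen S.
Proof.
by move=> a Sa; rewrite -[a]mul1r -[1 * a]addr0; apply: igenD => //; left.
Qed.

Lemma igen_ideal (A : comNzRingType) (S : set A) : is_ideal (igen S).
Proof.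
have D a b : igen S a -> igen S b -> igen S (a + b).
  move=> Sa Sb; elim: Sa => [|c g x Sg _ IH]; first by rewrite add0r.
  by rewrite -addrA; right.
split=> // [|a b]; first by left.
elim=> [|c g x Sg _ IH]; first by rewrite mulr0; left.
by rewrite mulrDr mulrA; right.
Qed.

(** Beyond every index there is a place where the sequence attains the minimum of its tail; the
    subsequence moves from one such place to the next. *)
Lemma nondecr_subseq (u : nat -> nat) : exists phi : nat -> nat,
  {homo phi : i j / (i < j)%N} /\ {homo (u \o phi) : i j / (i <= j)%N}.
Proof.
have mn k : exists j, (k <= j)%N /\ forall l, (k <= l)%N -> (u j <= u l)%N.
  have ex : exists v, `[< exists2 j, (k <= j)%N & u j = v >].
    by exists (u k); apply/asboolP; exists k.
  case: (ex_minnP ex) => v /asboolP[j kj <-] vmin.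
  by exists j; split=> // l kl; apply: vmin; apply/asboolP; exists l.
have [m mP] := choice mn.
pose phi := fix phi i := if i is i'.+1 then m (phi i').+1 else m 0%N.
have phiS i : (phi i < phi i.+1)%N by have [] := mP (phi i).+1.
have phil : {homo phi : i j / (i < j)%N} by apply: homo_ltn => //; apply: ltn_trans.
exists phi; split=> //; apply: homo_leq => //=; first exact: leq_trans.
move=> i; have mini l : (phi i <= l)%N -> (u (phi i) <= u l)%N.
  case: i => [|i] /= h; first by apply: (mP 0%N).2.
  apply: (mP _).2; apply: leq_trans h; exact: (mP _).1.
by apply: mini; apply: ltnW.
Qed.

(** Subsequences are extracted one coordinate at a time until every exponent is nondecreasing; then
    the first two terms will do. *)
Lemma dickson_seq n (u : nat -> (multinom n)) :
  exists i j, (i < j)%N /\ lem (u i) (u j).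
Proof.
suff [phi [phil H]] : exists phi : nat -> nat, {homo phi : i j / (i < j)%N} /\
    forall l : 'I_n, (l < n)%N -> {homo (fun i => u (phi i) l) : i j / (i <= j)%N}.
  exists (phi 0%N), (phi 1%N); split; first exact: phil.
  by apply/mnm_lepP => l; apply: H.
suff gen k : exists phi : nat -> nat, {homo phi : i j / (i < j)%N} /\
    forall l : 'I_n, (l < k)%N -> {homo (fun i => u (phi i) l) : i j / (i <= j)%N}.
  exact: gen.
elim: k => [|k [phi [phil H]]]; first by exists id; split=> // l; rewrite ltn0.
have [kn|nk] := ltnP k n; last first.
  exists phi; split=> // l _; apply: H; apply: leq_trans (ltn_ord l) nk.
have [psi [psil psiH]] := nondecr_subseq (fun i => u (phi i) (Ordinal kn)).
exists (phi \o psi); split=> [i j ij|l]; first by apply: phil; apply: psil.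
rewrite ltnS leq_eqVlt => /orP[/eqP lk i j ij|lk i j ij].
  have := psiH i j ij; rewrite /=.
  by have -> : Ordinal kn = l by apply/val_inj.
by apply: H => //=; move: ij; rewrite leq_eqVlt => /predU1P[->//|/psil/ltnW].
Qed.

(** Otherwise elements of [S] could be chosen one after another, none a multiple of an earlier one,
    against [dickson_seq]. *)
Lemma dickson n (S : set (multinom n)) : exists2 s : seq (multinom n),
  (forall m, m \in s -> S m) & forall m, S m -> exists2 g, g \in s & lem g m.
Proof.
apply: contrapT => /forall2NP H.
have nx (s : seq (multinom n)) : exists m, (forall g, g \in s -> S g) ->
    S m /\ forall g, g \in s -> ~~ lem g m.
  have [/existsNP[m /not_implyP[ms Sm]]|] := H s; first by exists m => /(_ m ms).
  move=> /existsNP[m /not_implyP[Sm /forall2NP h]]; exists m => _; split=> // g gs.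
  by have [//|/negP] := h g.
have [f fP] := choice nx.
pose s := fix s k := if k is k'.+1 then rcons (s k') (f (s k')) else [::].
have sS k : forall g, g \in s k -> S g.
  elim: k => //= k IH g; rewrite mem_rcons inE => /predU1P[->|]; last exact: IH.
  by have [] := fP _ IH.
have sub i j : (i < j)%N -> f (s i) \in s j.
  elim: j => // j IH; rewrite ltnS leq_eqVlt /= mem_rcons inE.
  by case/predU1P=> [->|/IH ->]; rewrite ?eqxx ?orbT.
have [i [j [ij le]]] := dickson_seq (fun i => f (s i)).
by have [_ /(_ _ (sub _ _ ij))] := fP (s j) (sS j); rewrite le.
Qed.

(* Hilbert's basis theorem: the leading monomials of J are generated by finitely
   many, by Dickson's lemma, and reduction modulo the corresponding elements of
   J terminates. *)
Lemma hilbert_basis n (K : fieldType) (J : set (mpoly n K)) : is_ideal J ->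
  exists s : seq (mpoly n K), J = igen [set` s].
Proof.
move=> Ji; have [J0 JD JM] := Ji.
have [s sS sP] := dickson [set m | exists a, [/\ J a, a != 0 & mlead a = m]].
have ch m : exists a, m \in s -> [/\ J a, a != 0 & mlead a = m].
  have [/sS[a aP]|ms] := boolP (m \in s); first by exists a.
  by exists 0 => ms'; case/negP: ms.
have [f fP] := choice ch.
exists [seq f m | m <- s]; apply/seteqP; split; last first.
  by apply: igen_sub => // _ /mapP[m ms ->]; have [] := fP m ms.
pose T := igen [set` [seq f m | m <- s]].
have [T0 TD TM] : is_ideal T by apply: igen_ideal.
suff H (m : (multinom n)) a : J a -> mlead a = m -> T a by move=> a Ja; apply: (H _ a).
elim/(well_founded_ind (@ltom_wf n)): m a => m IH a Ja am.
have [->//|a0] := eqVneq a 0.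
have [|g gs gm] := sP m; first by exists a.
have [Jg g0 gl] := fP g gs.
pose q := (mcoeff (mlead a) a / mcoeff (mlead (f g)) (f g)) *: mpolyX K (mnm_sub m g).
have lg : mcoeff (mlead (f g)) (f g) != 0 by rewrite mleadc_eq0.
have la : mcoeff (mlead a) a != 0 by rewrite mleadc_eq0.
have q0 : mcoeff (mlead a) a / mcoeff (mlead (f g)) (f g) != 0 by rewrite mulf_neq0 ?invr_eq0.
have qlead : mlead q = mnm_sub m g by rewrite mleadZ // mleadXm.
have qf : mnm_add (mlead q) (mlead (f g)) = m by rewrite qlead gl submK.
have ml : mlead (q * f g) = m.
  by rewrite mleadM // /q scaler_eq0 negb_or q0 -msupp_eq0 msuppX.
have mc : mcoeff m (q * f g) = mcoeff m a.
  rewrite -[m in LHS]qf mleadcM qlead mcoeffZ mcoeffX eqxx mulr1 mulfVK //.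
  by rewrite am.
rewrite -[a](subrK (q * f g)); apply: TD; last first.
  by apply: TM; apply: igenT => /=; apply: map_f.
have [->//|d0] := eqVneq (a - q * f g) 0.
apply: (IH (mlead (a - q * f g))) => //.
  rewrite lt_neqAle; apply/andP; split.
    apply/eqP => e; have := mleadc_eq0 (a - q * f g).
    by rewrite e mcoeffB mc subrr eqxx (negbTE d0).
  by apply: (le_trans (mleadB_le _ _)); rewrite ml am joinxx.
by apply: JD => //; rewrite -mulNr; apply: JM.
Qed.

(** A failure yields by choice a strictly increasing sequence of bad ideals. Their union is
    generated by finitely many elements, which already lie in one term of the sequence. *)
Lemma noetherian_ind n (K : fieldType) (Pr : set (mpoly n K) -> Prop) :
  (forall J, is_ideal J ->
    (forall J', is_ideal J' -> J `<` J' -> Pr J') -> Pr J) ->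
  forall J, is_ideal J -> Pr J.
Proof.
move=> step J0 J0i; apply: contrapT => nP.
pose bad J := is_ideal J /\ ~ Pr J.
have nx J : exists J', bad J -> bad J' /\ J `<` J'.
  have [[Ji nPJ]|nb] := pselect (bad J); last by exists J.
  have /existsNP[J' /not_implyP[J'i /not_implyP[JJ' nPJ']]] :
      ~ forall J', is_ideal J' -> J `<` J' -> Pr J'.
    by move=> h; apply: nPJ; apply: step.
  by exists J'.
have [f fP] := choice nx.
pose s k := iter k f J0.
have sb k : bad (s k) by elim: k => //= k IH; have [] := fP _ IH.
have sS k : s k `<` s k.+1 by have [] := fP _ (sb k).
have sle i j : (i <= j)%N -> s i `<=` s j.
  elim: j => [|j IH]; first by rewrite leqn0 => /eqP ->.
  rewrite leq_eqVlt => /predU1P[->//|]; rewrite ltnS => /IH h.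
  by apply: subset_trans h _; apply: properW.
pose U : set (mpoly n K) := [set a | exists k, s k a].
have Ui : is_ideal U.
  split=> [|a b [i ia] [j jb]|a b [i ib]].
  - by exists 0%N; have [[]] := sb 0%N.
  - exists (maxn i j); have [[_ D _] _] := sb (maxn i j).
    by apply: D; [apply: sle ia; apply: leq_maxl|apply: sle jb; apply: leq_maxr].
  - by exists i; have [[_ _ M] _] := sb i; apply: M.
have [g gU] := hilbert_basis Ui.
have [k gk] : exists k, [set` g] `<=` s k.
  have : [set` g] `<=` U by rewrite gU; apply: igenT.
  elim: {gU} g => [|a g IH] h; first by exists 0%N.
  have [k ks] : exists k, [set` g] `<=` s k.
    by apply: IH => b bg; apply: h => /=; rewrite inE bg orbT.
  have [l la] : U a by apply: h => /=; rewrite inE eqxx.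
  exists (maxn k l) => b /=; rewrite inE => /predU1P[->|bg].
    by apply: sle la; apply: leq_maxr.
  by apply: (sle k); [apply: leq_maxl|apply: ks].
have [sk nsk] := sS k; apply: nsk => a sa.
have : U a by exists k.+1.
by rewrite gU; apply: igen_sub => //; have [] := sb k.
Qed.

(** * Homogeneous ideals *)

Section Homogeneous.
Variables (R : realType) (N : nat).
Local Notation A := (mpoly N.+1 R[i]).
Local Notation pvar := (pvar R N).
Implicit Types (J : set A) (a b f g : A) (X Z P Q C : pvar).

Definition var (i : 'I_N.+1) : A := mpolyX R[i] (mnm1 i).

Definition is_hideal J : Prop :=
  is_ideal J /\ forall a d, J a -> J (pihomog mdeg d a).

Definition is_prime J : Prop := forall a b, J (a * b) -> J a \/ J b.

Lemma homog_pihomog d a : homog d (pihomog mdeg d a).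
Proof. exact: pihomogP. Qed.

Lemma homogM d e a b : homog d a -> homog e b -> homog (d + e) (a * b).
Proof. exact: dhomogM. Qed.

Lemma homogD d a b : homog d a -> homog d b -> homog d (a + b).
Proof. exact: dhomogD. Qed.

Lemma homogN d a : homog d (- a) = homog d a.
Proof. exact: dhomogN. Qed.

Lemma homogB d a b : homog d a -> homog d b -> homog d (a - b).
Proof. by move=> da db; apply: homogD; rewrite ?homogN. Qed.

Lemma homog0 d : homog d (0 : A).
Proof. exact: dhomog0. Qed.

Lemma homog_C c : homog 0 (mpolyC N.+1 c : A).
Proof. by rewrite -[mpolyC _ _]mulr1 mul_mpolyC; apply: dhomogZ; apply: dhomog1. Qed.

Lemma homogZ d c a : homog d a -> homog d (mpolyC N.+1 c * a : A).
Proof. by move=> da; apply: (@homogM 0); first exact: homog_C. Qed.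

Lemma homog_var i : homog 1 (var i).
Proof. by rewrite /homog dhomogX; apply/eqP; exact: mdeg1. Qed.

Lemma homog_varX i d : homog d (var i ^+ d).
Proof. by have := dhomogMn d (homog_var i); rewrite mul1n. Qed.

Lemma pihomog_homog d a : homog d a -> pihomog mdeg d a = a.
Proof. exact: pihomog_dE. Qed.

Lemma homog_decomp a : a = \sum_(d < mmeasure mdeg a) pihomog mdeg d a.
Proof. exact: pihomog_partitionE. Qed.

(** Only the component of [a] of degree [d - e] contributes; the case distinction guards against
    truncated subtraction. *)
Lemma pihomogMr d e a f : homog e f ->
  pihomog mdeg d (a * f) = if (e <= d)%N then pihomog mdeg (d - e) a * f else 0.
Proof.
move=> ef; rewrite {1}[a]homog_decomp mulr_suml linear_sum /=.
have E (i : nat) : pihomog mdeg d (pihomog mdeg i a * f) =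
    if (i + e == d)%N then pihomog mdeg i a * f else 0.
  have h : homog (i + e) (pihomog mdeg i a * f).
    by apply: homogM => //; apply: homog_pihomog.
  case: eqP => [<-|/eqP ne]; first exact: pihomog_homog.
  by rewrite (pihomog_ne0 ne).
under eq_bigr do rewrite E.
case: leqP => [ed|de]; last first.
  by rewrite big1 // => i _; case: eqP => // h; lia.
rewrite -big_mkcond /=.
have [lt|ge] := ltnP (d - e) (mmeasure mdeg a).
  rewrite (big_pred1 (Ordinal lt)) // => i /=.
  by apply/eqP/eqP => [h|->/=]; [apply: val_inj => /=|]; lia.
rewrite big1 => [|i /eqP h]; last by have := ltn_ord i; lia.
suff -> : pihomog mdeg (d - e) a = 0 by rewrite mul0r.
rewrite {1}[a]homog_decomp linear_sum /= big1 // => i _.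
by apply: (@pihomog_ne0 _ _ _ i); [have := ltn_ord i; lia|apply: homog_pihomog].
Qed.

Section Ideal.
Variables (J : set A) (Ji : is_ideal J).

Lemma ideal_zero : J 0. Proof. by have [] := Ji. Qed.
Lemma ideal_add a b : J a -> J b -> J (a + b). Proof. by have [_ D _] := Ji; apply: D. Qed.
Lemma ideal_mull a b : J b -> J (a * b). Proof. by have [_ _ M] := Ji; apply: M. Qed.
Lemma ideal_mulr a b : J a -> J (a * b). Proof. by rewrite mulrC; apply: ideal_mull. Qed.
Lemma ideal_opp a : J a -> J (- a).
Proof. by rewrite -mulN1r; apply: ideal_mull. Qed.
Lemma ideal_sub a b : J a -> J b -> J (a - b).
Proof. by move=> Ja Jb; apply: ideal_add => //; apply: ideal_opp. Qed.
Lemma ideal_sum (I : Type) (r : seq I) (p : pred I) (F : I -> A) :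
  (forall i, p i -> J (F i)) -> J (\sum_(i <- r | p i) F i).
Proof. by move=> H; apply: big_ind => //; [exact: ideal_zero|exact: ideal_add]. Qed.
End Ideal.

Definition idl X : set A := fun a => ideal X a.

Lemma idlE X a : idl X a <-> a \in ideal X.
Proof. by []. Qed.

Lemma idl_hideal X : is_hideal (idl X).
Proof.
split; last by move=> a d; apply: ideal_homog.
split=> [|a b|a b]; rewrite !idlE.
- exact: rpred0.
- exact: rpredD.
- exact: idealMr.
Qed.

Lemma idl_ideal X : is_ideal (idl X). Proof. by case: (idl_hideal X). Qed.

Lemma idl1 X : ~ idl X 1.
Proof. by rewrite idlE; apply/negP; have [] := ideal_closed X. Qed.

Lemma idl_prime X : is_prime (idl X).
Proof. by move=> a b ab; apply/orP; exact: (@ideal_prime _ _ X). Qed.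

Lemma pvar_eq X Z : idl X = idl Z -> X = Z.
Proof.
case: X Z => [I c p h r] [I' c' p' h' r'] e.
have E : I = I'.
  apply/funext => a; apply/idP/idP => H.
    by rewrite -/(idl (PVar c' p' h' r') a) -e.
  by rewrite -/(idl (PVar c p h r) a) e.
by subst I'; congr PVar; apply: Prop_irrelevance.
Qed.

Lemma subvarP X Z : subvar Z X <-> idl X `<=` idl Z.
Proof. by []. Qed.

Lemma subvar_anti X Z : subvar Z X -> subvar X Z -> X = Z.
Proof. by move=> h1 h2; apply: pvar_eq; apply/seteqP. Qed.

Lemma pvar_of_prime J i : is_hideal J -> is_prime J -> ~ J (var i) ->
  exists X, idl X = J.
Proof.
move=> [[J0 JD JM] Jh] Jp Ji.
have c : idealr_closed (fun a => `[< J a >]).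
  split=> [||a u v]; rewrite ?unfold_in.
  - exact/asboolP.
  - by apply/asboolP => J1; apply: Ji; rewrite -[var i]mulr1; apply: JM.
  - by move=> /asboolP Ju /asboolP Jv; apply/asboolP/JD => //; apply: JM.
have p : prime_idealr_closed (fun a => `[< J a >]).
  move=> a b; rewrite !unfold_in => /asboolP/Jp[]/asboolP -> //.
  by rewrite orbT.
have h a d : a \in (fun a => `[< J a >]) ->
    pihomog mdeg d a \in (fun a => `[< J a >]).
  by rewrite !unfold_in => /asboolP Ja; apply/asboolP/Jh.
have r : exists i : 'I_N.+1, mpolyX R[i] (mnm1 i) \notin (fun a => `[< J a >]).
  by exists i; rewrite unfold_in; apply/asboolP.
by exists (PVar c p h r); apply/funext => a; apply: asboolE.
Qed.

Definition iadd J f : set A := [set x | exists a c, J a /\ x = a + c * f].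

Lemma iadd_sub J f : J `<=` iadd J f.
Proof. by move=> a Ja; exists a, 0; rewrite mul0r addr0. Qed.

Lemma iadd_mem J f : is_ideal J -> iadd J f f.
Proof. by move=> Ji; exists 0, 1; rewrite mul1r add0r; split=> //; apply: ideal_zero. Qed.

Lemma iadd_ideal J f : is_ideal J -> is_ideal (iadd J f).
Proof.
move=> Ji; split=> [|_ _ [a [c [Ja ->]]] [b [d [Jb ->]]]|x _ [b [d [Jb ->]]]].
- by apply: iadd_sub; apply: ideal_zero.
- by exists (a + b), (c + d); split; [apply: ideal_add|ring].
- by exists (x * b), (x * d); split; [apply: ideal_mull|ring].
Qed.

Lemma iadd_hideal J f d : homog d f -> is_hideal J -> is_hideal (iadd J f).
Proof.
move=> df [Ji Jh]; split; first exact: iadd_ideal.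
move=> _ e [a [c [Ja ->]]]; rewrite linearD /= (pihomogMr _ _ df).
case: leqP => _; last by rewrite addr0; apply: iadd_sub; apply: Jh.
by exists (pihomog mdeg e a), (pihomog mdeg (e - d) c); split=> //; apply: Jh.
Qed.

(** Taking components of degree [n] turns both summands into forms; if [n] is smaller than the
    degree of [f], nothing of the second remains. *)
Lemma iadd_homog J f d n x : homog d f -> is_hideal J -> homog n x ->
  iadd J f x -> exists a c, [/\ J a, homog n a, x = a + c * f &
    ((d <= n)%N /\ homog (n - d) c) \/ c = 0].
Proof.
move=> df [Ji Jh] nx [a [c [Ja xE]]].
have := pihomog_homog nx; rewrite {1}xE linearD /= (pihomogMr _ _ df) => <-.
case: leqP => dn.
  exists (pihomog mdeg n a), (pihomog mdeg (n - d) c); split=> //.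
  - exact: Jh.
  - exact: homog_pihomog.
  - by left; split=> //; apply: homog_pihomog.
exists (pihomog mdeg n a), 0; split; [exact: Jh|exact: homog_pihomog| |by right].
by rewrite mul0r.
Qed.

Lemma iadd_proper J f : is_ideal J -> ~ J f -> J `<` iadd J f.
Proof.
move=> Ji Jf; split; first exact: iadd_sub.
by move=> /(_ f (iadd_mem f Ji)).
Qed.

(** The product of the top components of two factors is the top component of their product. One of
    the two therefore lies in [J] and can be removed; the induction is on the total number of
    components. *)
Lemma homog_prime J : is_hideal J ->
  (forall d e f g, homog d f -> homog e g -> J (f * g) -> J f \/ J g) ->
  is_prime J.
Proof.
move=> [Ji Jh] H.
have low (F G : nat -> A) k l n : (forall i, homog i (F i)) ->
    (forall i, homog i (G i)) -> (k + l <= n.+1)%N ->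
    pihomog mdeg n ((\sum_(i < k) F i) * (\sum_(j < l) G j)) = 0.
  move=> hF hG le; rewrite mulr_suml linear_sum big1 // => i _.
  rewrite mulr_sumr linear_sum big1 //= => j _.
  apply: (@pihomog_ne0 _ _ _ (i + j)%N); last exact: homogM.
  by have := ltn_ord i; have := ltn_ord j; lia.
have main (F G : nat -> A) : (forall i, homog i (F i)) ->
    (forall i, homog i (G i)) -> forall n k l, (k + l = n)%N ->
    J ((\sum_(i < k) F i) * (\sum_(j < l) G j)) ->
    J (\sum_(i < k) F i) \/ J (\sum_(j < l) G j).
  move=> hF hG; elim=> [|n IH] k l kl.
    case: k kl => [|//] _ _; left; rewrite big_ord0; exact: (ideal_zero Ji).
  case: k kl => [|k] kl; first by rewrite big_ord0 => _; left; exact: (ideal_zero Ji).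
  case: l kl => [|l] kl; first by move=> _; right; rewrite big_ord0; exact: (ideal_zero Ji).
  move=> Jab.
  have : J (F k * G l).
    have := Jh _ (k + l)%N Jab.
    rewrite [X in X * _]big_ord_recr /= mulrDl linearD /= low ?add0r //; last by lia.
    rewrite big_ord_recr /= mulrDr linearD /= (pihomog_homog (homogM (hF k) (hG l))).
    suff -> : pihomog mdeg (k + l) (F k * \sum_(i < l) G i) = 0 by rewrite add0r.
    rewrite mulr_sumr linear_sum big1 //= => j _.
    apply: (@pihomog_ne0 _ _ _ (k + j)%N); last exact: homogM.
    by have := ltn_ord j; lia.
  case/(H _ _ _ _ (hF k) (hG l)) => Jt.
    have /(IH _ l.+1) : (k + l.+1 = n)%N by lia.
    have Jp : J ((\sum_(i < k) F i) * \sum_(j < l.+1) G j).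
      have := ideal_sub Ji Jab (ideal_mulr Ji (\sum_(j < l.+1) G j) Jt).
      by rewrite -mulrBl big_ord_recr /= addrK.
    by case/(_ Jp) => Jx; [left; rewrite big_ord_recr; apply: ideal_add|right].
  have /(IH k.+1) : (k.+1 + l = n)%N by lia.
  have Jp : J ((\sum_(i < k.+1) F i) * \sum_(j < l) G j).
    have := ideal_sub Ji Jab (ideal_mull Ji (\sum_(j < k.+1) F j) Jt).
    by rewrite -mulrBr [in X in J X](big_ord_recr l) /= addrK.
  by case/(_ Jp) => Jx; [left|right; rewrite big_ord_recr; apply: ideal_add].
move=> a b Jab; rewrite [a]homog_decomp [b]homog_decomp.
by apply: (main (pihomog mdeg ^~ a) (pihomog mdeg ^~ b)) erefl _;
  rewrite -?homog_decomp // => i; apply: homog_pihomog.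
Qed.

(** This alternative drives every noetherian induction below, in place of primary decomposition:
    either [J] is prime, or [iadd J f] and [iadd J g] are strictly larger while their product is
    contained in [J]. *)
Lemma hideal_prime_or_split J : is_hideal J -> is_prime J \/
  exists d e f g, [/\ homog d f, homog e g, ~ J f, ~ J g & J (f * g)].
Proof.
move=> Jh; set S := (S in _ \/ S); have [|H] := pselect S; first by right.
left; apply: homog_prime => // d e f g df eg Jfg.
apply: contrapT => /not_orP[nf ng]; apply: H.
by exists d, e, f, g.
Qed.

Lemma hideal_ind (Pr : set A -> Prop) :
  (forall J, is_hideal J ->
    (forall J', is_hideal J' -> J `<` J' -> Pr J') -> Pr J) ->
  forall J, is_hideal J -> Pr J.
Proof.
move=> step J Jh; have [Ji _] := Jh; move: J Ji Jh.
apply: (@noetherian_ind _ _ (fun J => is_hideal J -> Pr J)) => J Ji IH Jh.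
by apply: step => // J' J'h JJ'; apply: IH => //; have [] := J'h.
Qed.

(** A zero of [J] in the chart where the coordinate [i] is invertible. If both larger ideals of a
    splitting contained a power of this coordinate, multiplying the two would put a power into
    [J]. *)
Lemma exists_prime J i : is_hideal J -> (forall m, ~ J (var i ^+ m)) ->
  exists2 Q, J `<=` idl Q & ~ idl Q (var i).
Proof.
move: J; apply: hideal_ind => J Jh IH Jm.
have Ji := Jh.1.
have [Jp|[d [e [f [g [df eg nf ng Jfg]]]]]] := hideal_prime_or_split Jh.
  have nJ : ~ J (var i) by have := Jm 1%N; rewrite expr1.
  have [Q QJ] := pvar_of_prime Jh Jp nJ.
  by exists Q; rewrite QJ.
have try h dh : homog dh h -> ~ J h -> (forall m, ~ iadd J h (var i ^+ m)) ->
    exists2 Q, J `<=` idl Q & ~ idl Q (var i).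
  move=> hd nh /(IH _ (iadd_hideal hd Jh) (iadd_proper Ji nh))[Q sQ nQ].
  by exists Q => //; apply: subset_trans sQ; apply: iadd_sub.
have [/(try _ _ df nf)//|/existsNP[m /contrapT[a [c [Ja ac]]]]] :=
  pselect (forall m, ~ iadd J f (var i ^+ m)).
have [/(try _ _ eg ng)//|/existsNP[n /contrapT[b [c' [Jb bc]]]]] :=
  pselect (forall m, ~ iadd J g (var i ^+ m)).
exfalso; apply: (Jm (m + n)%N); rewrite exprD ac bc.
have -> : (a + c * f) * (b + c' * g) =
    (b + c' * g) * a + (c * f) * b + (c * c') * (f * g) by ring.
by apply: ideal_add => //; [apply: ideal_add => //|]; apply: ideal_mull.
Qed.

End Homogeneous.

(** * Nullstellensatz *)

Section LinearFractions.
Variables (k : closedFieldType) (K : fieldType) (f : {rmorphism k -> K}) (t : K).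
Hypothesis t_transc : forall c, t != f c.

(** Clearing denominators produces a polynomial over [k] with root [t]. As [k] is algebraically
    closed, a nonzero one has its roots in the image of [k], so this one is zero; its value at [c i]
    isolates [l i]. *)
Lemma linear_fractions_free m (c l : 'I_m -> k) : injective c ->
  \sum_(i < m) f (l i) / (t - f (c i)) = 0 -> forall i, l i = 0.
Proof.
move=> inj_c sum0.
pose p := \sum_(i < m) l i *: \prod_(j < m | j != i) ('X - (c j)%:P).
have p0 : p = 0.
  apply: contra_eq sum0 => p_neq0; apply/eqP => sum0.
  have [r rE] := closed_field_poly_normal p.
  have : (map_poly f p).[t] = 0.
    rewrite rmorph_sum /= horner_sum.
    rewrite (eq_bigr (fun i => (\prod_(j < m) (t - f (c j))) * (f (l i) / (t - f (c i))))).
      by rewrite -mulr_sumr sum0 mulr0.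
    move=> i _; rewrite map_polyZ hornerZ rmorph_prod horner_prod /=.
    under eq_bigr do rewrite map_polyXsubC hornerXsubC.
    rewrite [in RHS](bigD1 i) //=; set P := \prod_(j < m | _) _.
    have ne : t - f (c i) != 0 by rewrite subr_eq0.
    by field.
  rewrite rE map_polyZ hornerZ rmorph_prod horner_prod /= => /eqP.
  rewrite mulf_eq0 fmorph_eq0 lead_coef_eq0 (negbTE p_neq0) /= prodf_seq_eq0.
  case/hasP => z _; rewrite map_polyXsubC hornerXsubC subr_eq0 => /eqP tz.
  by have := t_transc z; rewrite tz eqxx.
move=> i; have := congr1 (fun q => q.[c i]) p0.
rewrite horner0 horner_sum (bigD1 i) //= [X in _ + X]big1 => [|j ji].
  rewrite addr0 hornerZ horner_prod => /eqP; rewrite mulf_eq0 => /orP[/eqP//|].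
  rewrite prodf_seq_eq0 => /hasP[j _ /andP[ji]].
  by rewrite hornerXsubC subr_eq0 => /eqP/inj_c e; rewrite e eqxx in ji.
rewrite hornerZ horner_prod (bigD1 i) 1?eq_sym //= hornerXsubC subrr mul0r mulr0.
by [].
Qed.

End LinearFractions.

(** A countable set of reals has Lebesgue measure zero, whereas the unit interval has measure
    one. *)
Lemma uncountable_complex (R : realType) : ~ countable [set: R[i]].
Proof.
move=> ct.
have cR : countable [set: R].
  apply/countable_injP; have /countable_injP[h hi] := ct.
  exists (fun x => h (real_complex R x)) => x y _ _ e.
  have := hi (real_complex R x) (real_complex R y).
  by rewrite !inE => /(_ I I e) [].
have := @countable_lebesgue_measure0 R `[0, 1]%classic.
rewrite lebesgue_measure_itv /= lte_fin ltr01 oppr0 adde0 => /(_ _)/eqP.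
rewrite onee_eq0 => H; have : false by apply: H; apply: sub_countable cR; apply: subset_card_le.
by [].
Qed.

Lemma uncountable_fiber (R : realType) (u : R[i] -> nat) :
  exists n, infinite_set [set c | u c = n].
Proof.
apply: contrapT => /forallNP H; apply: (@uncountable_complex R).
have -> : [set: R[i]] = \bigcup_(n in [set: nat]) [set c | u c = n].
  by apply/seteqP; split=> // c _; exists (u c).
apply: bigcup_countable => // n _; apply: finite_set_countable.
exact: contrapT (H n).
Qed.

(** Applied with [y] a coordinate and [g] the class of a form of degree [m]: the inverses with the
    same [m] all lie in one finite-dimensional space. *)
Lemma linear_fraction_inv (F : fieldType) (g x y c : F) m : y != 0 ->
  x / y != c -> y ^+ m.+1 = g * (x - c * y) -> (x / y - c)^-1 = g / y ^+ m.
Proof.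
move=> y0; rewrite -subr_eq0 => xyc E; have ym : y ^+ m != 0 by rewrite expf_neq0.
apply: (mulIf xyc); rewrite mulVf //; apply: (mulIf ym); apply: (mulIf y0).
by rewrite mul1r -exprSr E; field; rewrite y0 ym.
Qed.

(** * Local rings as fractions of forms, and coordinates of closed points *)

Section LocalRings.
Variables (R : realType) (N : nat).
Local Notation A := (mpoly N.+1 R[i]).
Local Notation pvar := (pvar R N).
Implicit Types (J : set A) (a b f g : A) (X Z P Q C : pvar).

Lemma hcls_eq0 X a : hcls X a = 0 <-> idl X a.
Proof.
rewrite /hcls; split=> [/eqP|Xa].
  rewrite tofrac_eq0 => /eqP e; rewrite idlE -[a]subr0 Quotient.idealrBE.
  by apply/eqP; rewrite e rmorph0.
apply/eqP; rewrite tofrac_eq0; apply/eqP.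
rewrite -[RHS](rmorph0 (\pi_({ideal_quot (ideal X : {pred A})}))).
by apply/eqP; rewrite -Quotient.idealrBE subr0.
Qed.

Lemma hcls_neq0 X a : ~ idl X a -> hcls X a != 0.
Proof. by move=> Xa; apply/eqP => /hcls_eq0. Qed.

Lemma hcls_eq X a b : hcls X a = hcls X b <-> idl X (a - b).
Proof. by rewrite -hcls_eq0 rmorphB /=; split=> [->|/subr0_eq//]; rewrite subrr. Qed.

Lemma fraction_num_den (D : idomainType) (x : {fraction D}) :
  exists n d : D, d != 0 /\ x = tofrac n / tofrac d.
Proof.
elim/quotW: x => -[[n d] /= d0]; exists n, d; split=> //.
apply: (canRL (mulfK _)); first by rewrite tofrac_eq0.
unlock tofrac; rewrite -[LHS]FracField.pi_mul; apply/eqmodP.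
rewrite /= FracField.equivfE /FracField.mulf /=.
by rewrite !numden_Ratio ?mulf_neq0 ?oner_neq0 //= !mulr1 mulrC.
Qed.

Lemma hfrac_num_den X (phi : hfrac X) :
  exists a b, ~ idl X b /\ phi = hcls X a / hcls X b.
Proof.
have [n [d [d0 ->]]] := fraction_num_den phi.
exists (repr n), (repr d); rewrite /hcls !reprK; split=> // /hcls_eq0.
by rewrite /hcls reprK => /eqP; rewrite tofrac_eq0 (negbTE d0).
Qed.

Lemma relevant Z : exists i, ~ idl Z (var R i).
Proof. by have [i iZ] := ideal_relevant Z; exists i; rewrite idlE; apply/negP. Qed.

Lemma idl_exp Z a n : ~ idl Z a -> ~ idl Z (a ^+ n).
Proof.
move=> Za; elim: n => [|n IH]; first by rewrite expr0; apply: idl1.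
by rewrite exprS => /idl_prime[].
Qed.

Lemma idl_mul Z a b : ~ idl Z a -> ~ idl Z b -> ~ idl Z (a * b).
Proof. by move=> Za Zb /idl_prime[]. Qed.

Lemma exists_denominator Z d : exists b, homog d b /\ ~ idl Z b.
Proof.
have [i iZ] := relevant Z; exists (var R i ^+ d).
by split; [apply: homog_varX|apply: idl_exp].
Qed.

(** For a homogeneous ideal [J] this is its extension to the local ring at [Z], and [setT] gives the
    local ring itself. Arbitrary sets are allowed, so that multiples of a single form are covered
    too. *)
Definition loc X Z J : set (hfrac X) := [set phi | exists d a b,
  [/\ J a, homog d a, homog d b, ~ idl Z b & phi = hcls X a / hcls X b]].
Arguments loc : clear implicits.

Lemma local_ringE X Z : local_ring X Z = loc X Z setT.
Proof.
apply/seteqP; split=> [phi [a [b [[d /andP[da db]] Zb ->]]]|phi [d [a [b [_ da db Zb ->]]]]].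
  by exists d, a, b; split=> //; exact/negP.
exists a, b; split=> //; first by exists d; rewrite da db.
exact/negP.
Qed.

Section Subvar.
Variables (X Z : pvar).
Hypothesis ZX : subvar Z X.
Lemma hcls_neq0_off b : ~ idl Z b -> hcls X b != 0.
Proof. by move=> Zb; apply: hcls_neq0 => Xb; apply: Zb; apply: ZX. Qed.

Lemma locD J x y : is_ideal J -> loc X Z J x -> loc X Z J y -> loc X Z J (x + y).
Proof.
move=> Ji [d [a [b [Ja da db Zb ->]]]] [e [a' [b' [Ja' da' db' Zb' ->]]]].
exists (d + e)%N, (a * b' + a' * b), (b * b'); split.
- by apply: ideal_add => //; apply: ideal_mulr.
- by apply: homogD; [|rewrite addnC]; apply: homogM.
- exact: homogM.
- exact: idl_mul.
- by rewrite addf_div ?hcls_neq0_off // -!rmorphM -rmorphD.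
Qed.

Lemma locM J1 J2 J x y : (forall a b, J1 a -> J2 b -> J (a * b)) ->
  loc X Z J1 x -> loc X Z J2 y -> loc X Z J (x * y).
Proof.
move=> JM [d [a [b [Ja da db Zb ->]]]] [e [a' [b' [Ja' da' db' Zb' ->]]]].
exists (d + e)%N, (a * a'), (b * b'); split.
- exact: JM.
- exact: homogM.
- exact: homogM.
- exact: idl_mul.
- by rewrite mulf_div -!rmorphM.
Qed.

Lemma hfrac_scaleE (c : R[i]) (x : hfrac X) : c *: x = hcls X (mpolyC N.+1 c) * x.
Proof. by []. Qed.

Lemma loc_scalar c : local_ring X Z (hcls X (mpolyC N.+1 c)).
Proof.
rewrite local_ringE; exists 0%N, (mpolyC N.+1 c), 1.
split=> //; [exact: homog_C|exact: dhomog1|exact: idl1|].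
by rewrite rmorph1 divr1.
Qed.

Lemma local_ringM x y : local_ring X Z x -> local_ring X Z y -> local_ring X Z (x * y).
Proof. by rewrite local_ringE; apply: locM. Qed.

Lemma local_ringD x y : local_ring X Z x -> local_ring X Z y -> local_ring X Z (x + y).
Proof. by rewrite local_ringE; apply: locD. Qed.

Lemma local_ringZ c x : local_ring X Z x -> local_ring X Z (c *: x).
Proof. by rewrite hfrac_scaleE => ?; apply: local_ringM => //; apply: loc_scalar. Qed.

Lemma local_ring1 : local_ring X Z 1.
Proof. by have := loc_scalar 1; rewrite !rmorph1. Qed.

Lemma local_unit1 : local_unit Z (1 : hfrac X).
Proof. by split; rewrite ?invr1 ?oner_neq0 //; exact: local_ring1. Qed.

Lemma local_unitM (x y : hfrac X) :
  local_unit Z x -> local_unit Z y -> local_unit Z (x * y).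
Proof.
move=> [/eqP x0 Ox Oxi] [/eqP y0 Oy Oyi]; split.
- by apply: mulf_neq0; apply/eqP.
- exact: local_ringM.
- by rewrite invfM; apply: local_ringM.
Qed.

Lemma local_unitV (x : hfrac X) : local_unit Z x -> local_unit Z x^-1.
Proof. by move=> [x0 Ox Oxi]; split; rewrite ?invrK ?invr_eq0. Qed.

End Subvar.

Lemma subvar_refl X : subvar X X. Proof. by []. Qed.

Lemma subvar_trans Y X Z : subvar X Y -> subvar Y Z -> subvar X Z.
Proof. by rewrite !subvarP => h1 h2; apply: subset_trans h1. Qed.

(* Nullstellensatz over an uncountable field: otherwise the functions
   1 / (x_j / x_i - c) are uncountably many linearly independent elements of a
   space of countable dimension. *)
Lemma closed_point_coord P i j : closed_point P -> ~ idl P (var R i) ->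
  exists c, idl P (var R j - mpolyC N.+1 c * var R i).
Proof.
move=> Pcl Pi; apply: contrapT => /forallNP nc.
pose L c : A := var R j - mpolyC N.+1 c * var R i.
have hL c : homog 1 (L c).
  by apply: homogB; [|apply: homogZ]; apply: homog_var.
(* A common zero of [P] and [L c] with nonzero coordinate [i] would be a point of [P], hence [P]
   itself as [P] is closed. So a power of that coordinate lies in the ideal of [P] enlarged by
   [L c]. *)
have inv c : exists m, exists2 g, homog m g & idl P (var R i ^+ m.+1 - g * L c).
  have [/(exists_prime (iadd_hideal (hL c) (idl_hideal P)))[Q PQ Qi]|] :=
      pselect (forall m, ~ iadd (idl P) (L c) (var R i ^+ m)).
    exfalso; apply: (nc c); apply: (Pcl Q).
      by apply: subset_trans PQ; apply: iadd_sub.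
    by apply: PQ; apply: iadd_mem; apply: idl_ideal.
  move=> /existsNP[m /contrapT].
  move/(iadd_homog (hL c) (idl_hideal P) (homog_varX R i m)).
  move=> [a [g [Pa ha E [[m1 hg]|g0]]]]; last first.
    by case: (idl_exp (n := m) Pi); rewrite E g0 mul0r addr0.
  exists m.-1, g; first by move: hg; rewrite subn1.
  rewrite prednK // E addrK; exact: Pa.
have [u uP] := choice inv.
(* One degree [m] serves infinitely many [c]; it suffices to take one more of them than the
   dimension of the space of forms of degree [m]. *)
have [m minf] := uncountable_fiber u.
pose D : nat := \dim {: dhomog N.+1 R[i] m}.
have [B Bsub Bcard] := infinite_set_fset D.+1 minf.
pose c (k : 'I_D.+1) := nth 0 (finmap.enum_fset B) k.
have cB k : [set` B] (c k) by apply: mem_nth; apply: leq_trans Bcard.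
have uc k : u (c k) = m by exact: Bsub.
have c_inj : injective c.
  move=> k l /eqP; rewrite nth_uniq ?finmap.fset_uniq //; try by apply: leq_trans Bcard.
  by move/eqP/val_inj.
have ex k : exists g : dhomog N.+1 R[i] m,
    idl P (var R i ^+ m.+1 - mpoly_of_dhomog g * L (c k)).
  have [g hg] := uP (c k); rewrite uc in hg *.
  by exists (DHomog hg).
have [g gP] := choice ex.
pose X := [tuple g k | k < D.+1].
have : free X.
  apply/freeP => l; under eq_bigr do rewrite (nth_map ord0) ?size_enum_ord // nth_ord_enum.
  move/(congr1 (@mpoly_of_dhomog _ _ _)); rewrite raddf_sum /= => sum0.
  pose f : {rmorphism R[i] -> hfrac P} := hcls P \o @mpolyC N.+1 R[i].
  have xi0 : hcls P (var R i) != 0 by apply: hcls_neq0.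
  pose t := hcls P (var R j) / hcls P (var R i).
  have tf e : t != f e.
    apply/eqP => te; apply: (nc e); apply/hcls_eq0.
    by rewrite rmorphB rmorphM /= -[hcls P (mpolyC _ _)]/(f e) -te mulfVK // subrr.
  apply: (linear_fractions_free tf c_inj).
  have /(congr1 (fun q => hcls P q / hcls P (var R i) ^+ m)) := sum0.
  rewrite rmorph0 mul0r rmorph_sum mulr_suml /= => S0; apply: (etrans _ S0); apply: eq_bigr => k _.
  have /hcls_eq0 := gP k; rewrite rmorphB rmorphXn rmorphM /= => /subr0_eq E.
  rewrite -mul_mpolyC rmorphM /= -mulrA; congr (_ * _).
  apply: (linear_fraction_inv xi0 (tf (c k))).
  by rewrite [LHS]E /L rmorphB rmorphM.
rewrite /free size_tuple => /eqP fr.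
by have := dimvS (subvf <<X>>%VS); rewrite fr ltnn.
Qed.

End LocalRings.

Arguments loc {R N} X Z J _.

(** * Curves *)

Section ModSpan.
Variables (k : fieldType) (V : lmodType k).
Implicit Types (U : set V) (S : set V).

Inductive span_mod U S : set V :=
| span_mod_base x : U x -> span_mod U S x
| span_mod_step c v x : S v -> span_mod U S x -> span_mod U S (c *: v + x).

Definition is_subspace U : Prop :=
  [/\ U 0, forall x y, U x -> U y -> U (x + y) & forall c x, U x -> U (c *: x)].

Lemma span_modD U S x y : (forall a b, U a -> U b -> U (a + b)) ->
  span_mod U S x -> span_mod U S y -> span_mod U S (x + y).
Proof.
move=> UD + Sy; elim=> [a Ua|c v a Sv _ IH]; last by rewrite -addrA; right.
elim: Sy => [b Ub|c v b Sv _ IH]; first by left; apply: UD.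
by rewrite addrCA; right.
Qed.

Lemma span_modS U U' S S' x : U `<=` U' -> S `<=` S' -> span_mod U S x -> span_mod U' S' x.
Proof.
by move=> UU' SS'; elim=> [a /UU'|c v a /SS' Sv _ IH]; [left|right].
Qed.

End ModSpan.

Lemma mul_div_swap (F : fieldType) (c f h b : F) :
  h != 0 -> c * f / b = f / h * (c * h / b).
Proof. by move=> h0; rewrite [RHS]mulrA; congr (_ / b); field. Qed.

(** * Closed points of a curve and finiteness of its local quotients *)

Section Curves.
Variables (R : realType) (N : nat).
Local Notation A := (mpoly N.+1 R[i]).
Local Notation pvar := (pvar R N).
Implicit Types (J : set A) (a b f g : A) (X Z P Q C : pvar).

(** The residue field of a closed point is the field of complex numbers: modulo [P], every form is a
    constant times a power of a coordinate that does not vanish at [P]. *)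
Lemma closed_point_value P d a b : closed_point P -> homog d a -> homog d b ->
  ~ idl P b -> exists c, idl P (a - mpolyC N.+1 c * b).
Proof.
move=> Pcl da db Pb; have [i Pi] := relevant P.
have Pid := idl_ideal P.
have mono (m : multinom N.+1) : exists c : R[i],
    idl P (mpolyX R[i] m - mpolyC N.+1 c * var R i ^+ mdeg m).
  have [c cP] := choice (fun j => closed_point_coord j Pcl Pi).
  exists (\prod_j c j ^+ m j); rewrite mpolyXE_id mdegE.
  rewrite -prodrXr rmorph_prod -big_split /=.
  apply: (big_ind2 (fun x y => idl P (x - y))).
  - by rewrite subrr; apply: ideal_zero.
  - move=> x y x' y' h h'.
    have -> : x * x' - y * y' = x * (x' - y') + y' * (x - y) by ring.
    by apply: ideal_add => //; apply: ideal_mull.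
  - move=> j _; rewrite rmorphXn /= -exprMn subrXX; apply: ideal_mulr => //.
    exact: cP.
have val e x : homog e x -> exists c : R[i], idl P (x - mpolyC N.+1 c * var R i ^+ e).
  move=> /dhomogP he; have [c cP] := choice mono.
  exists (\sum_(m <- msupp x) mcoeff m x * c m).
  rewrite {1}(mpolyE x) rmorph_sum mulr_suml -sumrB big_seq.
  apply: ideal_sum => // m mx; rewrite rmorphM /= -mul_mpolyC -mulrA -mulrBr.
  by apply: ideal_mull => //; have := cP m; rewrite (he m mx).
have [u uP] := val d a da; have [v vP] := val d b db.
have v0 : v != 0.
  by apply: contra_notN Pb => /eqP v0; move: vP; rewrite v0 rmorph0 mul0r subr0.
exists (u / v).
have -> : a - mpolyC N.+1 (u / v) * b = (a - mpolyC N.+1 u * var R i ^+ d)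
   - mpolyC N.+1 (u / v) * (b - mpolyC N.+1 v * var R i ^+ d).
  have -> : mpolyC N.+1 u = mpolyC N.+1 (u / v) * mpolyC N.+1 v.
    by rewrite -rmorphM /= divfK.
  ring.
by apply: ideal_sub => //; apply: ideal_mull.
Qed.

(** The value 1 differs from the default 0 of [pdim], so it is a genuine maximal chain length. *)
Lemma pdim_curve C : pdim C = 1%N -> chain C 1 /\ forall m, chain C m -> (m <= 1)%N.
Proof.
rewrite /pdim => H; pose S := [set n | chain C n /\ forall m, chain C m -> (m <= n)%N].
have [exS|nS] := pselect (exists x, S x); first by have := xgetPex 0%N exS; rewrite H.
by move: H; rewrite xgetPN // => x Sx; apply: nS; exists x.
Qed.

(** A point strictly inside [Q] would give a chain of length 2 in the curve. *)
Lemma curve_closed C Q : pdim C = 1%N -> subvar Q C -> ~ subvar C Q -> closed_point Q.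
Proof.
move=> /pdim_curve[_ max] QC nQC P PQ; apply: contrapT => nPQ.
suff /max : chain C 2 by [].
exists (fun i => nth C [:: P; Q; C] i); split.
  by case=> [|[|[|//]]] _ //=; apply: subvar_trans PQ QC.
by case=> [|[|//]] _ /=.
Qed.

Lemma proper_neq J J' : J `<` J' -> ~ J' `<=` J. Proof. by case. Qed.

Lemma proper_sub_trans J1 J2 J3 : J1 `<` J2 -> J2 `<=` J3 -> J1 `<` J3.
Proof.
move=> [J12 n21] J23; split; first exact: subset_trans J23.
by move=> J31; apply: n21; apply: subset_trans J31.
Qed.

(** A zero of a splitting ideal is a zero of one of the two larger ideals. A prime ideal strictly
    above that of the curve is either a closed point, which is then the only zero, or irrelevant,
    without zeros. *)
Lemma finite_zeros C J : pdim C = 1%N -> is_hideal J -> idl C `<` J ->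
  finite_set [set P | closed_point P /\ J `<=` idl P].
Proof.
move=> C1; move: J; apply: hideal_ind => J Jh IH CJ.
have Ji := Jh.1.
have [Jp|[d [e [f [g [df eg nf ng Jfg]]]]]] := hideal_prime_or_split Jh.
  have [all_var|/existsNP[i Ji']] := pselect (forall i, J (var R i)).
    rewrite (_ : [set _ | _] = set0) //; apply/seteqP; split=> // P [_ JP].
    by have [i Pi] := relevant P; apply: Pi; apply: JP.
  have [Q QJ] := pvar_of_prime Jh Jp Ji'.
  apply: (@sub_finite_set _ _ [set Q]); last exact: finite_set1.
  move=> P [Pcl]; rewrite -QJ => PQ /=.
  have QC : closed_point Q.
    apply: (curve_closed C1); first by rewrite subvarP QJ; apply: properW.
    by rewrite subvarP QJ; apply: proper_neq.
  by apply: subvar_anti => //; apply: QC.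
have F (h : A) dh : homog dh h -> ~ J h ->
    finite_set [set P | closed_point P /\ iadd J h `<=` idl P].
  move=> hd nh; apply: IH; [exact: iadd_hideal hd Jh|exact: iadd_proper|].
  by apply: proper_sub_trans CJ _; apply: iadd_sub.
apply: (@sub_finite_set _ _ ([set P | closed_point P /\ iadd J f `<=` idl P] `|`
  [set P | closed_point P /\ iadd J g `<=` idl P])).
  move=> P [Pcl JP].
  have T (h : A) : idl P h -> iadd J h `<=` idl P.
    move=> Ph _ [a [c [Ja ->]]]; apply: (ideal_add (idl_ideal P) (JP _ Ja)).
    by apply: ideal_mull => //; apply: idl_ideal.
  by have [/T ?|/T ?] := idl_prime (JP _ Jfg); [left|right].
by rewrite finite_setU; split; [exact: (F _ _ df nf)|exact: (F _ _ eg ng)].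
Qed.

(** When [f * g] splits [J], the local ring modulo [J] is an extension of its quotient modulo [J]
    and [f] by the multiples of [f], and these are spanned by the images of generators modulo [J]
    and [g]. *)
Lemma local_ring_finite_mod C P J : pdim C = 1%N -> closed_point P -> subvar P C ->
  is_hideal J -> idl C `<` J ->
  exists s : seq (hfrac C), local_ring C P `<=` span_mod (loc C P J) [set` s].
Proof.
move=> C1 Pcl PC; move: J; apply: hideal_ind => J Jh IH CJ.
have [Ji Jhom] := Jh.
have [Jp|[d [e [f [g [df eg nf ng Jfg]]]]]] := hideal_prime_or_split Jh.
  have [JP|/existsNP[a /not_implyP[Ja Pa]]] := pselect (J `<=` idl P); last first.
    (* Some homogeneous component of [a] does not vanish at [P]; the quotient is then zero and the
       empty family spans it. *)
    have [dd Pad] : exists dd, ~ idl P (pihomog mdeg dd a).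
      apply: contrapT => /forallNP h; apply: Pa; rewrite (homog_decomp a).
      by apply: (ideal_sum (idl_ideal P)) => i _; apply: contrapT (h i).
    exists [::] => x; rewrite local_ringE => -[n [u [v [_ hu hv Pv ->]]]].
    left; set b := pihomog mdeg dd a in Pad.
    exists (n + dd)%N, (u * b), (v * b); split.
    - by apply: ideal_mull => //; apply: Jhom.
    - by apply: homogM => //; apply: homog_pihomog.
    - by apply: homogM => //; apply: homog_pihomog.
    - exact: idl_mul.
    - have b0 : hcls C b != 0 by apply: hcls_neq0_off Pad.
      by rewrite !rmorphM -mulf_div divff // mulr1.
  have [i Pi] := relevant P.
  have [Q QJ] := pvar_of_prime Jh Jp (fun h => Pi (JP _ h)).
  have Qcl : closed_point Q.
    apply: (curve_closed C1); first by rewrite subvarP QJ; apply: properW.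
    by rewrite subvarP QJ; apply: proper_neq.
  (* Here [J] is the ideal of [P], and the quotient is the residue field, spanned by 1. *)
  have PJ : idl P `<=` J by rewrite -QJ; apply: (Qcl P); rewrite subvarP QJ.
  exists [:: 1] => x; rewrite local_ringE => -[n [u [v [_ hu hv Pv ->]]]].
  have [c cP] := closed_point_value Pcl hu hv Pv.
  have v0 : hcls C v != 0 by apply: hcls_neq0_off Pv.
  have -> : hcls C u / hcls C v =
      c *: (1 : hfrac C) + hcls C (u - mpolyC N.+1 c * v) / hcls C v.
    rewrite hfrac_scaleE rmorphB rmorphM mulrBl mulfK // mulr1.
    by rewrite addrCA subrr addr0.
  right; first by rewrite /= inE.
  left; exists n, (u - mpolyC N.+1 c * v), v; split=> //; first exact: PJ.
  by apply: homogB => //; apply: homogZ.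
have F (h : A) dh : homog dh h -> ~ J h -> exists s : seq (hfrac C),
    local_ring C P `<=` span_mod (loc C P (iadd J h)) [set` s].
  move=> hd nh; apply: IH; [exact: iadd_hideal hd Jh|exact: iadd_proper|].
  by apply: proper_sub_trans CJ _; apply: iadd_sub.
have [s sP] := F f d df nf; have [t tP] := F g e eg ng.
have [h [dh Ph]] := exists_denominator P d.
(* Division by a form of the same degree that is nonzero at [P] turns [f] into an element of the
   local ring. *)
pose w := hcls C f / hcls C h.
exists (s ++ [seq w * y | y <- t]) => x /sP.
have wg y : loc C P (iadd J g) y -> loc C P J (w * y).
  have wf : loc C P [set f] w by exists d, f, h; split.
  move=> Jy; apply: (locM _ wf Jy) => a b /= -> [j [c [Jj ->]]].
  rewrite mulrDr; apply: ideal_add => //; first exact: ideal_mull.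
  by rewrite mulrCA; apply: ideal_mull.
have wspan y : span_mod (loc C P (iadd J g)) [set` t] y ->
    span_mod (loc C P J) [set` s ++ [seq w * y | y <- t]] (w * y).
  elim=> [z /wg|c v z tv _ IHz]; first by left.
  have -> : w * (c *: v + z) = c *: (w * v) + w * z.
    by rewrite mulrDr !hfrac_scaleE mulrCA.
  right => //.
  by rewrite /= mem_cat map_f ?orbT.
elim=> [{}x|c v {}x sv _]; last first.
  by right => //; rewrite /= mem_cat (_ : v \in s).
move=> [n [a [b [Ja hna hnb Pb ->]]]].
have [u [c [Ju hu -> [[dn hc]|->]]]] := iadd_homog df Jh hna Ja; last first.
  by left; exists n, u, b; split=> //; rewrite mul0r addr0.
rewrite rmorphD mulrDl; apply: span_modD.
- by move=> y z; exact: (locD PC Ji).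
- by left; exists n, u, b; split.
have -> : hcls C (c * f) / hcls C b = w * (hcls C (c * h) / hcls C b).
  have h0 : hcls C h != 0 by apply: hcls_neq0_off Ph.
  by rewrite !rmorphM; apply: mul_div_swap.
apply: wspan; apply: tP; rewrite local_ringE; exists n, (c * h), b; split=> //.
by rewrite -(subnK dn); apply: homogM.
Qed.

End Curves.

(** * Dimensions of quotients *)

Section Dimension.
Variables (R : realType) (k : fieldType) (V : lmodType k).
Implicit Types (U W : set V).

Definition free_mod U m (v : 'I_m -> V) : Prop :=
  forall c : 'I_m -> k, U (\sum_(i < m) c i *: v i) -> forall i, c i = 0.

Definition basis_mod W U m (v : 'I_m -> V) : Prop :=
  [/\ forall i, W (v i), free_mod U v & W `<=` span_mod U (range v)].

Section Subspace.
Variable U : set V.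
Hypothesis Us : is_subspace U.

Lemma subspaceD x y : U x -> U y -> U (x + y).
Proof. by case: Us => _ UD _; apply: UD. Qed.
Lemma subspaceZ c x : U x -> U (c *: x).
Proof. by case: Us => _ _ UZ; apply: UZ. Qed.
Lemma subspaceB x y : U x -> U y -> U (x - y).
Proof. by move=> Ux Uy; apply: subspaceD => //; rewrite -scaleN1r; apply: subspaceZ. Qed.
Lemma subspace_sum m (F : 'I_m -> V) : (forall i, U (F i)) -> U (\sum_i F i).
Proof.
by move=> H; apply: big_ind => //; [case: Us|exact: subspaceD].
Qed.

Lemma span_mod_coef m (v : 'I_m -> V) x : span_mod U (range v) x ->
  exists c : 'I_m -> k, U (x - \sum_i c i *: v i).
Proof.
elim=> [y Uy|a _ y [i _ <-] _ [c cP]].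
  by exists (fun=> 0); rewrite big1 ?subr0 // => i _; rewrite scale0r.
exists (fun j => (if j == i then a else 0) + c j).
under eq_bigr do rewrite scalerDl.
rewrite big_split /= opprD addrACA (bigD1 i) //= eqxx big1 ?addr0 ?subrr ?add0r //.
by move=> j /negbTE ->; rewrite scale0r.
Qed.

Lemma coef_span_mod m (v : 'I_m -> V) x (c : 'I_m -> k) :
  U (x - \sum_i c i *: v i) -> span_mod U (range v) x.
Proof.
move=> H; rewrite -(subrK (\sum_i c i *: v i) x).
move: (x - _) H => y Uy.
suff gen (r : seq 'I_m) : span_mod U (range v) (y + \sum_(i <- r) c i *: v i).
  exact: gen.
elim: r => [|i r IH]; first by rewrite big_nil addr0; left.
by rewrite big_cons addrCA; right.
Qed.

(** Steinitz exchange in matrix form: with more rows than columns the coefficient matrix has a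
    nonzero left kernel vector, which is a relation modulo [U]. *)
Lemma free_mod_le m n (v : 'I_m -> V) (w : 'I_n -> V) : free_mod U v ->
  (forall i, span_mod U (range w) (v i)) -> (m <= n)%N.
Proof.
move=> vfree vw; rewrite leqNgt; apply/negP => nm.
have [M MP] := choice (fun i => span_mod_coef (vw i)).
pose B := \matrix_(i < m, j < n) M i j.
have : kermx B != 0.
  rewrite -mxrank_eq0 mxrank_ker subn_eq0 -ltnNge.
  exact: leq_ltn_trans (rank_leq_col _) nm.
case/rowV0Pn => u /sub_kermxP uB u0.
have := vfree (fun i => u 0 i).
have -> : \sum_i u 0 i *: v i = \sum_i u 0 i *: (v i - \sum_j M i j *: w j).
  under [RHS]eq_bigr do rewrite scalerBr.
  rewrite sumrB [X in _ = _ - X](_ : _ = 0) ?subr0 //.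
  under eq_bigr do rewrite scaler_sumr.
  rewrite exchange_big big1 //= => j _.
  under eq_bigr do rewrite scalerA.
  rewrite -scaler_suml; have /rowP/(_ j) := uB; rewrite !mxE => E.
  by under eq_bigr do [rewrite -[M _ j](mxE matrix_key (fun i j => M i j))]; rewrite E scale0r.
move=> /(_ (subspace_sum (fun i => subspaceZ _ (MP i)))) uE.
by case/eqP: u0; apply/rowP => i; rewrite uE mxE.
Qed.

Lemma ldim_basis W m (v : 'I_m -> V) : basis_mod W U v ->
  ldim R W U = (m%:R)%:E.
Proof.
move=> [Wv vfree vspan]; apply/eqP; rewrite eq_le; apply/andP; split.
  apply: ub_ereal_sup => _ [n [w Ww wfree] <-].
  by rewrite lee_fin ler_nat; apply: (free_mod_le wfree) => i; apply: vspan.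
by apply: ereal_sup_ubound; exists m => //; exists v.
Qed.

Lemma maximal_free_span W m (v : 'I_m -> V) : (forall i, W (v i)) -> free_mod U v ->
  (forall n (w : 'I_n -> V), (forall i, W (w i)) -> free_mod U w -> (n <= m)%N) ->
  basis_mod W U v.
Proof.
move=> Wv vfree vmax; split=> // x Wx; apply: contrapT => nx.
pose w (i : 'I_m.+1) := if unlift ord0 i is Some j then v j else x.
suff /(vmax _ w) : free_mod U w.
  rewrite ltnn => H; have : false by apply: H => i; rewrite /w; case: unliftP => [j|] _.
  by [].
have wE (c : 'I_m.+1 -> k) : \sum_i c i *: w i =
    c ord0 *: x + \sum_i c (lift ord0 i) *: v i.
  rewrite big_ord_recl /w unlift_none; congr (_ + _).
  by apply: eq_bigr => i _; rewrite liftK.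
move=> c; rewrite wE => Uc.
have c0 : c ord0 = 0.
  apply/eqP; apply: contrapT => /negP c0; apply: nx.
  apply: (@coef_span_mod _ _ _ (fun i => - (c ord0)^-1 * c (lift ord0 i))).
  have -> : x - \sum_i (- (c ord0)^-1 * c (lift ord0 i)) *: v i =
      (c ord0)^-1 *: (c ord0 *: x + \sum_i c (lift ord0 i) *: v i).
    rewrite scalerDr scalerA mulVf // scale1r scaler_sumr -sumrN; congr (_ + _).
    by apply: eq_bigr => i _; rewrite scalerA mulNr scaleNr opprK.
  exact: subspaceZ.
move: Uc; rewrite c0 scale0r add0r => /vfree Uc i.
by case: (unliftP ord0 i) => [j ->|->].
Qed.

Lemma bounded_basis W n : (forall m (w : 'I_m -> V), (forall i, W (w i)) ->
    free_mod U w -> (m <= n)%N) ->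
  exists m (v : 'I_m -> V), basis_mod W U v.
Proof.
move=> bound.
pose Pn m := `[< exists2 w : 'I_m -> V, (forall i, W (w i)) & free_mod U w >].
have ex : exists m, Pn m.
  by exists 0%N; apply/asboolP; exists (fun=> 0) => [[]|c _ []].
have ub m : Pn m -> (m <= n)%N by move=> /asboolP[w Ww]; apply: bound.
case: (ex_maxnP ex ub) => m /asboolP[v Wv vfree] vmax.
exists m, v; apply: maximal_free_span => // p w Ww wfree.
by apply: vmax; apply/asboolP; exists w.
Qed.

Lemma finite_basis W (s : seq V) : W `<=` span_mod U [set` s] ->
  exists m (v : 'I_m -> V), basis_mod W U v.
Proof.
move=> Ws; apply: (@bounded_basis _ (size s)) => n w Ww wfree.
apply: (@free_mod_le _ _ w (tnth (in_tuple s))) => // i.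
apply: (span_modS (U := U) (S := [set` s])) => // [x /= xs|].
  by have /tnthP[j ->] : x \in in_tuple s by []; exists j.
exact: Ws.
Qed.

(** A supremum of natural numbers that equals [n] is attained: without a free family of length [n],
    all lengths would be at most [n - 1]. *)
Lemma ldim_finite W n : ldim R W U = (n%:R)%:E ->
  (exists2 v : 'I_n -> V, (forall i, W (v i)) & free_mod U v) /\
  forall m (w : 'I_m -> V), (forall i, W (w i)) -> free_mod U w -> (m <= n)%N.
Proof.
move=> dimn.
have ub m (w : 'I_m -> V) : (forall i, W (w i)) -> free_mod U w -> (m <= n)%N.
  move=> Ww wfree; rewrite -(ler_nat R) -lee_fin -dimn.
  by apply: ereal_sup_ubound; exists m => //; exists w.
split=> //; case: n dimn ub => [|n] dimn ub.
  by exists (fun=> 0) => [[]|c _ []].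
apply: contrapT => nv.
suff : (ldim R W U <= (n%:R)%:E)%E by rewrite dimn lee_fin ler_nat ltnn.
apply: ub_ereal_sup => _ [m [w Ww wfree] <-]; rewrite lee_fin ler_nat.
have := ub _ _ Ww wfree; rewrite leq_eqVlt => /predU1P[mn|//].
by subst m; case: nv; exists w.
Qed.

End Subspace.
End Dimension.

(** * Orders on curves *)

Section Order.
Variables (R : realType) (N : nat) (C P : pvar R N).
Hypotheses (C1 : pdim C = 1%N) (Pcl : closed_point P) (PC : subvar P C).
Implicit Types a b x y phi psi : hfrac C.

Let O : set (hfrac C) := local_ring C P.

Definition principal a : set (hfrac C) := [set a * x | x in local_ring C P].

Lemma scale_hfracAr (X : pvar R N) c (x y : hfrac X) : x * (c *: y) = c *: (x * y).
Proof. by rewrite !hfrac_scaleE mulrCA. Qed.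

Lemma principal_subspace a : is_subspace (principal a).
Proof.
split=> [|_ _ [x Ox <-] [y Oy <-]|c _ [x Ox <-]].
- exists 0; last by rewrite mulr0.
  rewrite local_ringE; exists 0%N, 0, 1.
  split=> //; [exact: homog0|exact: dhomog1|exact: idl1|].
  by rewrite rmorph0 mul0r.
- by exists (x + y); [exact: local_ringD|rewrite mulrDr].
- by exists (c *: x); [exact: local_ringZ|rewrite scale_hfracAr].
Qed.

(** With [a = f / g], a fraction [c * f / v] is [a] times [c * g / v]. The extension of the ideal of
    [C] enlarged by [f] therefore lies in the principal ideal, and [local_ring_finite_mod]
    applies. *)
Lemma principal_finite a : O a -> a <> 0 ->
  exists m (v : 'I_m -> hfrac C), basis_mod O (principal a) v.
Proof.
move=> Oa a0.
have [d [f [g [_ df dg Pg aE]]]] : loc C P setT a by rewrite -local_ringE.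
subst a; have Cf : ~ idl C f by move=> /hcls_eq0 f0; apply: a0; rewrite f0 mul0r.
have Ci := idl_ideal C.
have Jh : is_hideal (iadd (idl C) f) by apply: iadd_hideal df (idl_hideal C).
have [s sP] := local_ring_finite_mod C1 Pcl PC Jh (iadd_proper Ci Cf).
apply: (finite_basis (principal_subspace _) (s := s)) => x /sP.
apply: span_modS => // {}x.
move=> [n [u [v [Ju hu hv Pv ->]]]].
have [w [c [Cw hw -> [[dn hc]|->]]]] := iadd_homog df (idl_hideal C) hu Ju; last first.
  exists 0; first by case: (principal_subspace 1) => -[z Oz zE] _ _; rewrite -zE mul1r.
  have /hcls_eq0 -> : idl C (w + 0 * f) by rewrite mul0r addr0.
  by rewrite mulr0 mul0r.
exists (hcls C (c * g) / hcls C v).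
  rewrite local_ringE; exists n, (c * g), v; split=> //.
  by rewrite -(subnK dn); apply: homogM.
have /hcls_eq0 w0 := Cw; have g0 : hcls C g != 0 by apply: hcls_neq0_off Pg.
by rewrite rmorphD /= w0 add0r !rmorphM /=; symmetry; apply: mul_div_swap.
Qed.

Lemma colength_basis a m (v : 'I_m -> hfrac C) :
  basis_mod O (principal a) v -> colength P a = m%:R.
Proof. by move=> /(ldim_basis R (principal_subspace a)); rewrite /colength => ->. Qed.

(** A basis modulo [a] together with [a] times a basis modulo [b] is a basis modulo [a * b],
    reflecting the exact sequence O/b -> O/ab -> O/a. *)
Lemma colengthM a b : O a -> a <> 0 -> O b -> b <> 0 ->
  colength P (a * b) = colength P a + colength P b.
Proof.
move=> Oa a0 Ob b0.
have [m [v vB]] := principal_finite Oa a0; have [n [w wB]] := principal_finite Ob b0.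
rewrite (colength_basis vB) (colength_basis wB) -natrD.
have [Ov vfree vspan] := vB; have [Ow wfree wspan] := wB.
pose z (i : 'I_(m + n)) := match fintype.split i with inl j => v j | inr j => a * w j end.
have zE (c : 'I_(m + n) -> R[i]) : \sum_i c i *: z i =
    \sum_i c (lshift n i) *: v i + a * \sum_j c (rshift m j) *: w j.
  rewrite big_split_ord mulr_sumr; congr (_ + _); apply: eq_bigr => i _.
    by rewrite /z (unsplitK (inl i)).
  by rewrite /z (unsplitK (inr i)) scale_hfracAr.
have Os : is_subspace O.
  have := principal_subspace 1; congr is_subspace; apply/seteqP; split=> [_ [x Ox <-]|x Ox].
    by rewrite mul1r.
  by exists x; rewrite ?mul1r.
apply: (@colength_basis _ _ z); split.
- by move=> i; rewrite /z; case: fintype.split => j; [exact: Ov|exact: (local_ringM Oa (Ow j))].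
- move=> c; rewrite zE => -[x Ox xE].
  have Oaw : O (\sum_j c (rshift m j) *: w j).
    by apply: subspace_sum => // j; apply: subspaceZ.
  have cl : forall i, c (lshift n i) = 0.
    apply: vfree; exists (b * x - \sum_j c (rshift m j) *: w j).
      by apply: subspaceB => //; apply: local_ringM.
    by rewrite mulrBr mulrA xE addrK.
  have cr : forall j, c (rshift m j) = 0.
    apply: wfree; exists x => //; move: xE; rewrite big1 ?add0r -?mulrA.
      by apply: mulfI; apply/eqP.
    by move=> i _; rewrite cl scale0r.
  by move=> i; rewrite -(splitK i); case: fintype.split => j; [exact: cl|exact: cr].
- move=> x Ox; have [c [y Oy yE]] := span_mod_coef (vspan x Ox).
  have [d [u Ou uE]] := span_mod_coef (wspan y Oy).
  pose e (i : 'I_(m + n)) := match fintype.split i with inl j => c j | inr j => d j end.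
  apply: (coef_span_mod (c := e)).
  exists u => //; rewrite zE -mulrA uE mulrBr yE.
  under [\sum_i e (lshift n i) *: _]eq_bigr do rewrite /e (unsplitK (inl _)).
  under [\sum_i e (rshift m i) *: _]eq_bigr do rewrite /e (unsplitK (inr _)).
  rewrite opprD addrA; reflexivity.
Qed.

Lemma colength_unit a : local_unit P a -> colength P a = 0.
Proof.
move=> [/eqP a0 Oa Oai].
apply: (@colength_basis _ 0%N (fun=> 0)); split=> [[]//|c _ []//|x Ox].
left; exists (a^-1 * x); first exact: local_ringM.
by rewrite mulVKf //; apply/eqP.
Qed.

(** If [a / b = c / d], then [a * d = c * b], and additivity of colengths shows that the two
    differences agree. *)
Lemma ord_quot a b : O a -> a <> 0 -> O b -> b <> 0 ->
  ord P (a / b) = colength P a - colength P b.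
Proof.
move=> Oa a0 Ob b0; rewrite /ord; apply: xget_unique.
  by exists a, b; split=> //; split=> //; apply/eqP.
move=> _ [c [d [[Oc /eqP c0] [Od /eqP d0] E ->]]].
have : a * d = c * b.
  apply/eqP; rewrite -eqr_div; first (by apply/eqP); by apply/eqP.
move=> /(congr1 (colength P)); rewrite !colengthM // => H.
by lra.
Qed.

(** Numerator and denominator are each divided by a form of their common degree that does not vanish
    at [P]. *)
Lemma fun_field_quot phi : fun_field C phi -> phi <> 0 ->
  exists a b, [/\ O a, a <> 0, O b, b <> 0 & phi = a / b].
Proof.
rewrite /fun_field local_ringE => -[d [f [g [_ df dg Cg ->]]]] phi0.
have [h [dh Ph]] := exists_denominator P d.
have h0 : hcls C h != 0 by apply: hcls_neq0_off Ph.
have g0 : hcls C g <> 0 by move/hcls_eq0.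
exists (hcls C f / hcls C h), (hcls C g / hcls C h); split.
- by rewrite /O local_ringE; exists d, f, h.
- move=> /eqP; rewrite mulf_eq0 invr_eq0 (negbTE h0) orbF => /eqP f0.
  by apply: phi0; rewrite f0 mul0r.
- by rewrite /O local_ringE; exists d, g, h.
- by move=> /eqP; rewrite mulf_eq0 invr_eq0 (negbTE h0) orbF => /eqP.
- by rewrite invf_div mulrA divfK.
Qed.

Lemma ordM phi psi : fun_field C phi -> phi <> 0 -> fun_field C psi -> psi <> 0 ->
  ord P (phi * psi) = ord P phi + ord P psi.
Proof.
move=> Kphi phi0 Kpsi psi0.
have [a [b [Oa a0 Ob b0 ->]]] := fun_field_quot Kphi phi0.
have [c [d [Oc c0 Od d0 ->]]] := fun_field_quot Kpsi psi0.
have nz x y : x <> 0 -> y <> 0 -> x * y <> 0.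
  by move=> x0 y0; apply/eqP; apply: mulf_neq0; exact/eqP.
rewrite mulf_div (ord_quot (local_ringM Oa Oc) (nz _ _ a0 c0)
  (local_ringM Ob Od) (nz _ _ b0 d0)) (ord_quot Oa a0 Ob b0) (ord_quot Oc c0 Od d0).
rewrite (colengthM Oa a0 Oc c0) (colengthM Ob b0 Od d0); lra.
Qed.

Lemma ord_unit phi : local_unit P phi -> ord P phi = 0.
Proof.
move=> u; have [/eqP u0 Ou _] := u; rewrite -[phi]divr1 ord_quot //; last 2 first.
- exact: local_ring1.
- by apply/eqP; rewrite oner_neq0.
by rewrite !colength_unit ?subrr //; apply: local_unit1.
Qed.

End Order.

(** * Cartier divisors *)

Lemma hcls_divM (R : realType) (N : nat) (X : pvar R N) a b a' b' :
  hcls X a / hcls X b * (hcls X a' / hcls X b') = hcls X (a * a') / hcls X (b * b').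
Proof. by rewrite mulf_div -!rmorphM. Qed.

(** * Restriction of rational functions to a subvariety *)

Section Restriction.
Variables (R : realType) (N : nat) (X C : pvar R N).
Hypothesis CX : subvar C X.
Implicit Types (phi psi : hfrac X) (P : pvar R N).

(** The cross-multiplied identity between two representations holds modulo the ideal of [X], hence
    modulo that of [C], so the choice made in [restr] is immaterial. *)
Lemma restrE d a b : homog d a -> homog d b -> ~ idl C b ->
  restr C (hcls X a / hcls X b) = hcls C a / hcls C b.
Proof.
move=> da db Cb; have q : (exists d, homog d a && homog d b) by exists d; rewrite da db.
apply: xget_unique; first by exists a, b; split; split=> //; exact/negP.
move=> _ [a' [b' [[_ /negP Cb' E] [_ _ ->]]]].
have nz (Z : pvar R N) c : subvar C Z -> ~ idl C c -> hcls Z c != 0.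
  by move=> CZ; apply: hcls_neq0_off.
have [bX bX'] := (nz X _ CX Cb, nz X _ CX Cb').
have [bC bC'] := (nz C _ (@subvar_refl R N C) Cb, nz C _ (@subvar_refl R N C) Cb').
apply/eqP; rewrite (eqr_div _ _ bC' bC) -!rmorphM; apply/eqP/hcls_eq; apply: CX.
by apply/hcls_eq; rewrite !rmorphM; apply/eqP; rewrite -(eqr_div _ _ bX' bX) E.
Qed.

Lemma restrM phi psi : local_ring X C phi -> local_ring X C psi ->
  restr C (phi * psi) = restr C phi * restr C psi.
Proof.
rewrite local_ringE => -[d [a [b [_ da db Cb ->]]]] [e [a' [b' [_ ea eb Cb' ->]]]].
rewrite (hcls_divM X) (restrE (homogM da ea) (homogM db eb) (idl_mul Cb Cb')).
by rewrite (restrE da db Cb) (restrE ea eb Cb') (hcls_divM C).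
Qed.

Lemma restr1 : restr C (1 : hfrac X) = 1.
Proof.
have -> : (1 : hfrac X) = hcls X 1 / hcls X 1 by rewrite rmorph1 divr1.
rewrite (restrE (d := 0)) ?rmorph1 ?divr1 //; [exact: dhomog1|exact: dhomog1|exact: idl1].
Qed.

Lemma restr_local_ring P phi : subvar P C -> local_ring X P phi ->
  local_ring C P (restr C phi).
Proof.
rewrite !local_ringE => PC [d [a [b [_ da db Pb ->]]]].
rewrite (restrE da db); last by move=> Cb; apply: Pb; apply: PC.
by exists d, a, b; split.
Qed.

Lemma local_ring_sub P : subvar P C -> local_ring X P `<=` local_ring X C.
Proof.
rewrite !local_ringE => PC _ [d [a [b [_ da db Pb ->]]]].
by exists d, a, b; split=> //; move=> Cb; apply: Pb; apply: PC.
Qed.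

Lemma restr_unit P phi : subvar P C -> local_unit P phi -> local_unit P (restr C phi).
Proof.
move=> PC [/eqP phi0 h1 h2].
have E : restr C phi * restr C phi^-1 = 1.
  rewrite -restrM; [|exact: local_ring_sub PC _ h1|exact: local_ring_sub PC _ h2].
  by rewrite divff ?restr1 //; apply/eqP.
have r0 : restr C phi != 0.
  by apply/eqP => r0; move: E; rewrite r0 mul0r => /eqP; rewrite eq_sym oner_eq0.
split; [exact: r0|exact: restr_local_ring|].
have -> : (restr C phi)^-1 = restr C phi^-1 by apply: (mulfI r0); rewrite E divff.
exact: restr_local_ring.
Qed.

End Restriction.

(** * The group of Cartier divisors and additivity of intersection numbers *)

Section CartierGroup.
Variables (R : realType) (N : nat) (X : pvar R N).
Implicit Types (D E : cartier X) (C P Z W : pvar R N).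

Lemma fun_fieldM phi psi : fun_field X phi -> fun_field X psi ->
  fun_field X (phi * psi).
Proof. exact: local_ringM. Qed.

Lemma fun_fieldV phi : phi <> 0 -> fun_field X phi -> fun_field X phi^-1.
Proof.
rewrite /fun_field local_ringE => phi0 [d [a [b [_ da db Xb E]]]].
exists d, b, a; split=> //; last by rewrite E invf_div.
by move=> /hcls_eq0 a0; apply: phi0; rewrite E a0 mul0r.
Qed.

Lemma local_unit_near D Z : subvar Z X -> exists2 h, (exists d, homog d h) /\ ~ idl Z h &
  forall W, subvar W X -> ~ idl W h -> local_unit W (local_eq D Z / local_eq D W).
Proof.
move=> ZX; have [h [hd /negP Zh H]] := local_eq_compat D ZX.
by exists h => // W WX /negP Wh; apply: H.
Qed.

Lemma local_eq_nz D Z : subvar Z X -> local_eq D Z <> 0.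
Proof. by move=> ZX; apply/eqP; apply: local_eq_neq0. Qed.

Section Mul.
Variables D E : cartier X.
Let f Z := local_eq D Z * local_eq E Z.

Fact cartier_mul_neq0 Z : subvar Z X -> f Z != 0.
Proof. by move=> ZX; apply: mulf_neq0; apply: local_eq_neq0. Qed.

Fact cartier_mul_fun Z : subvar Z X -> fun_field X (f Z).
Proof. by move=> ZX; apply: fun_fieldM; apply: local_eq_fun. Qed.

Fact cartier_mul_compat Z : subvar Z X ->
  exists h, [/\ exists d, homog d h, h \notin ideal Z &
    forall W, subvar W X -> h \notin ideal W -> local_unit W (f Z / f W)].
Proof.
move=> ZX; have [h [[d hd] Zh] H] := local_unit_near D ZX.
have [g [[e ge] Zg] G] := local_unit_near E ZX.
exists (h * g); split; first by exists (d + e)%N; apply: homogM.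
  by apply/negP; apply: idl_mul.
move=> W WX /negP Wgh; rewrite /f -mulf_div; apply: local_unitM.
  apply: H => // Wh; apply: Wgh; apply: ideal_mulr Wh; exact: idl_ideal.
apply: G => // Wg; apply: Wgh; apply: ideal_mull Wg; exact: idl_ideal.
Qed.

Definition cartier_mul : cartier X :=
  Cartier cartier_mul_neq0 cartier_mul_fun cartier_mul_compat.
End Mul.

Section Inv.
Variable D : cartier X.
Let f Z := (local_eq D Z)^-1.

Fact cartier_inv_neq0 Z : subvar Z X -> f Z != 0.
Proof. by move=> ZX; rewrite invr_eq0; apply: local_eq_neq0. Qed.

Fact cartier_inv_fun Z : subvar Z X -> fun_field X (f Z).
Proof.
by move=> ZX; apply: fun_fieldV; [apply: local_eq_nz|apply: local_eq_fun].
Qed.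

Fact cartier_inv_compat Z : subvar Z X ->
  exists h, [/\ exists d, homog d h, h \notin ideal Z &
    forall W, subvar W X -> h \notin ideal W -> local_unit W (f Z / f W)].
Proof.
move=> ZX; have [h [hd /negP Zh] H] := local_unit_near D ZX.
exists h; split=> // W WX /negP Wh; rewrite /f -invfM.
by apply: local_unitV; apply: H.
Qed.

Definition cartier_inv : cartier X :=
  Cartier cartier_inv_neq0 cartier_inv_fun cartier_inv_compat.
End Inv.

Section One.
Fact cartier_one_neq0 Z : subvar Z X -> (1 : hfrac X) != 0.
Proof. by move=> _; apply: oner_neq0. Qed.

Fact cartier_one_fun Z : subvar Z X -> fun_field X (1 : hfrac X).
Proof. by move=> _; apply: local_ring1. Qed.

Fact cartier_one_compat Z : subvar Z X ->
  exists h, [/\ exists d, homog d h, h \notin ideal Z &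
    forall W, subvar W X -> h \notin ideal W -> local_unit W (1 / 1 : hfrac X)].
Proof.
move=> ZX; exists 1; split; first by exists 0%N; apply: dhomog1.
  by apply/negP; apply: idl1.
by move=> W WX _; rewrite divr1; apply: local_unit1.
Qed.

Definition cartier_one : cartier X :=
  Cartier cartier_one_neq0 cartier_one_fun cartier_one_compat.
End One.

Section Curve.
Variable C : pvar R N.
Hypotheses (CX : subvar C X) (C1 : pdim C = 1%N).

Definition local_deg D P : R := ord P (restr C (local_eq D P / local_eq D C)).

Let points := [set P | subvar P C /\ closed_point P].

Lemma inumE D : inum D C = \sum_(P \in points) local_deg D P.
Proof. by []. Qed.

Lemma local_eq_ratio D P : subvar P C -> local_unit C (local_eq D P / local_eq D C).
Proof.
move=> PC; have PX := subvar_trans PC CX.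
have [h [_ Ph] H] := local_unit_near D PX.
by apply: H => // Ch; apply: Ph; apply: PC.
Qed.

Lemma restr_ratio D P : subvar P C ->
  let r := restr C (local_eq D P / local_eq D C) in fun_field C r /\ r <> 0.
Proof.
move=> /(local_eq_ratio D)/(restr_unit CX (@subvar_refl R N C)) [r0 r1 _].
by split; [exact: r1|exact/eqP].
Qed.

(** Around the generic point of [C] all local equations agree up to units, except at zeros of a form
    [h] not vanishing on [C], and these are finite in number. A sum with infinite support is 0 by
    convention, so additivity of [inum] rests on this finiteness. *)
Lemma local_deg_finite D :
  exists2 S : set (pvar R N), finite_set S & forall P, points P -> ~ S P -> local_deg D P = 0.
Proof.
have [h [[d hd] Ch] H] := local_unit_near D CX.
have Jh := iadd_hideal hd (idl_hideal C).
have fin := finite_zeros C1 Jh (iadd_proper (idl_ideal C) Ch).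
exists [set P | closed_point P /\ iadd (idl C) h `<=` idl P] => // P [PC Pcl] nS.
have PX := subvar_trans PC CX.
have Ph : ~ idl P h.
  move=> Ph; apply: nS; split=> // _ [a [c [Ca ->]]].
  apply: (ideal_add (idl_ideal P)); first exact: PC.
  by apply: (ideal_mull (idl_ideal P)).
apply: (ord_unit C1 Pcl PC); apply: (restr_unit CX PC).
by rewrite -invf_div; apply: local_unitV; apply: H.
Qed.

Lemma local_degM D E P : points P ->
  local_deg (cartier_mul D E) P = local_deg D P + local_deg E P.
Proof.
move=> [PC Pcl]; rewrite /local_deg /= -mulf_div.
have [_ uD _] := local_eq_ratio D PC; have [_ uE _] := local_eq_ratio E PC.
rewrite (restrM CX uD uE); have [fD D0] := restr_ratio D PC; have [fE E0] := restr_ratio E PC.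
exact: (ordM C1 Pcl PC fD D0 fE E0).
Qed.

Lemma local_deg1 P : points P -> local_deg cartier_one P = 0.
Proof.
move=> [PC Pcl]; rewrite /local_deg /= divr1 restr1 //.
by apply: (ord_unit C1 Pcl PC); apply: local_unit1.
Qed.

Lemma local_degV D P : points P -> local_deg (cartier_inv D) P = - local_deg D P.
Proof.
move=> PP; apply/eqP; rewrite -addr_eq0 addrC -local_degM //.
have [PC Pcl] := PP; have PX := subvar_trans PC CX.
rewrite -[0](local_deg1 PP) /local_deg /=.
by rewrite (divff (local_eq_neq0 D PX)) (divff (local_eq_neq0 D CX)).
Qed.

Lemma inumM D E : inum (cartier_mul D E) C = inum D C + inum E C.
Proof.
have [S Sfin S0] := local_deg_finite D; have [T Tfin T0] := local_deg_finite E.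
pose Q := points `&` (S `|` T).
have Qfin : finite_set Q by apply: finite_setIr; rewrite finite_setU.
have out P : (points `\` Q) P -> [/\ points P, ~ S P & ~ T P].
  by move=> [PP nQ]; split=> // ?; apply: nQ; split=> //; [left|right].
rewrite !inumE -!(@fsbig_widen _ _ _ _ Q points) //; try exact: subIsetl.
- by rewrite -fsbig_split //; apply: eq_fsbigr => P /[!inE] -[PP _]; apply: local_degM.
- by move=> P /out[PP _ nT]; apply: T0.
- by move=> P /out[PP nS _]; apply: S0.
- by move=> P /out[PP nS nT]; rewrite /= local_degM // S0 // T0 // addr0.
Qed.

Lemma inum1 : inum cartier_one C = 0.
Proof. by rewrite inumE; apply: fsbig1 => P; apply: local_deg1. Qed.

Lemma inumV D : inum (cartier_inv D) C = - inum D C.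
Proof.
rewrite !inumE (eq_fsbigr (fun P => -1 * local_deg D P)) => [|P /[!inE] PP].
  rewrite -mulr_fsumr ?mulN1r //.
by rewrite local_degV // mulN1r.
Qed.

End Curve.

Lemma cartier_class_eq (x : N1 X) D : (forall C, subvar C X -> pdim C = 1%N ->
  inum D C = rinum (repr x) C) -> cartier_class D = x.
Proof.
move=> H; rewrite -[RHS]N1_classK; apply/N1_classP => C CX C1.
by rewrite /rinum big_seq1 mul1r H.
Qed.

Lemma N1Z0 : N1Z (0 : N1 X).
Proof.
exists cartier_one => //; apply: cartier_class_eq => C CX C1.
by rewrite inum1 // [LHS](esym (rinum_nil X C)) -(rinum_repr [::] CX C1).
Qed.

Lemma rinum_cartier_class D C : subvar C X -> pdim C = 1%N ->
  rinum (repr (cartier_class D)) C = inum D C.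
Proof. by move=> CX C1; rewrite rinum_repr // /rinum big_seq1 mul1r. Qed.

Lemma N1ZD (x y : N1 X) : N1Z x -> N1Z y -> N1Z (x + y).
Proof.
move=> [D _ <-] [E _ <-]; exists (cartier_mul D E) => //.
apply: cartier_class_eq => C CX C1; rewrite inumM // rinum_repr // rinum_cat.
by rewrite !rinum_cartier_class.
Qed.

Lemma N1ZN (x : N1 X) : N1Z x -> N1Z (- x).
Proof.
move=> [D _ <-]; exists (cartier_inv D) => //.
apply: cartier_class_eq => C CX C1; rewrite inumV // rinum_repr // rinum_scale.
by rewrite rinum_cartier_class // mulN1r.
Qed.

Lemma N1Z_lincomb m (v : 'I_m -> N1 X) (z : 'I_m -> int) : (forall i, N1Z (v i)) ->
  N1Z (\sum_i (z i)%:~R *: v i).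
Proof.
move=> vZ; apply: big_ind => [||i _]; [exact: N1Z0|exact: N1ZD|].
have nat_mul n : N1Z (v i *+ n).
  by elim: n => [|n IH]; [rewrite mulr0n; exact: N1Z0|rewrite mulrS; exact: N1ZD].
case: (z i) => n; first by rewrite -pmulrn scaler_nat.
by rewrite NegzE mulrNz scaleNr -pmulrn scaler_nat; apply: N1ZN.
Qed.

End CartierGroup.

(** * Volumes on the space of numerical classes *)

Section LinearCombinations.
Variables (k : fieldType) (V : lmodType k) (m : nat) (v : 'I_m -> V).

Definition lincomb (x : 'rV[k]_m) : V := \sum_i x 0 i *: v i.

Fact lincomb_is_linear : linear lincomb.
Proof.
move=> c x y; rewrite /lincomb scaler_sumr -big_split; apply: eq_bigr => i _.
by rewrite !mxE scalerDl scalerA.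
Qed.

HB.instance Definition _ := GRing.isLinear.Build k 'rV[k]_m V _ lincomb
  lincomb_is_linear.

Lemma lincomb_bij : basis_mod [set: V] [set 0] v -> bijective lincomb.
Proof.
move=> [_ vfree vspan].
have s0 : is_subspace [set (0 : V)].
  by split=> // [x y -> ->|c x ->]; rewrite /= ?addr0 ?scaler0.
have ex x : exists y, lincomb y = x.
  have [c /= /subr0_eq cE] := span_mod_coef (vspan x I).
  by exists (\row_i c i); rewrite cE; apply: eq_bigr => i _; rewrite mxE.
have [g gK] := choice ex.
exists g => // x; apply/eqP; rewrite -subr_eq0; apply/eqP/rowP => i; rewrite [RHS]mxE.
apply: (vfree (fun i => (g (lincomb x) - x) 0 i)).
by rewrite /= -/(lincomb _) linearB /= gK subrr.
Qed.

End LinearCombinations.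

(** * Bases made of classes of Cartier divisors *)

Section Basis.
Variables (R : realType) (N : nat) (X : pvar R N).

Lemma N1_eq (x y : N1 X) : (forall C, subvar C X -> pdim C = 1%N ->
  rinum (repr x) C = rinum (repr y) C) -> x = y.
Proof. by move=> H; rewrite -[x]N1_classK -[y]N1_classK; apply/N1_classP. Qed.

Lemma rinumD (x y : N1 X) C : subvar C X -> pdim C = 1%N ->
  rinum (repr (x + y)) C = rinum (repr x) C + rinum (repr y) C.
Proof. by move=> CX C1; rewrite rinum_repr // rinum_cat. Qed.

Lemma rinumZ c (x : N1 X) C : subvar C X -> pdim C = 1%N ->
  rinum (repr (c *: x)) C = c * rinum (repr x) C.
Proof. by move=> CX C1; rewrite rinum_repr // rinum_scale. Qed.

Lemma N1_class_sum (s : rdivisor X) :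
  N1_class s = \sum_(t <- s) t.1 *: cartier_class t.2.
Proof.
elim: s => [|[c D] s IH]; first by rewrite big_nil.
rewrite big_cons -IH; apply: N1_eq => C CX C1.
by rewrite rinumD // rinumZ // !rinum_repr // /rinum big_cons big_seq1 mul1r.
Qed.

Lemma N1_lincomb (x : N1 X) : exists m (D : 'I_m -> cartier X) (r : 'rV[R]_m),
  x = lincomb (fun i => cartier_class (D i)) r.
Proof.
rewrite -[x]N1_classK N1_class_sum; set s := repr x.
exists (size s), (fun i => (tnth (in_tuple s) i).2), (\row_i (tnth (in_tuple s) i).1).
by rewrite big_tnth; apply: eq_bigr => i _; rewrite mxE.
Qed.

Lemma set0_subspace : is_subspace [set (0 : N1 X)].
Proof. by split=> // [x y -> ->|c x ->]; rewrite /= ?addr0 ?scaler0. Qed.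

(** Classes of Cartier divisors span the space, so a longest family of them that is independent over
    the reals is a basis, and its length must be [rho]. In general it generates only a sublattice of
    [N1Z], as an integral isomorphism allows. *)
Lemma N1_basis rho : picard_number X = (rho%:R)%:E ->
  exists D : 'I_rho -> cartier X,
    basis_mod [set: N1 X] [set 0] (fun i => cartier_class (D i)).
Proof.
move=> /ldim_finite[[u _ ufree] umax].
have [m [v [vZ vfree vspan]]] : exists m (v : 'I_m -> N1 X),
    basis_mod (@N1Z R N X) [set 0] v.
  by apply: (@bounded_basis _ _ _ set0_subspace _ rho) => m w _; apply: umax.
have vT x : span_mod [set 0] (range v) x.
  have [p [D [r ->]]] := N1_lincomb x.
  have sp : is_subspace (span_mod [set 0] (range v)).
    split=> [|y z|c y]; first by left.
    - by apply: span_modD => a b -> ->; rewrite /= addr0.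
    - elim=> [z ->|d z t vz _ IH]; first by left; rewrite scaler0.
      by rewrite scalerDr scalerA; right.
  apply: subspace_sum => // i; apply: subspaceZ => //; apply: vspan; by exists (D i).
have mrho : m = rho.
  apply/eqP; rewrite eqn_leq (umax _ v) //=.
  by apply: (free_mod_le set0_subspace ufree) => i; apply: vT.
subst m; have ex i : exists D, cartier_class D = v i by have [D _ <-] := vZ i; exists D.
have [D DE] := choice ex.
have vE : (fun i => cartier_class (D i)) = v by apply/funext => i; apply: DE.
by exists D; rewrite vE; split=> // x _; apply: vT.
Qed.

End Basis.

(** Multiplying the coordinates of a point by [n + 1], rounding down and dividing again gives
    rational points that converge to it. *)
Lemma eq_continuous_rat (R : realType) m (f g : 'rV[R]_m -> R) :
  continuous f -> continuous g ->
  (forall (n : nat) (z : 'rV[int]_m),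
     f (n.+1%:R^-1 *: map_mx intr z) = g (n.+1%:R^-1 *: map_mx intr z)) -> f = g.
Proof.
move=> fc gc fg; apply/funext => r.
pose q (n : nat) : 'rV[R]_m := n.+1%:R^-1 *: map_mx intr (\row_i Num.floor (n.+1%:R * r 0 i)).
have qr : q n @[n --> \oo] --> r.
  apply/cvg_ballP => e e0; near=> n; split=> // i j; rewrite (ord1 i) !mxE.
  rewrite /ball /=; set x := r 0 j.
  have n0 : 0 < n.+1%:R :> R by rewrite ltr0n.
  have /andP[h1 h2] := floor_itv (n.+1%:R * x).
  have -> : x - n.+1%:R^-1 * (Num.floor (n.+1%:R * x))%:~R =
     n.+1%:R^-1 * (n.+1%:R * x - (Num.floor (n.+1%:R * x))%:~R).
    by rewrite mulrBr mulKf // gt_eqF.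
  rewrite normrM gtr0_norm ?invr_gt0 // ger0_norm ?subr_ge0 //.
  apply: (@le_lt_trans _ _ (n.+1%:R^-1)).
    rewrite ler_piMr ?invr_ge0 ?ltW //.
    by move: h2; rewrite intrD; lra.
  near: n; exact: near_infty_natSinv_lt (PosNum e0).
have cf : f (q n) @[n --> \oo] --> f r by apply: continuous_cvg qr; apply: fc.
have cg : g (q n) @[n --> \oo] --> g r by apply: continuous_cvg qr; apply: gc.
have fgq : (fun n => f (q n)) = (fun n => g (q n)) by apply/funext => n; apply: fg.
by move: cf; rewrite fgq => cf; apply: (cvg_unique _ cf cg).
Unshelve. all: by end_near.
Qed.

Section Volume.
Variables (R : realType) (N : nat) (X : pvar R N).

(** Values at integral combinations of Cartier classes are prescribed, since these are again Cartier
    classes; homogeneity extends the agreement to rational combinations and continuity to real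
    ones. *)
Lemma is_volume_unique (v w : N1 X -> R) : is_volume v -> is_volume w -> v = w.
Proof.
move=> [_ vc vh vD] [_ wc wh wD]; apply/funext => x.
have [m [D [r ->]]] := N1_lincomb x.
pose phi : {linear 'rV[R]_m -> N1 X} := lincomb (fun i => cartier_class (D i)).
rewrite -[lincomb _ r]/(phi r); suff /(congr1 (fun f => f r)) : v \o phi = w \o phi by [].
apply: eq_continuous_rat; [exact: vc|exact: wc|move=> n z].
have [E _ EE] : N1Z (phi (map_mx intr z)).
  rewrite /phi /= /lincomb; under eq_bigr do rewrite mxE.
  by apply: N1Z_lincomb => i; exists (D i).
have EQ : v (phi (map_mx intr z)) = w (phi (map_mx intr z)).
  by rewrite -EE; have := vD E; rewrite -wD => -[].
by rewrite /= linearZ /= vh ?wh ?EQ // invr_ge0 ler0n.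
Qed.

Lemma vol_ge0 (x : N1 X) : 0 <= vol X x.
Proof.
rewrite /vol; have [ex|nex] := pselect (exists v, [set v : N1 X -> R | is_volume v] v).
  by have [+ _ _ _] := xgetPex (fun=> 0) ex; apply.
by rewrite xgetPN // => v vX; apply: nex; exists v.
Qed.

End Volume.

(** * Automorphisms of algebraically closed fields *)

Lemma Zorn_extension (T : Type) (good : set (set T)) (G0 : set T) : good G0 ->
  (forall F : set (set T), F !=set0 -> F `<=` good -> total_on F subset ->
     good (\bigcup_(G in F) G)) ->
  exists M, [/\ good M, G0 `<=` M & forall M', good M' -> M `<=` M' -> M' `<=` M].
Proof.
move=> gG0 chain_good.
pose ok (G : set T) := G = set0 \/ (good G /\ G0 `<=` G).
have [F Fok Ftot|M [Mok Mmax]] := @Zorn_bigcup T ok.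
  have [[G [FG G0']]|nF] := pselect (exists G, F G /\ G !=set0); last first.
    left; apply/seteqP; split=> // x [G FG Gx]; apply: nF; exists G.
    by split=> //; exists x.
  right; pose F' := F `&` [set G | G !=set0].
  have E : \bigcup_(H in F) H = \bigcup_(H in F') H.
    apply/seteqP; split=> x [H FH Hx]; exists H => //; last by case: FH.
    by split=> //; exists x.
  have F'good H : F' H -> good H /\ G0 `<=` H.
    by move=> [/Fok[->|//]] [x].
  rewrite E; split; last first.
    by move=> x G0x; exists G => //; apply: (F'good G _).2.
  apply: chain_good; first by exists G.
    by move=> H /F'good[].
  by move=> H1 H2 [F1 _] [F2 _]; apply: Ftot.
have Mgood : good M /\ G0 `<=` M.
  case: Mok => // M0; have [E|/set0P[x G0x]] := eqVneq G0 set0.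
    by rewrite -E in M0; rewrite M0; split.
  suff : M `<` G0 by move=> /Mmax []; right; split.
  by rewrite M0; split=> // /(_ x G0x).
exists M; split; [exact: Mgood.1|exact: Mgood.2|move=> M' gM' MM'].
apply: contrapT => nM; apply: (Mmax M'); first by split.
by right; split=> //; apply: subset_trans MM'; apply: Mgood.2.
Qed.

Section Automorphisms.
Variable K : closedFieldType.
Implicit Types (G : set (K * K)) (S : set K) (e : K * K) (p q h r : {poly K * K}).

Local Notation p1 p := (map_poly (fst : K * K -> K) p).
Local Notation p2 p := (map_poly (snd : K * K -> K) p).

Definition is_subring (A : nzRingType) (S : set A) : Prop :=
  [/\ S 1, forall x y, S x -> S y -> S (x - y) & forall x y, S x -> S y -> S (x * y)].

Definition over (A : nzRingType) (S : set A) (p : {poly A}) : Prop := forall i, S p`_i.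

Section Subring.
Variables (A : nzRingType) (S : set A).
Hypothesis Sr : is_subring S.

Lemma subring1 : S 1. Proof. by case: Sr. Qed.
Lemma subringB x y : S x -> S y -> S (x - y). Proof. by case: Sr => _ B _; apply: B. Qed.
Lemma subringM x y : S x -> S y -> S (x * y). Proof. by case: Sr => _ _ M; apply: M. Qed.
Lemma subring0 : S 0. Proof. by rewrite -(subrr 1); apply: subringB; exact: subring1. Qed.
Lemma subringN x : S x -> S (- x).
Proof. by move=> Sx; rewrite -sub0r; apply: subringB => //; exact: subring0. Qed.
Lemma subringD x y : S x -> S y -> S (x + y).
Proof. by move=> Sx Sy; rewrite -[y]opprK; apply: subringB => //; apply: subringN. Qed.
Lemma subringX x n : S x -> S (x ^+ n).
Proof.
by move=> Sx; elim: n => [|n IH]; [rewrite expr0; exact: subring1|rewrite exprS; apply: subringM].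
Qed.
Lemma subring_sum (I : Type) (s : seq I) (F : I -> A) :
  (forall i, S (F i)) -> S (\sum_(i <- s) F i).
Proof. by move=> SF; apply: big_ind => //; [exact: subring0|exact: subringD]. Qed.

Lemma overC c : S c -> over S c%:P.
Proof. by move=> Sc i; rewrite coefC; case: eqP => // _; exact: subring0. Qed.
Lemma overX : over S 'X.
Proof. by move=> i; rewrite coefX; case: eqP => _; [exact: subring1|exact: subring0]. Qed.
Lemma overB (p q : {poly A}) : over S p -> over S q -> over S (p - q).
Proof. by move=> Sp Sq i; rewrite coefB; apply: subringB. Qed.
Lemma overD (p q : {poly A}) : over S p -> over S q -> over S (p + q).
Proof. by move=> Sp Sq i; rewrite coefD; apply: subringD. Qed.
Lemma overM (p q : {poly A}) : over S p -> over S q -> over S (p * q).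
Proof. by move=> Sp Sq i; rewrite coefM; apply: subring_sum => j; apply: subringM. Qed.
Lemma over_horner (p : {poly A}) x : over S p -> S x -> S p.[x].
Proof.
move=> Sp Sx; rewrite horner_coef; apply: subring_sum => i.
by apply: subringM => //; apply: subringX.
Qed.
Lemma overXn n : over S ('X ^+ n).
Proof.
move=> i; rewrite coefXn; case: eqP => _; [exact: subring1|exact: subring0].
Qed.
End Subring.

Lemma coef_p1 p i : (p1 p)`_i = (p`_i).1.
Proof. by rewrite coef_map. Qed.

Lemma horner_pair p e : p.[e] = ((p1 p).[e.1], (p2 p).[e.2]).
Proof.
by rewrite [LHS]surjective_pairing; congr pair; rewrite horner_map.
Qed.

(* An isomorphism between two subrings of K is represented by its graph, a subring
   of K * K that is functional together with its transpose. *)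
Definition functional G : Prop := forall x, G x -> x.1 = 0 -> x.2 = 0.
Definition transpose G : set (K * K) := [set x | G (x.2, x.1)].
Definition adjoin G e : set (K * K) := [set x | exists2 p, over G p & x = p.[e]].

Lemma adjoin_sub G e : is_subring G -> G `<=` adjoin G e.
Proof. by move=> Gr x Gx; exists x%:P; [apply: overC|rewrite hornerC]. Qed.

Lemma adjoin_mem G e : is_subring G -> adjoin G e e.
Proof. by move=> Gr; exists 'X; [apply: overX|rewrite hornerX]. Qed.

Lemma adjoin_subring G e : is_subring G -> is_subring (adjoin G e).
Proof.
move=> Gr; split=> [|_ _ [p Gp ->] [q Gq ->]|_ _ [p Gp ->] [q Gq ->]].
- by apply: adjoin_sub => //; apply: subring1.
- by exists (p - q); [apply: overB|rewrite hornerD hornerN].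
- by exists (p * q); [apply: overM|rewrite hornerM].
Qed.

Lemma transpose_subring G : is_subring G -> is_subring (transpose G).
Proof.
move=> Gr; split=> [|x y Gx Gy|x y Gx Gy].
- exact: (subring1 Gr).
- exact: (subringB Gr Gx Gy).
- exact: (subringM Gr Gx Gy).
Qed.

Definition transcendental S a : Prop := forall f : {poly K}, over S f -> f.[a] = 0 -> f = 0.

Definition dom G : set K := [set a | exists b, G (a, b)].

Lemma over_p1 G p : over G p -> over (dom G) (p1 p).
Proof. by move=> Gp i; exists (p`_i).2; rewrite coef_p1 -surjective_pairing. Qed.

Lemma lift_over G (f : {poly K}) : G 0 -> over (dom G) f ->
  exists2 p, over G p & p1 p = f.
Proof.
move=> G0 /choice[b bP]; exists (\poly_(i < size f) (f`_i, b i)).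
  by move=> i; rewrite coef_poly; case: ifP.
apply/polyP => i; rewrite coef_p1 coef_poly; case: ltnP => //= h.
by rewrite nth_default.
Qed.

Section PartialIsomorphism.
Variable G : set (K * K).
Hypotheses (Gr : is_subring G) (Gf : functional G) (Gf' : functional (transpose G)).

(** The ring [K * K] has zero divisors, but an element of the graph vanishes as soon as one
    component does, so degrees of polynomials over [G] can be read off on either side. *)
Lemma graph_eq0 x : G x -> (x.1 == 0) = (x == 0).
Proof.
move=> Gx; apply/eqP/eqP => [x1|->//].
by rewrite [x]surjective_pairing x1 (Gf Gx x1).
Qed.

Lemma graph_eq0' x : G x -> (x.2 == 0) = (x == 0).
Proof.
move=> Gx; apply/eqP/eqP => [x2|->//].
have x1 : x.1 = 0 by apply: (Gf' (x := (x.2, x.1))); rewrite // /transpose /= -surjective_pairing.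
by rewrite [x]surjective_pairing x1 x2.
Qed.

Lemma over_p1_eq0 p : over G p -> (p1 p == 0) = (p == 0).
Proof.
move=> Gp; apply/eqP/eqP => [h|->]; last by rewrite map_poly0.
apply/polyP => i; apply/eqP; rewrite coef0 -graph_eq0 //.
by rewrite -coef_p1 h coef0.
Qed.

Lemma size_p1 p : over G p -> size (p1 p) = size p.
Proof.
move=> Gp; have [->|p0] := eqVneq p 0; first by rewrite map_poly0 !size_poly0.
have Gl : G (lead_coef p) := Gp _.
by apply: size_map_poly_id0; rewrite (graph_eq0 Gl) lead_coef_eq0.
Qed.

Lemma size_p2 p : over G p -> size (p2 p) = size p.
Proof.
move=> Gp; have [->|p0] := eqVneq p 0; first by rewrite map_poly0 !size_poly0.
have Gl : G (lead_coef p) := Gp _.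
by apply: size_map_poly_id0; rewrite (graph_eq0' Gl) lead_coef_eq0.
Qed.

(** The graph is a ring and not a field, so a remainder exists only after multiplication by a power
    of the leading coefficient. *)
Lemma pseudo_division p q : over G p -> over G q -> p != 0 -> exists k h r,
  [/\ over G h, over G r, lead_coef p ^+ k *: q = h * p + r & (size r < size p)%N].
Proof.
move=> Gp + p0; have [n] := ubnP (size q); elim: n q => // n IH q qn Gq.
have Z c f : G c -> over G f -> over G (c *: f).
  by move=> Gc Gf0 i; rewrite coefZ; apply: subringM.
have [qp|pq] := ltnP (size q) (size p).
  exists 0%N, 0, q; split=> //; first by move=> i; rewrite coef0; apply: subring0.
  by rewrite expr0 scale1r mul0r add0r.
have p_gt0 : (0 < size p)%N by rewrite size_poly_gt0.
pose d := (size q - size p)%N.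
pose f := lead_coef q *: ('X^d : {poly K * K}).
have Gf0 : over G f by apply: (Z _ _ (Gq _)); exact: (overXn Gr).
pose q' := lead_coef p *: q - f * p.
have Gq' : over G q' := overB Gr (Z _ _ (Gp _) Gq) (overM Gr Gf0 Gp).
have q'n : (size q' < n)%N.
  suff : (size q' <= (size q).-1)%N by have := leq_trans p_gt0 pq; lia.
  apply/leq_sizeP => j; rewrite leq_eqVlt => /predU1P[<-|jq].
    rewrite coefB coefZ /f -scalerAl coefZ coefXnM.
    have -> : ((size q).-1 < d)%N = false by rewrite /d; lia.
    have -> : ((size q).-1 - d = (size p).-1)%N by rewrite /d; lia.
    by rewrite mulrC subrr.
  rewrite coefB coefZ /f -scalerAl coefZ coefXnM.
  have -> : (j < d)%N = false by rewrite /d; lia.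
  have qj : (size q <= j)%N by lia.
  have pj : (size p <= j - d)%N by rewrite /d; lia.
  by rewrite (nth_default _ qj) (nth_default _ pj) !mulr0 subrr.
have [k [h [r [Gh Grr E rp]]]] := IH _ q'n Gq'.
exists k.+1, (lead_coef p ^+ k *: f + h), r; split=> //.
  by apply: (overD Gr _ Gh); apply: Z => //; apply: (subringX Gr); apply: Gp.
have -> : lead_coef p ^+ k.+1 *: q = lead_coef p ^+ k *: (q' + f * p).
  by rewrite subrK scalerA exprSr.
by rewrite scalerDr E mulrDl scalerAl addrC addrA.
Qed.

(** The partner [t] is a root of the second component of a polynomial [p] of least degree that
    vanishes at [s]. Pseudo-division by [p] carries vanishing at [s] over to [t]. The converse
    divides by a polynomial [m] of least degree vanishing at [t]. *)
Lemma algebraic_lift s : (exists2 f : {poly K}, f != 0 & over (dom G) f /\ f.[s] = 0) ->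
  exists t, forall q, over G q -> ((p1 q).[s] = 0 <-> (p2 q).[t] = 0).
Proof.
move=> [f f0 [Gf0 fs]].
have minimal (Q : {poly K * K} -> Prop) : (exists2 p, over G p & p != 0 /\ Q p) ->
    exists p, [/\ over G p, p != 0, Q p &
      forall r, over G r -> Q r -> (size r < size p)%N -> r = 0].
  move=> [p Gp [p0 Qp]].
  have ex : exists n, `[< exists p, [/\ over G p, p != 0, Q p & size p = n] >].
    by exists (size p); apply/asboolP; exists p.
  case: (ex_minnP ex) => n /asboolP[m [Gm m0 Qm mn]] nmin.
  exists m; split=> // r Grr Qr; rewrite mn ltnNge => /negP nr.
  apply/eqP; apply: contrapT => /negP r0; apply: nr; apply: nmin.
  by apply/asboolP; exists r.
have [p [Gp p0 ps pmin]] : exists p, [/\ over G p, p != 0, (p1 p).[s] = 0 &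
      forall r, over G r -> (p1 r).[s] = 0 -> (size r < size p)%N -> r = 0].
  apply: minimal; have [p Gp pf] := lift_over (subring0 Gr) Gf0.
  by exists p; rewrite // -over_p1_eq0 // pf.
have sp : (size (p2 p) != 1)%N.
  rewrite size_p2 // -size_p1 //; apply: contraNneq p0 => /eqP/size_poly1P[c c0 pc].
  by move: ps; rewrite pc hornerC => /eqP; rewrite (negbTE c0).
have [t /eqP pt] := closed_rootP _ sp; exists t.
have lc1 m k : over G m -> m != 0 -> (lead_coef m ^+ k).1 != 0.
  move=> Gm m0; have -> : (lead_coef m ^+ k).1 = (lead_coef m).1 ^+ k by exact: (rmorphXn fst).
  have Gl : G (lead_coef m) := Gm _.
  by rewrite expf_neq0 // (graph_eq0 Gl) lead_coef_eq0.
have lc2 m k : over G m -> m != 0 -> (lead_coef m ^+ k).2 != 0.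
  move=> Gm m0; have -> : (lead_coef m ^+ k).2 = (lead_coef m).2 ^+ k by exact: (rmorphXn snd).
  have Gl : G (lead_coef m) := Gm _.
  by rewrite expf_neq0 // (graph_eq0' Gl) lead_coef_eq0.
have fwd q : over G q -> (p1 q).[s] = 0 -> (p2 q).[t] = 0.
  move=> Gq qs; have [k [h [r [Gh Grr E rp]]]] := pseudo_division Gp Gq p0.
  have rs : (p1 r).[s] = 0.
    have := congr1 (fun u => (p1 u).[s]) E.
    by rewrite rmorphD rmorphM map_polyZ !hornerE qs ps !mulr0 add0r.
  have r0 := pmin _ Grr rs rp.
  have := congr1 (fun u => (p2 u).[t]) E.
  rewrite r0 addr0 rmorphM map_polyZ !hornerE pt mulr0 => /eqP.
  by rewrite mulf_eq0 (negbTE (lc2 _ _ Gp p0)) => /eqP.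
move=> q Gq; split; first exact: fwd.
have [m [Gm m0 mt mmin]] : exists m, [/\ over G m, m != 0, (p2 m).[t] = 0 &
      forall r, over G r -> (p2 r).[t] = 0 -> (size r < size m)%N -> r = 0].
  by apply: minimal; exists p => //; split.
(* Up to a nonzero scalar, [p] equals [h * m]. If [h] vanished at [s], its degree would be at least
   that of [p], and [m] would be a nonzero constant. *)
have ms : (p1 m).[s] = 0.
  have [k [h [r [Gh Grr E rm]]]] := pseudo_division Gm Gp m0.
  have rt : (p2 r).[t] = 0.
    have := congr1 (fun u => (p2 u).[t]) E.
    by rewrite rmorphD rmorphM map_polyZ !hornerE pt mt !mulr0 add0r.
  have r0 := mmin _ Grr rt rm; rewrite r0 addr0 in E.
  have /eqP := congr1 (fun u => (p1 u).[s]) E.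
  rewrite rmorphM map_polyZ !hornerE ps mulr0 eq_sym mulf_eq0 => /orP[/eqP hs|/eqP //].
  have E1 := congr1 (fun u => p1 u) E; rewrite rmorphM map_polyZ /= in E1.
  have p10 : p1 p != 0 by rewrite over_p1_eq0.
  have h10 : p1 h != 0.
    apply: contraNneq p10 => h0; move/eqP: E1; rewrite h0 mul0r scaler_eq0.
    by rewrite (negbTE (lc1 _ _ Gm m0)).
  have m10 : p1 m != 0 by rewrite over_p1_eq0.
  have := congr1 (fun u : {poly K} => size u) E1.
  rewrite size_scale ?lc1 // size_mul // !size_p1 // => sz.
  have hp : (size p <= size h)%N.
    rewrite leqNgt; apply/negP => hp; move: h10; rewrite (pmin h) // map_poly0.
    by rewrite eqxx.
  have m1 : (size m = 1)%N.
    have arith (a b c : nat) : a = (b + c).-1 -> (a <= b)%N -> (0 < a)%N ->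
      (0 < c)%N -> c = 1%N by lia.
    by apply: arith sz hp _ _; rewrite size_poly_gt0.
  have := size_p2 Gm; rewrite m1 => /eqP/size_poly1P[c c0 mc].
  by move: mt; rewrite mc hornerC => /eqP; rewrite (negbTE c0).
move=> qt; have [k [h [r [Gh Grr E rm]]]] := pseudo_division Gm Gq m0.
have rt : (p2 r).[t] = 0.
  have := congr1 (fun u => (p2 u).[t]) E.
  by rewrite rmorphD rmorphM map_polyZ !hornerE qt mt !mulr0 add0r.
have r0 := mmin _ Grr rt rm; rewrite r0 addr0 in E.
have /eqP := congr1 (fun u => (p1 u).[s]) E.
rewrite rmorphM map_polyZ !hornerE ms mulr0 mulf_eq0 (negbTE (lc1 _ _ Gm m0)) /=.
by move/eqP.
Qed.

Lemma adjoin_functional s t : (forall q, over G q -> (p1 q).[s] = 0 -> (p2 q).[t] = 0) ->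
  functional (adjoin G (s, t)).
Proof. by move=> H _ [q Gq ->]; rewrite horner_pair /=; apply: H. Qed.

Lemma adjoin_cofunctional s t : (forall q, over G q -> (p2 q).[t] = 0 -> (p1 q).[s] = 0) ->
  functional (transpose (adjoin G (s, t))).
Proof.
move=> H [x y] [q Gq]; rewrite horner_pair => -[-> ->] /=; exact: H.
Qed.

End PartialIsomorphism.

Definition is_pgraph G : Prop :=
  [/\ is_subring G, functional G & functional (transpose G)].

Definition algebraic S s : Prop := exists2 f : {poly K}, f != 0 & over S f /\ f.[s] = 0.

Lemma chain_subring (A : nzRingType) (F : set (set A)) : F !=set0 ->
  (forall H, F H -> is_subring H) -> total_on F subset ->
  is_subring (\bigcup_(H in F) H).
Proof.
move=> [G FG] Fr Ftot.
have two x y : (\bigcup_(G in F) G) x -> (\bigcup_(G in F) G) y ->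
    exists H, [/\ F H, H x & H y].
  move=> [H1 F1 x1] [H2 F2 y2]; have [s|s] := Ftot _ _ F1 F2.
    by exists H2; split=> //; apply: s.
  by exists H1; split=> //; apply: s.
split=> [|x y Ux Uy|x y Ux Uy].
- by exists G => //; apply: subring1; apply: Fr.
- by have [H [FH Hx Hy]] := two _ _ Ux Uy; exists H => //; apply: subringB => //; apply: Fr.
- by have [H [FH Hx Hy]] := two _ _ Ux Uy; exists H => //; apply: subringM => //; apply: Fr.
Qed.

Lemma transpose_pgraph G : is_pgraph G -> is_pgraph (transpose G).
Proof.
move=> [Gr Gf Gf']; split=> //; first exact: transpose_subring.
by move=> [x y] /= Gxy; apply: (Gf (x, y)).
Qed.

Lemma pgraph_extend G s : is_pgraph G -> algebraic (dom G) s ->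
  exists M, [/\ is_pgraph M, G `<=` M & dom M s].
Proof.
move=> [Gr Gf Gf'] /(algebraic_lift Gr Gf Gf')[t tP].
exists (adjoin G (s, t)); split.
- split; first exact: adjoin_subring.
    by apply: adjoin_functional => q /tP[].
  by apply: adjoin_cofunctional => q /tP[].
- exact: adjoin_sub.
- by exists t; apply: adjoin_mem.
Qed.

(** A maximal partial isomorphism already has every algebraic element in its domain; the same
    argument for the transpose gives the range. *)
Lemma pgraph_total G : is_pgraph G -> (forall a, algebraic (dom G) a) ->
  (forall a, algebraic (dom (transpose G)) a) ->
  exists M, [/\ is_pgraph M, G `<=` M, forall a, dom M a & forall a, dom (transpose M) a].
Proof.
move=> Gp alg alg'.
have [F F0 Fp Ftot|M [Mp GM Mmax]] := @Zorn_extension _ is_pgraph G Gp.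
  split.
  - by apply: chain_subring => // H /Fp[].
  - by move=> x [H /Fp[_ Hf _]]; apply: Hf.
  - by move=> x [H /Fp[_ _ Hf]]; apply: Hf.
exists M; split=> // a.
  have [|M' [Mp' MM' [b M'b]]] := pgraph_extend (s := a) Mp.
    have [f f0 [Gf0 fa]] := alg a; exists f => //; split=> // i.
    by have [c Gc] := Gf0 i; exists c; apply: GM.
  by exists b; apply: (Mmax M').
have [|M' [Mp' MM' [b M'b]]] := pgraph_extend (s := a) (transpose_pgraph Mp).
  have [f f0 [Gf0 fa]] := alg' a; exists f => //; split=> // i.
  by have [c Gc] := Gf0 i; exists c; apply: GM.
exists b; apply: (Mmax (transpose M') (transpose_pgraph Mp')) => //.
by move=> [x y] Mxy; apply: (MM' (y, x)).
Qed.

Lemma pgraph_automorphism M : is_pgraph M -> (forall a, dom M a) ->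
  (forall a, dom (transpose M) a) ->
  exists sigma tau : {rmorphism K -> K}, [/\ cancel sigma tau, cancel tau sigma &
    forall a b, M (a, b) -> sigma a = b].
Proof.
have half G : is_pgraph G -> (forall a, dom G a) ->
    exists sigma : {rmorphism K -> K}, forall a b, G (a, b) <-> sigma a = b.
  move=> [Gr Gf _] /choice[g gP].
  have gE a b : G (a, b) <-> g a = b.
    split=> [Gab|<-//]; apply/eqP; rewrite -subr_eq0; apply/eqP.
    by apply: (Gf (a - a, g a - b)); [apply: (subringB Gr (gP a) Gab)|apply: subrr].
  have gz : zmod_morphism g.
    by move=> a b; apply/gE; apply: (subringB Gr (gP a) (gP b)).
  have gm : monoid_morphism g.
    split; first by apply/gE; apply: (subring1 Gr).
    by move=> a b; apply/gE; apply: (subringM Gr (gP a) (gP b)).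
  pose gZ := GRing.isZmodMorphism.Build K K g gz.
  pose gM := GRing.isMonoidMorphism.Build K K g gm.
  pose h : {rmorphism K -> K} := HB.pack g gZ gM.
  by exists h.
move=> Mp dM dM'; have [s sP] := half M Mp dM.
have [t tP] := half _ (transpose_pgraph Mp) dM'.
exists s, t; split=> [a|a|a b /sP//].
- by apply/tP; apply/sP.
- by apply/sP; apply/tP.
Qed.

Definition is_alg_closed S : Prop :=
  is_subring S /\ forall f : {poly K}, f != 0 -> over S f -> forall a, f.[a] = 0 -> S a.

Lemma alg_closed_transcendental S a : is_alg_closed S -> ~ S a -> transcendental S a.
Proof.
move=> [_ Sc] Sa f Sf fa; apply/eqP; apply: contrapT => /negP f0.
by apply: Sa; apply: (Sc f).
Qed.

(* The exchange of u and w is first extended by the identity on a maximal set of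
   further algebraically independent elements, then to the algebraic closure. *)
Lemma exchange_automorphism F k u w : is_alg_closed F -> is_alg_closed k ->
  F `<=` k -> k w -> ~ F w -> ~ k u ->
  exists sigma tau : {rmorphism K -> K}, [/\ cancel sigma tau, cancel tau sigma,
    forall a, F a -> sigma a = a & sigma u = w].
Proof.
move=> Fc kc Fk kw Fw ku.
have [Fr _] := Fc; have [kr _] := kc.
have Ft := alg_closed_transcendental Fc Fw; have kt := alg_closed_transcendental kc ku.
pose over2 (P : {poly {poly K}}) := forall i j, F P`_i`_j.
(* The graph of the automorphism of [F[u, w]] that swaps [u] and [w]. *)
pose G0 := [set x : K * K | exists2 P, over2 P & x = (P.[u%:P].[w], P.[w%:P].[u])].
(* Since the graphs are required to be symmetric, functionality in one direction gives the other. *)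
pose good G := [/\ is_subring G, functional G, forall x, G x -> G (x.2, x.1) & G0 `<=` G].
have over2M P Q : over2 P -> over2 Q -> over2 (P * Q).
  move=> FP FQ i j; rewrite coefM coef_sum; apply: (subring_sum Fr) => l.
  by rewrite coefM; apply: (subring_sum Fr) => m; apply: (subringM Fr).
(* Algebraic independence of [u] and [w] over [F]: [u] is transcendental over [k], which contains
   [w], and [w] is transcendental over [F]. *)
have gen P : over2 P -> P.[u%:P].[w] = 0 -> P = 0.
  move=> FP P0; apply/polyP => i; rewrite coef0; apply: Ft; first exact: FP.
  pose f := map_poly (horner_eval w) P.
  have fE j : f`_j = (P`_j).[w] by rewrite coef_map.
  have f0 : f = 0.
    apply: kt; first by move=> j; rewrite fE; apply: over_horner => // l; apply: Fk.
    move: P0; rewrite -[P.[u%:P].[w]]/(horner_eval w P.[u%:P]) -horner_map /=.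
    by rewrite /horner_eval hornerC.
  by rewrite -fE f0 coef0.
have G0good : good G0.
  split=> //.
  - split.
    + exists 1; last by rewrite !hornerC.
      move=> i j; rewrite coef1; case: eqP => _ /=; last by rewrite coef0; apply: subring0.
      by rewrite coef1; case: eqP => _ /=; [exact: subring1|exact: subring0].
    + move=> _ _ [P FP ->] [Q FQ ->]; exists (P - Q); last by rewrite !hornerE.
      by move=> i j; rewrite !coefB; apply: subringB.
    + move=> _ _ [P FP ->] [Q FQ ->]; exists (P * Q); first exact: over2M.
      by rewrite !hornerM.
  - by move=> _ [P FP ->] /= /(gen P FP) ->; rewrite !horner0.
  - move=> _ [P FP ->] /=; exists (swapXY P); first by move=> i j; rewrite coef_swapXY.
    by rewrite !horner2_swapXY.
have [H H0 Hg Htot|M [[Mr Mf Msym G0M] _ Mmax]] := @Zorn_extension _ good G0 G0good.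
  split.
  - by apply: chain_subring => // G /Hg[].
  - by move=> x [G /Hg[_ Gf _ _]]; apply: Gf.
  - by move=> x [G HG Gx]; exists G => //; have [_ _ Gs _] := Hg _ HG; apply: Gs.
  - by have [G HG] := H0; apply: subset_trans (bigcup_sup HG); have [] := Hg _ HG.
have trM : transpose M = M.
  apply/seteqP; split=> [[x y] /Msym //|[x y] Mx].
  exact: (Msym _ Mx).
have Mp : is_pgraph M by split=> //; rewrite trM.
(* An element transcendental over the domain could be adjoined as a fixed point, against
   maximality. *)
have alg c : algebraic (dom M) c.
  apply: contrapT => nalg.
  have trc q : over M q -> (p1 q).[c] = 0 -> q = 0.
    move=> Mq qc; apply/eqP; rewrite -(over_p1_eq0 Mf Mq); apply: contrapT => /negP q0.
    by apply: nalg; exists (p1 q) => //; split=> //; apply: over_p1.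
  have cM : ~ dom M c.
    move=> Mc; apply: nalg; exists ('X - c%:P); first by rewrite polyXsubC_eq0.
    split; last by rewrite hornerXsubC subrr.
    move=> i; rewrite coefB coefX coefC; case: i => [|[|i]] /=.
    - by rewrite sub0r; have [b Mb] := Mc; exists (- b); apply: (subringN Mr Mb).
    - by rewrite subr0; exists 1; exact: (subring1 Mr).
    - by rewrite subr0; exists 0; exact: (subring0 Mr).
  apply: cM; exists c; apply: (Mmax (adjoin M (c, c))); last exact: adjoin_mem.
    split; first exact: adjoin_subring.
    - by apply: adjoin_functional => q Mq /(trc q Mq) ->; rewrite rmorph0 horner0.
    - move=> _ [q Mq ->].
      pose q' : {poly K * K} := \poly_(i < size q) ((q`_i).2, (q`_i).1).
      have q'E i : q'`_i = ((q`_i).2, (q`_i).1).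
        by rewrite coef_poly; case: ltnP => // qi; rewrite nth_default.
      exists q'; first by move=> i; rewrite q'E; apply: Msym.
      rewrite !horner_pair /=; congr (_, _); congr (_.[c]); apply/polyP => i.
        by rewrite !coef_map q'E.
      by rewrite !coef_map q'E.
    - by apply: subset_trans G0M _; apply: adjoin_sub.
  exact: adjoin_sub.
have [|E [Ep ME Ed Ed']] := pgraph_total Mp alg; first by rewrite trM.
have [s [t [st ts sE]]] := pgraph_automorphism Ep Ed Ed'.
exists s, t; split=> //.
- move=> a Fa; apply/sE/ME/G0M; exists (a%:P)%:P; last by rewrite !hornerC.
  move=> i j; rewrite coefC; case: eqP => _; last by rewrite coef0; apply: subring0.
  by rewrite coefC; case: eqP => _ //; apply: subring0.
- apply/sE/ME/G0M; exists 'X; last by rewrite !hornerX !hornerC.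
  move=> i j; rewrite coefX; case: eqP => _ /=; last by rewrite coef0; apply: subring0.
  by rewrite coef1; case: eqP => _ /=; [exact: subring1|exact: subring0].
Qed.

(** * A countable algebraically closed subfield that absorbs finite sets *)

Section CountableSubfield.
Hypothesis uncountableK : forall e : nat -> K, exists a, ~ range e a.
Implicit Types (en : nat -> K).

(* The operation z - x * y generates all ring operations from 0 and 1. *)
Definition closure_step en (n : nat) : K :=
  match choice.unpickle n : option ((nat * nat * nat) + (seq nat * nat)) with
  | Some (inl (x, y, z)) => en z - en x * en y
  | Some (inr (s, j)) => (sval (closed_field_poly_normal (Poly (map en s))))`_j
  | None => 0
  end.

Definition closure_enum en (n : nat) : K :=
  if choice.unpickle n is Some (k, m) then iter k closure_step en m else 0.

Lemma closure_enumP en a :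
  (exists k, range (iter k closure_step en) a) -> range (closure_enum en) a.
Proof.
by move=> [k [m _ <-]]; exists (choice.pickle (k, m)) => //; rewrite /closure_enum choice.pickleK.
Qed.

Lemma range_stepB en x y z : range en x -> range en y -> range en z ->
  range (closure_step en) (z - x * y).
Proof.
move=> [i _ <-] [j _ <-] [l _ <-].
exists (choice.pickle (inl (i, j, l) : (nat * nat * nat) + (seq nat * nat))) => //.
by rewrite /closure_step choice.pickleK.
Qed.

(** The stages increase because [z = z - 0 * 0]. The finitely many coefficients of a polynomial
    occur at a common stage, and the next stage contains its roots. *)
Lemma closure_alg_closed en : range en 0 -> range en 1 ->
  is_alg_closed (range (closure_enum en)) /\
  range en `<=` range (closure_enum en).
Proof.
move=> e0 e1; pose S k := range (iter k closure_step en).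
have S0 k : S k 0.
  by elim: k => // k IH; have := range_stepB IH IH IH; rewrite mulr0 subr0.
have SS k : S k `<=` S k.+1.
  by move=> a Sa; have := range_stepB (S0 k) (S0 k) Sa; rewrite mulr0 subr0.
have Sle k l : (k <= l)%N -> S k `<=` S l.
  elim: l => [|l IH]; first by rewrite leqn0 => /eqP ->.
  rewrite leq_eqVlt => /predU1P[->//|]; rewrite ltnS => /IH h.
  exact: subset_trans (SS l).
have out a : range (closure_enum en) a -> exists k, S k a.
  move=> [n _ <-]; rewrite /closure_enum; case: choice.unpickle => [[k m]|].
    by exists k; exists m.
  by exists 0%N; apply: S0.
have inn k a : S k a -> range (closure_enum en) a by move=> Sa; apply: closure_enumP; exists k.
have op x y z : range (closure_enum en) x -> range (closure_enum en) y ->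
    range (closure_enum en) z -> range (closure_enum en) (z - x * y).
  move=> /out[i xi] /out[j yj] /out[l zl]; apply: (inn (maxn i (maxn j l)).+1).
  apply: range_stepB.
  - by apply: (Sle i) xi; lia.
  - by apply: (Sle j) yj; lia.
  - by apply: (Sle l) zl; lia.
have r1 : range (closure_enum en) 1 by apply: (inn 0%N).
have r0 : range (closure_enum en) 0 by apply: (inn 0%N).
split; last by move=> a ea; apply: (inn 0%N).
split; first split=> // x y rx ry.
- by rewrite -[y]mul1r; apply: op.
- have -> : x * y = 0 - (0 - x * y) * 1 by ring.
  exact: (op _ _ _ (op _ _ _ rx ry r0) r1 r0).
move=> f f0 rf a fa.
have [k kf] : exists k, forall i, S k f`_i.
  suff [k kf] : exists k, forall i, (i < size f)%N -> S k f`_i.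
    exists k => i; have [/kf//|h] := ltnP i (size f).
    by rewrite nth_default.
  elim: (size f) => [|n [k kP]]; first by exists 0%N.
  have [l lP] := out _ (rf n); exists (maxn k l) => i.
  rewrite ltnS leq_eqVlt => /predU1P[->|/kP h].
    by apply: Sle lP; apply: leq_maxr.
  by apply: Sle h; apply: leq_maxl.
have [m mP] := choice (fun i => let: ex_intro2 m _ e := kf i in ex_intro (fun m => _ = f`_i) m e).
apply: (inn k.+1); pose s := mkseq m (size f).
have fE : Poly (map (iter k closure_step en) s) = f.
  apply/polyP => i; rewrite coef_Poly; have [h|h] := ltnP i (size f).
    by rewrite (nth_map 0%N) ?size_mkseq // nth_mkseq // mP.
  by rewrite !nth_default // size_map size_mkseq.
case rE : (closed_field_poly_normal f) => [r fr].
have ar : a \in r.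
  move: fa; rewrite fr hornerZ horner_prod => /eqP.
  rewrite mulf_eq0 lead_coef_eq0 (negbTE f0) /= prodf_seq_eq0 => /hasP[b br].
  by rewrite hornerXsubC subr_eq0 => /eqP ->.
exists (choice.pickle (inr (s, index a r) : (nat * nat * nat) + (seq nat * nat))) => //.
by rewrite /= /closure_step choice.pickleK fE rE /= nth_index.
Qed.

(** The subfield is the union of a tower of countable algebraically closed fields [E i], each
    missing [w (E i)], which lies in the next one. The images of the elements already treated lie in
    one [E i], so a new element outside the union is exchanged with [w (E i)] while [E i] is
    fixed. *)
Lemma countable_universal_subfield : exists kinf : nat -> K,
  forall s : seq K, exists sigma tau : {rmorphism K -> K},
    [/\ cancel sigma tau, cancel tau sigma & forall x, x \in s -> range kinf (sigma x)].
Proof.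
have [w wP] := choice uncountableK.
pose econs a en n := if n is n'.+1 then en n' else a : K.
pose E := fix E i := closure_enum (if i is i'.+1 then econs (w (E i')) (E i')
  else fun n => if n is 0%N then 0 else 1).
have sub_cons a en : range en `<=` range (econs a en).
  by move=> _ [n _ <-]; exists n.+1.
have Ec i : is_alg_closed (range (E i)).
  elim: i => [|i IH]; first by apply: (closure_alg_closed _ _).1; [exists 0%N|exists 1%N].
  by have [Sr _] := IH; apply: (closure_alg_closed _ _).1; apply: sub_cons;
    [apply: subring0|apply: subring1].
have [E0 E1] : (forall i, range (E i) 0) /\ (forall i, range (E i) 1).
  by split=> i; have [Sr _] := Ec i; [apply: subring0|apply: subring1].
have cons_sub i : range (econs (w (E i)) (E i)) `<=` range (E i.+1).
  by apply: (closure_alg_closed _ _).2; apply: sub_cons.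
have Ew i : range (E i.+1) (w (E i)) by apply: cons_sub; exists 0%N.
have Enw i : ~ range (E i) (w (E i)) by apply: wP.
have ES i : range (E i) `<=` range (E i.+1).
  by apply: subset_trans (cons_sub i); apply: sub_cons.
have Ele i j : (i <= j)%N -> range (E i) `<=` range (E j).
  elim: j => [|j IH]; first by rewrite leqn0 => /eqP ->.
  rewrite leq_eqVlt => /predU1P[->//|]; rewrite ltnS => /IH h.
  exact: subset_trans (ES j).
pose kinf n := if choice.unpickle n is Some (i, m) then E i m else 0.
have kinfP a : range kinf a <-> exists i, range (E i) a.
  split=> [[n _ <-]|[i [m _ <-]]]; last first.
    by exists (choice.pickle (i, m)) => //; rewrite /kinf choice.pickleK.
  by rewrite /kinf; case: choice.unpickle => [[i m]|]; [exists i; exists m|exists 0%N].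
have kc : is_alg_closed (range kinf).
  have -> : range kinf = \bigcup_(H in range (fun i => range (E i))) H.
    apply/seteqP; split=> [a /kinfP[i Ea]|a [_ [i _ <-] Ea]].
      by exists (range (E i)) => //; exists i.
    by apply/kinfP; exists i.
  split.
    apply: chain_subring; first by exists (range (E 0%N)); exists 0%N.
      by move=> _ [i _ <-]; have [] := Ec i.
    move=> _ _ [i _ <-] [j _ <-]; have [ij|/ltnW ji] := leqP i j; [left|right]; exact: Ele.
  move=> f f0 Sf a fa.
  have [k kf] : exists k, forall i, range (E k) f`_i.
    suff [k kf] : exists k, forall i, (i < size f)%N -> range (E k) f`_i.
      exists k => i; have [/kf//|h] := ltnP i (size f).
      by rewrite nth_default.
    elim: (size f) => [|n [k kP]]; first by exists 0%N.
    have [_ [l _ <-] lP] := Sf n; exists (maxn k l) => i.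
    rewrite ltnS leq_eqVlt => /predU1P[->|/kP h].
      by apply: Ele lP; apply: leq_maxr.
    by apply: Ele h; apply: leq_maxl.
  exists (range (E k)); first by exists k.
  by have [_ Hc] := Ec k; apply: (Hc f).
exists kinf; elim=> [|x s [sg [ta [st ts sP]]]].
  by exists idfun, idfun.
have [kx|nkx] := pselect (range kinf (sg x)).
  by exists sg, ta; split=> // y; rewrite inE => /predU1P[->//|]; apply: sP.
have [i iP] : exists i, forall y, y \in s -> range (E i) (sg y).
  elim: s sP => [|y s IH] sP; first by exists 0%N.
  have [i iP] : exists i, forall z, z \in s -> range (E i) (sg z).
    by apply: IH => z zs; apply: sP; rewrite inE zs orbT.
  have /kinfP[j jP] : range kinf (sg y) by apply: sP; rewrite inE eqxx.
  exists (maxn i j) => z; rewrite inE => /predU1P[->|/iP h].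
    by apply: Ele jP; apply: leq_maxr.
  by apply: Ele h; apply: leq_maxl.
have Eki : range (E i) `<=` range kinf by move=> a Ea; apply/kinfP; exists i.
have kw : range kinf (w (E i)) by apply/kinfP; exists i.+1.
have [s' [t' [s't' t's' fixE s'x]]] := exchange_automorphism (Ec i) kc Eki kw (Enw i) nkx.
exists (s' \o sg : {rmorphism K -> K}), (ta \o t' : {rmorphism K -> K}); split.
- by move=> a /=; rewrite s't' st.
- by move=> a /=; rewrite ts t's'.
- move=> y; rewrite inE /= => /predU1P[->|ys]; first by rewrite s'x.
  by rewrite fixE; [apply: sP|apply: iP].
Qed.

End CountableSubfield.

End Automorphisms.

(** * Conjugate varieties *)

(** Conjugation is not linear over the complex numbers: it twists scalars by [s]. As [s] is
    bijective, relations still correspond to relations and free families to free families. *)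
Lemma ldim_semilinear (R : realType) (k : fieldType) (s : {rmorphism k -> k})
    (V V' : lmodType k) (F : V -> V') (W U : set V) (W' U' : set V') :
  bijective s -> (forall y, exists x, F x = y) -> {morph F : x y / x + y} -> F 0 = 0 ->
  (forall c x, F (c *: x) = s c *: F x) ->
  (forall x, W x <-> W' (F x)) -> (forall x, U x <-> U' (F x)) ->
  ldim R W' U' = ldim R W U.
Proof.
move=> [t st ts] Fsurj FD F0 FZ WW' UU'.
have Fsum m (c : 'I_m -> k) (v : 'I_m -> V) :
    F (\sum_i c i *: v i) = \sum_i s (c i) *: F (v i).
  by rewrite (big_morph F FD F0); apply: eq_bigr.
rewrite /ldim; congr ereal_sup; congr image; apply/seteqP; split=> m [v Wv vfree].
  have [w wE] := choice (fun i => Fsurj (v i)).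
  exists w => [i|c Uc i]; first by apply/WW'; rewrite wE.
  have : s (c i) = 0.
    apply: (vfree (fun i => s (c i))); rewrite (eq_bigr (fun i => s (c i) *: F (w i))).
      by rewrite -Fsum; apply/UU'.
    by move=> j _; rewrite wE.
  by move=> sc; apply/eqP; rewrite -(fmorph_eq0 s) sc.
exists (fun i => F (v i)) => [i|c Uc i]; first exact/WW'.
have : t (c i) = 0.
  apply: (vfree (fun i => t (c i))); apply/UU'; rewrite Fsum.
  by under eq_bigr do rewrite ts.
by move=> /(congr1 s); rewrite ts rmorph0.
Qed.

Lemma hcls_divB (R : realType) (N : nat) (X : pvar R N) a b a' b' :
  ~ idl X b -> ~ idl X b' ->
  hcls X a / hcls X b - hcls X a' / hcls X b' =
  hcls X (a * b' - a' * b) / hcls X (b * b').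
Proof.
move=> /hcls_neq0 Xb /hcls_neq0 Xb'.
by rewrite rmorphB !rmorphM /= -(mulNr (hcls X a') (hcls X b')^-1) (addf_div _ _ Xb Xb') mulNr.
Qed.

Section Conjugation.
Variable R : realType.

(** The inverse is part of the data because the ideal of a conjugate variety is defined by pulling
    back along it. *)
Record cauto := CAuto {
  cfwd :> {rmorphism R[i] -> R[i]};
  cbwd : {rmorphism R[i] -> R[i]};
  cfwdK : cancel cfwd cbwd;
  cbwdK : cancel cbwd cfwd }.

Definition cauto_inv (g : cauto) : cauto := CAuto (@cbwdK g) (@cfwdK g).

Variable N : nat.
Local Notation A := (mpoly N.+1 R[i]).
Local Notation pvar := (pvar R N).
Implicit Types (g : cauto) (a b : A) (X Z P Q C W : pvar).

(* Locked, since unification must not unfold operations on polynomials. *)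
Fact conj_mpoly_key : unit. Proof. by []. Qed.
Definition conj_mpoly g : A -> A :=
  locked_with conj_mpoly_key (@map_mpoly N.+1 R[i] R[i] g).

Lemma conj_mpolyE g a : conj_mpoly g a = map_mpoly g a.
Proof. by rewrite /conj_mpoly unlock. Qed.

Fact conj_mpoly_is_zmod_morphism g : zmod_morphism (conj_mpoly g).
Proof. by move=> a b; rewrite !conj_mpolyE rmorphB. Qed.

Fact conj_mpoly_is_monoid_morphism g : monoid_morphism (conj_mpoly g).
Proof. by split=> [|a b]; rewrite !conj_mpolyE ?rmorph1 ?rmorphM. Qed.

HB.instance Definition _ g := GRing.isZmodMorphism.Build A A (conj_mpoly g)
  (conj_mpoly_is_zmod_morphism g).
HB.instance Definition _ g := GRing.isMonoidMorphism.Build A A (conj_mpoly g)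
  (conj_mpoly_is_monoid_morphism g).

Lemma conj_mpolyK g : cancel (conj_mpoly g) (conj_mpoly (cauto_inv g)).
Proof.
by move=> a; apply/mpolyP => m; rewrite !conj_mpolyE !mcoeff_map_mpoly /= cfwdK.
Qed.

Lemma conj_mpolyVK g : cancel (conj_mpoly (cauto_inv g)) (conj_mpoly g).
Proof.
by move=> a; apply/mpolyP => m; rewrite !conj_mpolyE !mcoeff_map_mpoly /= cbwdK.
Qed.

Lemma homog_conj g d a : homog d (conj_mpoly g a) = homog d a.
Proof.
apply/dhomogP/dhomogP => H m mm; apply: H; move: mm; rewrite !mcoeff_msupp;
  by rewrite conj_mpolyE mcoeff_map_mpoly fmorph_eq0.
Qed.

Lemma pihomog_conj g d a :
  pihomog mdeg d (conj_mpoly g a) = conj_mpoly g (pihomog mdeg d a).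
Proof.
rewrite {1}[a]homog_decomp rmorph_sum linear_sum /=.
have E (i : nat) : pihomog mdeg d (conj_mpoly g (pihomog mdeg i a)) =
    if i == d then conj_mpoly g (pihomog mdeg i a) else 0.
  have h : homog i (conj_mpoly g (pihomog mdeg i a)) by rewrite homog_conj homog_pihomog.
  by case: eqP => [<-|/eqP ne]; [apply: pihomog_homog|apply: pihomog_ne0 h].
under eq_bigr do rewrite E.
rewrite -big_mkcond /=; have [lt|ge] := ltnP d (mmeasure mdeg a).
  by rewrite (big_pred1 (Ordinal lt)) // => i /=; apply/eqP/eqP => [h|->//]; apply: val_inj.
rewrite big1 => [|i /eqP h]; last by have := ltn_ord i; rewrite h ltnNge ge.
suff -> : pihomog mdeg d a = 0 by rewrite rmorph0.
rewrite [a]homog_decomp linear_sum /= big1 // => i _.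
apply: (@pihomog_ne0 _ _ _ i); last exact: homog_pihomog.
by have := ltn_ord i; case: eqP => // ->; rewrite ltnNge ge.
Qed.

Lemma conj_var g i : conj_mpoly g (mpolyX R[i] (mnm1 i)) = mpolyX R[i] (mnm1 i).
Proof. by rewrite conj_mpolyE; exact: map_mpolyX. Qed.

Section ConjPvar.
Variables (g : cauto) (X : pvar).
Let I a := ideal X (conj_mpoly (cauto_inv g) a).

Fact conj_ideal_closed : idealr_closed I.
Proof.
have [h0 h1 h2] := ideal_closed X; rewrite /I; split; rewrite ?unfold_in.
- by rewrite rmorph0.
- by rewrite rmorph1.
- move=> a u v; rewrite !unfold_in (rmorphD (conj_mpoly (cauto_inv g))).
  rewrite (rmorphM (conj_mpoly (cauto_inv g))); exact: h2.
Qed.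

Fact conj_ideal_prime : prime_idealr_closed I.
Proof. by move=> a b; rewrite /I !unfold_in rmorphM; apply: ideal_prime. Qed.

Fact conj_ideal_homog a d : a \in I -> pihomog mdeg d a \in I.
Proof. by rewrite /I !unfold_in -pihomog_conj; apply: ideal_homog. Qed.

Fact conj_ideal_relevant : exists i : 'I_N.+1, mpolyX R[i] (mnm1 i) \notin I.
Proof.
have [i iX] := ideal_relevant X.
by exists i; rewrite /I unfold_in conj_var.
Qed.

Definition conj_pvar : pvar :=
  PVar conj_ideal_closed conj_ideal_prime conj_ideal_homog conj_ideal_relevant.

End ConjPvar.

Lemma idl_conj g X a : idl (conj_pvar g X) (conj_mpoly g a) <-> idl X a.
Proof. by rewrite -{2}(conj_mpolyK g a); exact: iff_refl. Qed.

Lemma idl_conjV g X a : idl (conj_pvar g X) a <-> idl X (conj_mpoly (cauto_inv g) a).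
Proof. exact: iff_refl. Qed.

Lemma conj_pvarVK g X : conj_pvar g (conj_pvar (cauto_inv g) X) = X.
Proof.
apply: pvar_eq; apply/funext => a.
by rewrite -[in RHS](conj_mpolyVK g a).
Qed.

Lemma conj_pvarK g X : conj_pvar (cauto_inv g) (conj_pvar g X) = X.
Proof.
apply: pvar_eq; apply/funext => a.
by rewrite -[in RHS](conj_mpolyK g a).
Qed.

Lemma subvar_conj g Z X : subvar (conj_pvar g Z) (conj_pvar g X) <-> subvar Z X.
Proof.
rewrite !subvarP; split=> H a; last by rewrite !idl_conjV => /H.
by move=> /(idl_conj g) /H /idl_conj.
Qed.

Lemma closed_point_conj g P : closed_point P -> closed_point (conj_pvar g P).
Proof.
by move=> Pcl Q; rewrite -(conj_pvarVK g Q) !subvar_conj; apply: Pcl.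
Qed.

Lemma closed_point_conjE g P : closed_point (conj_pvar g P) <-> closed_point P.
Proof.
split; last exact: closed_point_conj.
by move=> /(@closed_point_conj (cauto_inv g)); rewrite conj_pvarK.
Qed.

Lemma chain_conj g X m : chain X m -> chain (conj_pvar g X) m.
Proof.
move=> [c [cX cS]]; exists (fun i => conj_pvar g (c i)); split=> i im.
  by rewrite subvar_conj; apply: cX.
by rewrite !subvar_conj; apply: cS.
Qed.

Lemma chain_conjE g X m : chain (conj_pvar g X) m <-> chain X m.
Proof.
split; last exact: chain_conj.
by move=> /(@chain_conj (cauto_inv g)); rewrite conj_pvarK.
Qed.

Lemma pdim_conj g X : pdim (conj_pvar g X) = pdim X.
Proof.
have E : chain (conj_pvar g X) = chain X by apply/funext => m; apply/propext/chain_conjE.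
by rewrite /pdim E.
Qed.

Section ConjHfrac.
Variables (g : cauto) (X : pvar).
Local Notation Y := (conj_pvar g X).

Definition conj_hfrac (phi : hfrac X) : hfrac Y :=
  xget 0 [set psi | exists a b, [/\ ~ idl X b, phi = hcls X a / hcls X b &
    psi = hcls Y (conj_mpoly g a) / hcls Y (conj_mpoly g b)]].

Lemma conj_hfracE a b : ~ idl X b -> conj_hfrac (hcls X a / hcls X b) =
  hcls Y (conj_mpoly g a) / hcls Y (conj_mpoly g b).
Proof.
move=> Xb; apply: xget_unique; first by exists a, b.
move=> _ [a' [b' [Xb' E ->]]].
have nz c : ~ idl X c -> hcls Y (conj_mpoly g c) != 0.
  by move=> Xc; apply: hcls_neq0; rewrite idl_conj.
apply/eqP; rewrite (eqr_div _ _ (nz _ Xb') (nz _ Xb)) -!rmorphM; apply/eqP.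
apply/hcls_eq; rewrite -rmorphB; apply/idl_conj/hcls_eq; rewrite !rmorphM; apply/eqP.
by rewrite -(eqr_div _ _ (hcls_neq0 Xb') (hcls_neq0 Xb)) E.
Qed.

Fact conj_hfrac_is_zmod_morphism : zmod_morphism conj_hfrac.
Proof.
move=> x y; have [a [b [Xb ->]]] := hfrac_num_den x; have [c [d [Xd ->]]] := hfrac_num_den y.
have nz e : ~ idl X e -> ~ idl Y (conj_mpoly g e) by rewrite idl_conj.
rewrite (conj_hfracE _ Xb) (conj_hfracE _ Xd).
apply: (etrans (congr1 conj_hfrac (hcls_divB a c Xb Xd))).
apply: (etrans (conj_hfracE _ (idl_mul Xb Xd))); symmetry.
apply: (etrans (hcls_divB _ _ (nz _ Xb) (nz _ Xd))).
have conjM := rmorphM (conj_mpoly g).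
by rewrite -!conjM -(rmorphB (conj_mpoly g)).
Qed.

Fact conj_hfrac_is_monoid_morphism : monoid_morphism conj_hfrac.
Proof.
split=> [|x y].
  have -> : (1 : hfrac X) = hcls X 1 / hcls X 1 by rewrite rmorph1 divr1.
  by rewrite (conj_hfracE _ (@idl1 _ _ X)) !rmorph1 divr1.
have [a [b [Xb ->]]] := hfrac_num_den x; have [c [d [Xd ->]]] := hfrac_num_den y.
rewrite (conj_hfracE _ Xb) (conj_hfracE _ Xd).
apply: (etrans (congr1 conj_hfrac (hcls_divM X a b c d))).
apply: (etrans (conj_hfracE _ (idl_mul Xb Xd))); symmetry.
apply: (etrans (hcls_divM Y _ _ _ _)).
have conjM := rmorphM (conj_mpoly g).
by rewrite -!conjM.
Qed.

HB.instance Definition _ := GRing.isZmodMorphism.Build (hfrac X) (hfrac Y)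
  conj_hfrac conj_hfrac_is_zmod_morphism.
HB.instance Definition _ := GRing.isMonoidMorphism.Build (hfrac X) (hfrac Y)
  conj_hfrac conj_hfrac_is_monoid_morphism.

Lemma conj_hfrac_surj (psi : hfrac Y) : exists phi, conj_hfrac phi = psi.
Proof.
have [a [b [Yb ->]]] := hfrac_num_den psi.
exists (hcls X (conj_mpoly (cauto_inv g) a) / hcls X (conj_mpoly (cauto_inv g) b)).
by rewrite (conj_hfracE _ Yb) !conj_mpolyVK.
Qed.

Lemma conj_hfrac_hcls a : conj_hfrac (hcls X a) = hcls Y (conj_mpoly g a).
Proof.
have -> : hcls X a = hcls X a / hcls X 1 by rewrite rmorph1 divr1.
by rewrite (conj_hfracE _ (@idl1 _ _ X)) !rmorph1 divr1.
Qed.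

Lemma conj_hfracZ c phi : conj_hfrac (c *: phi) = g c *: conj_hfrac phi.
Proof.
rewrite !hfrac_scaleE rmorphM /= conj_hfrac_hcls.
by rewrite conj_mpolyE map_mpolyC.
Qed.

Lemma local_ring_conj_sub Z phi : subvar Z X -> local_ring X Z phi ->
  local_ring Y (conj_pvar g Z) (conj_hfrac phi).
Proof.
rewrite !local_ringE => ZX [d [a [b [_ da db Zb ->]]]].
have Xb : ~ idl X b by move=> Xb; apply: Zb; apply: ZX.
rewrite conj_hfracE //; exists d, (conj_mpoly g a), (conj_mpoly g b).
by split; rewrite ?homog_conj // idl_conj.
Qed.

Lemma local_ring_conj Z phi : subvar Z X ->
  local_ring Y (conj_pvar g Z) (conj_hfrac phi) <-> local_ring X Z phi.
Proof.
move=> ZX; split; last exact: local_ring_conj_sub.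
rewrite !local_ringE => -[d [a [b [_ da db Zb E]]]].
exists d, (conj_mpoly (cauto_inv g) a), (conj_mpoly (cauto_inv g) b).
split; [by []|by rewrite homog_conj|by rewrite homog_conj|exact: Zb|].
apply: (fmorph_inj conj_hfrac); apply: (etrans E); symmetry.
have Xb : ~ idl X (conj_mpoly (cauto_inv g) b) by move=> Xb; apply: Zb; exact: (ZX _ Xb).
by apply: (etrans (conj_hfracE _ Xb)); rewrite !conj_mpolyVK.
Qed.

Lemma local_unit_conj Z phi : subvar Z X ->
  local_unit (conj_pvar g Z) (conj_hfrac phi) <-> local_unit Z phi.
Proof.
move=> ZX; split=> -[/eqP p0 h1 h2]; split.
- by apply/eqP => p1; apply: p0; rewrite p1; exact: (rmorph0 conj_hfrac).
- exact/(local_ring_conj _ ZX).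
- by apply/(local_ring_conj _ ZX); rewrite fmorphV.
- by rewrite fmorph_eq0; apply/eqP.
- exact/(local_ring_conj _ ZX).
- by rewrite -fmorphV; apply/(local_ring_conj _ ZX).
Qed.

Lemma fun_field_conj phi : fun_field Y (conj_hfrac phi) <-> fun_field X phi.
Proof. exact: local_ring_conj (@subvar_refl _ _ X). Qed.

Lemma colength_conj P (a : hfrac X) : subvar P X ->
  colength (conj_pvar g P) (conj_hfrac a) = colength P a.
Proof.
move=> PX; apply: (congr1 (@fine R)).
apply: (@ldim_semilinear R R[i] (cfwd g) (hfrac X) (hfrac Y) conj_hfrac).
- by exists (cbwd g); [exact: cfwdK|exact: cbwdK].
- exact: conj_hfrac_surj.
- exact: rmorphD.
- exact: rmorph0.
- exact: conj_hfracZ.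
- by move=> x; rewrite local_ring_conj.
- move=> x; split=> [[y Oy <-]|[y' Oy' E]].
    by exists (conj_hfrac y); [apply/local_ring_conj|rewrite rmorphM].
  have [y yE] := conj_hfrac_surj y'; subst y'.
  exists y; first exact: (proj1 (local_ring_conj y PX) Oy').
  apply: (fmorph_inj conj_hfrac); exact: (etrans (rmorphM conj_hfrac a y) E).
Qed.

Lemma ord_conj P phi : subvar P X -> ord (conj_pvar g P) (conj_hfrac phi) = ord P phi.
Proof.
move=> PX; apply: (congr1 (xget 0)); apply/seteqP; split=> r.
  move=> [a' [b' [[Oa /eqP a0] [Ob /eqP b0] E ->]]].
  have [a aE] := conj_hfrac_surj a'; have [b bE] := conj_hfrac_surj b'; subst a' b'.
  exists a, b; split; last by rewrite (colength_conj a PX) (colength_conj b PX).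
  - split; first exact/(local_ring_conj _ PX).
    by apply/eqP => z; apply: a0; rewrite z; exact: (rmorph0 conj_hfrac).
  - split; first exact/(local_ring_conj _ PX).
    by apply/eqP => z; apply: b0; rewrite z; exact: (rmorph0 conj_hfrac).
  - apply: (fmorph_inj conj_hfrac); exact: (etrans E (esym (fmorph_div conj_hfrac a b))).
move=> [a [b [[Oa /eqP a0] [Ob /eqP b0] -> ->]]]; exists (conj_hfrac a), (conj_hfrac b).
have nz (x : hfrac X) : x <> 0 -> conj_hfrac x != 0.
  by move=> x0; rewrite fmorph_eq0; apply/eqP.
split; last by rewrite (colength_conj a PX) (colength_conj b PX).
- by split; [exact/(local_ring_conj _ PX)|exact: nz].
- by split; [exact/(local_ring_conj _ PX)|exact: nz].
- exact: (fmorph_div conj_hfrac a b).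
Qed.

End ConjHfrac.

Lemma restr_conj g X C (phi : hfrac X) : subvar C X -> local_ring X C phi ->
  restr (conj_pvar g C) (conj_hfrac g phi) = conj_hfrac g (restr C phi).
Proof.
move=> CX; rewrite local_ringE => -[d [a [b [_ da db Cb ->]]]].
have Xb : ~ idl X b by move=> Xb; apply: Cb; apply: CX.
have Yb : ~ idl (conj_pvar g C) (conj_mpoly g b) by rewrite idl_conj.
have CX' : subvar (conj_pvar g C) (conj_pvar g X) by rewrite subvar_conj.
rewrite (conj_hfracE _ _ Xb) (restrE CX da db Cb) (conj_hfracE _ _ Cb).
by apply: (restrE (d := d) CX') => //; rewrite homog_conj.
Qed.

End Conjugation.

(** * Conjugation of divisors, numerical classes and volumes *)

Section ConjCartier.
Variables (R : realType) (N : nat) (g : cauto R) (X : pvar R N).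
Implicit Types (D : cartier X) (Z P C W : pvar R N).
Local Notation Y := (conj_pvar g X).
Local Notation T := (@conj_hfrac R N g X).
Local Notation unconj := (conj_pvar (cauto_inv g)).

Lemma subvar_unconj W : subvar W Y -> subvar (unconj W) X.
Proof. by rewrite -{1}(conj_pvarVK g W) subvar_conj. Qed.

Lemma idl_unconj W h : idl W (conj_mpoly g h) <-> idl (unconj W) h.
Proof. by rewrite -{1}(conj_pvarVK g W) idl_conj. Qed.

Section Cartier.
Variable D : cartier X.
Let f W := T (local_eq D (unconj W)).

Fact conj_cartier_neq0 W : subvar W Y -> f W != 0.
Proof. by move=> /subvar_unconj WX; rewrite fmorph_eq0; apply: local_eq_neq0. Qed.

Fact conj_cartier_fun W : subvar W Y -> fun_field Y (f W).
Proof. by move=> /subvar_unconj WX; apply/fun_field_conj; apply: local_eq_fun. Qed.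

Fact conj_cartier_compat W : subvar W Y ->
  exists h, [/\ exists d, homog d h, h \notin ideal W &
    forall W', subvar W' Y -> h \notin ideal W' -> local_unit W' (f W / f W')].
Proof.
move=> /subvar_unconj WX; have [h [[d hd] Wh] H] := local_unit_near D WX.
exists (conj_mpoly g h); split; first by exists d; rewrite homog_conj.
  by apply/negP => /idl_unconj.
move=> W' W'Y /negP W'h; have W'X := subvar_unconj W'Y.
have u := H _ W'X (fun k => W'h (proj2 (idl_unconj W' h) k)).
have := proj2 (local_unit_conj g _ W'X) u.
by rewrite conj_pvarVK fmorph_div.
Qed.

Definition conj_cartier : cartier Y :=
  Cartier conj_cartier_neq0 conj_cartier_fun conj_cartier_compat.

Lemma local_eq_conj Z : local_eq conj_cartier (conj_pvar g Z) = T (local_eq D Z).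
Proof. by rewrite /= /f conj_pvarK. Qed.

End Cartier.

Lemma cartier_eq (E F : cartier Y) : local_eq E = local_eq F -> E = F.
Proof.
case: E F => [f f0 ff fc] [f' f0' ff' fc'] /= e; subst f'.
by congr Cartier; apply: Prop_irrelevance.
Qed.

Lemma conj_cartier_surj (E : cartier Y) : exists D, conj_cartier D = E.
Proof.
have [f fE] := choice (fun Z => conj_hfrac_surj (local_eq E (conj_pvar g Z))).
have f0 Z : subvar Z X -> f Z != 0.
  move=> ZX; rewrite -(fmorph_eq0 (@conj_hfrac R N g X)) /= fE.
  by apply: local_eq_neq0; rewrite subvar_conj.
have ff Z : subvar Z X -> fun_field X (f Z).
  move=> ZX; apply/(fun_field_conj g); rewrite fE.
  by apply: local_eq_fun; rewrite subvar_conj.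
have fc Z : subvar Z X -> exists h, [/\ exists d, homog d h, h \notin ideal Z &
    forall W, subvar W X -> h \notin ideal W -> local_unit W (f Z / f W)].
  move=> ZX; have ZY : subvar (conj_pvar g Z) Y by rewrite subvar_conj.
  have [h [[d hd] Zh] H] := local_unit_near E ZY.
  exists (conj_mpoly (cauto_inv g) h); split; first by exists d; rewrite homog_conj.
    exact/negP.
  move=> W WX /negP Wh; have WY : subvar (conj_pvar g W) Y by rewrite subvar_conj.
  have u := H _ WY Wh; rewrite -(fE Z) -(fE W) -fmorph_div in u.
  exact: (proj1 (local_unit_conj g _ WX) u).
exists (Cartier f0 ff fc); apply: cartier_eq; apply/funext => W /=.
by rewrite fE conj_pvarVK.
Qed.

Lemma local_deg_conj D C P : subvar C X -> subvar P C ->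
  local_deg (conj_pvar g C) (conj_cartier D) (conj_pvar g P) = local_deg C D P.
Proof.
move=> CX PC; rewrite /local_deg !local_eq_conj.
have [_ u _] := local_eq_ratio CX D PC.
apply: etrans (ord_conj g (restr C (local_eq D P / local_eq D C)) PC).
apply: (congr1 (ord (conj_pvar g P))).
apply: etrans (restr_conj g CX u).
by apply: (congr1 (restr (conj_pvar g C))); rewrite fmorph_div.
Qed.

Lemma inum_conj D C : subvar C X ->
  inum (conj_cartier D) (conj_pvar g C) = inum D C.
Proof.
move=> CX.
have bij : set_bij [set P | subvar P C /\ closed_point P]
    [set P | subvar P (conj_pvar g C) /\ closed_point P] (conj_pvar g).
  split.
  - by move=> P [PC Pcl]; split; [rewrite subvar_conj|apply/closed_point_conjE].
  - by move=> P Q _ _ /(congr1 unconj); rewrite !conj_pvarK.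
  - move=> W [WC Wcl]; exists (unconj W); last exact: conj_pvarVK.
    rewrite -(conj_pvarVK g W) subvar_conj in WC.
    by split=> //; rewrite -(closed_point_conjE g) conj_pvarVK.
have E := @reindex_fsbig R 0 +%R _ _ _ _ _
  (local_deg (conj_pvar g C) (conj_cartier D)) bij.
apply: (etrans E).
by apply: eq_fsbigr => P /[!inE] -[PC _]; apply: local_deg_conj.
Qed.

Lemma sections_conj D k phi :
  sections (conj_cartier D) k (T phi) <-> sections D k phi.
Proof.
have E Z : T phi * local_eq (conj_cartier D) (conj_pvar g Z) ^+ k =
    T (phi * local_eq D Z ^+ k).
  rewrite local_eq_conj; symmetry; apply: etrans (rmorphM T _ _) _.
  by apply: (congr1 (fun x => T phi * x)); apply: (rmorphXn T).
split=> -[Kphi H]; split; try exact/(fun_field_conj g).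
- move=> Z ZX; apply/(local_ring_conj g _ ZX); rewrite -E.
  by apply: H; rewrite subvar_conj.
- move=> W WY; have WX := subvar_unconj WY; rewrite -(conj_pvarVK g W) E.
  by apply/(local_ring_conj g _ WX); apply: H.
Qed.

Lemma vol_cartier_conj D : vol_cartier (conj_cartier D) = vol_cartier D.
Proof.
suff S k : ldim R (sections (conj_cartier D) k) [set 0] = ldim R (sections D k) [set 0].
  rewrite /vol_cartier pdim_conj; apply: (congr1 (@limn_esup R)); apply/funext => k.
  by apply: (congr1 (fun x => x * _)%E); apply: S.
apply: (@ldim_semilinear R R[i] (cfwd g) (hfrac X) (hfrac Y) T).
- by exists (cbwd g); [exact: cfwdK|exact: cbwdK].
- exact: conj_hfrac_surj.
- exact: rmorphD.
- exact: rmorph0.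
- exact: conj_hfracZ.
- by move=> x; rewrite sections_conj.
- move=> x /=; split=> [->|]; first exact: rmorph0.
  by move/eqP; rewrite fmorph_eq0 => /eqP.
Qed.

Definition conj_rdivisor (D : rdivisor X) : rdivisor Y :=
  [seq (t.1, conj_cartier t.2) | t <- D].

Lemma rinum_conj (D : rdivisor X) C : subvar C X ->
  rinum (conj_rdivisor D) (conj_pvar g C) = rinum D C.
Proof.
by move=> CX; rewrite /rinum big_map; apply: eq_bigr => t _; rewrite inum_conj.
Qed.

Definition conj_N1 (x : N1 X) : N1 Y := N1_class (conj_rdivisor (repr x)).

Lemma rinum_conj_N1 (x : N1 X) C : subvar C X -> pdim C = 1%N ->
  rinum (repr (conj_N1 x)) (conj_pvar g C) = rinum (repr x) C.
Proof.
by move=> CX C1; rewrite rinum_repr ?subvar_conj ?pdim_conj // rinum_conj.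
Qed.

Lemma conj_N1_eq (y z : N1 Y) : (forall C, subvar C X -> pdim C = 1%N ->
  rinum (repr y) (conj_pvar g C) = rinum (repr z) (conj_pvar g C)) -> y = z.
Proof.
move=> H; apply: N1_eq => C CY C1; rewrite -(conj_pvarVK g C).
by apply: H; [exact: subvar_unconj|rewrite pdim_conj].
Qed.

Fact conj_N1_is_linear : linear conj_N1.
Proof.
move=> c x y; apply: conj_N1_eq => C CX C1.
have CY : subvar (conj_pvar g C) Y by rewrite subvar_conj.
have C1' : pdim (conj_pvar g C) = 1%N by rewrite pdim_conj.
by rewrite rinumD // rinumZ // !rinum_conj_N1 // rinumD // rinumZ.
Qed.

HB.instance Definition _ := GRing.isLinear.Build R (N1 X) (N1 Y) _ conj_N1
  conj_N1_is_linear.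

Lemma conj_N1_class D : conj_N1 (cartier_class D) = cartier_class (conj_cartier D).
Proof.
apply: conj_N1_eq => C CX C1.
have CY : subvar (conj_pvar g C) Y by rewrite subvar_conj.
have C1' : pdim (conj_pvar g C) = 1%N by rewrite pdim_conj.
apply: etrans (rinum_conj_N1 _ CX C1) _; apply: etrans (rinum_cartier_class D CX C1) _.
by apply: etrans (esym (rinum_cartier_class _ CY C1')); rewrite (inum_conj D CX).
Qed.

Lemma conj_N1_bij : exists2 h : {linear N1 Y -> N1 X},
  cancel conj_N1 h & cancel h conj_N1.
Proof.
have surj (y : N1 Y) : exists x, conj_N1 x = y.
  rewrite -[y]N1_classK N1_class_sum; elim: (repr y) => [|t s [x xE]].
    by exists 0; rewrite big_nil linear0.
  have [D DE] := conj_cartier_surj t.2.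
  exists (t.1 *: cartier_class D + x); rewrite linearP /= xE conj_N1_class DE.
  by rewrite big_cons.
have inj : injective conj_N1.
  move=> x y E; apply: N1_eq => C CX C1.
  by rewrite -rinum_conj_N1 // E rinum_conj_N1.
have [h hK] := choice surj.
have Kh : cancel conj_N1 h by move=> x; apply: inj; rewrite hK.
have hl : linear h by move=> c x y; apply: inj; rewrite hK linearP /= !hK.
pose hL := GRing.isLinear.Build R (N1 Y) (N1 X) _ h hl.
pose h' : {linear N1 Y -> N1 X} := HB.pack h hL.
by exists h'.
Qed.

Lemma is_volume_conj (v : N1 Y -> R) : is_volume v -> is_volume (v \o conj_N1).
Proof.
move=> [v0 vc vh vD]; split=> [x|m phi|t x t0|D] /=.
- exact: v0.
- exact: (vc m (conj_N1 \o phi)).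
- by rewrite linearZ /= vh // pdim_conj.
- by rewrite conj_N1_class vD vol_cartier_conj.
Qed.

Lemma is_volume_unconj (v : N1 X -> R) (h : {linear N1 Y -> N1 X}) :
  cancel conj_N1 h -> is_volume v -> is_volume (v \o h).
Proof.
move=> Kh [v0 vc vh vD]; split=> [x|m phi|t x t0|E] /=.
- exact: v0.
- exact: (vc m (h \o phi)).
- by rewrite linearZ /= vh // pdim_conj.
- have [D <-] := conj_cartier_surj E.
  by rewrite -conj_N1_class Kh vD vol_cartier_conj.
Qed.

(** A volume on [Y] pulls back to a function with the characterizing properties on [X], where
    uniqueness applies. A volume exists on one side exactly when it does on the other; failing that,
    both [vol] are the default zero function and still agree. *)
Lemma vol_conj : vol Y \o conj_N1 = vol X.
Proof.
have [h Kh _] := conj_N1_bij.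
have [ex|nex] := pselect (exists v, [set v : N1 Y -> R | is_volume v] v).
  have volY := is_volume_conj (xgetPex (fun=> 0) ex).
  apply: (is_volume_unique volY); rewrite /vol.
  by apply: (@xgetPex _ _ [set v | is_volume v]); exists (vol Y \o conj_N1).
have volY0 : vol Y = (fun=> 0) by apply: xgetPN => v vY; apply: nex; exists v.
have volX0 : vol X = (fun=> 0).
  by apply: xgetPN => v vX; apply: nex; exists (v \o h); apply: is_volume_unconj.
by rewrite volY0 volX0.
Qed.

End ConjCartier.

(** * Countably many models *)

Section Encoding.
Variables (R : realType) (kinf : nat -> R[i]).

(** A term is coded by the index of its coefficient in [kinf] and the list of its exponents, missing
    ones being read as 0. *)
Definition decode_mpoly N (l : seq (nat * seq nat)) : mpoly N.+1 R[i] :=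
  \sum_(t <- l) kinf t.1 *: mpolyX R[i] (Multinom [tuple nth 0%N t.2 i | i < N.+1]).

Lemma decode_mpoly_surj N (a : mpoly N.+1 R[i]) : (forall m, m \in msupp a ->
  range kinf (mcoeff m a)) -> exists l, decode_mpoly N l = a.
Proof.
move=> aP; rewrite [a]mpolyE.
have gen (r : seq (multinom N.+1)) : (forall m, m \in r -> range kinf (mcoeff m a)) ->
    exists l, decode_mpoly N l = \sum_(m <- r) mcoeff m a *: mpolyX R[i] m.
  elim: r => [|m r IH] rP; first by exists [::]; rewrite /decode_mpoly !big_nil.
  have [l lE] : exists l, decode_mpoly N l = \sum_(m <- r) mcoeff m a *: mpolyX R[i] m.
    by apply: IH => p pr; apply: rP; rewrite inE pr orbT.
  have [n _ nE] : range kinf (mcoeff m a) by apply: rP; rewrite inE eqxx.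
  exists ((n, val (multinom_val m)) :: l).
  rewrite /decode_mpoly big_cons -/(decode_mpoly N l) lE big_cons /= nE.
  congr (_ *: mpolyX _ _ + _); apply/mnmP => i.
  by rewrite /fun_of_multinom /= tnth_mktuple (tnth_nth 0%N).
exact: gen.
Qed.

End Encoding.

Lemma igen_conj (R : realType) N (g : cauto R) (X : pvar R N) s :
  idl X = igen [set` s] ->
  idl (conj_pvar g X) = igen [set` map (@conj_mpoly R N g) s].
Proof.
move=> Xs; apply/seteqP; split=> a.
  rewrite idl_conjV Xs -[in X in _ -> X](conj_mpolyVK g a).
  elim=> [|c h b hs _ IH]; first by rewrite rmorph0; left.
  by rewrite rmorphD rmorphM; right => //=; apply: map_f.
apply: igen_sub; first exact: idl_ideal.
move=> _ /mapP[h hs ->]; apply/idl_conj; rewrite Xs; exact: igenT.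
Qed.

Lemma countable_models (R : realType) : exists kinf : nat -> R[i],
  forall N (X : pvar R N), exists (g : cauto R) (code : seq (seq (nat * seq nat))),
    idl (conj_pvar g X) = igen [set` map (decode_mpoly kinf N) code].
Proof.
have unc (e : nat -> R[i]) : exists a, ~ range e a.
  apply: contrapT => /forallNP H; apply: (@uncountable_complex R).
  have -> : [set: R[i]] = range e.
    by apply/seteqP; split=> // a _; apply: contrapT (H a).
  exact: sub_countable (card_image_le _ _) (countableP _).
have [kinf kP] := countable_universal_subfield unc.
exists kinf => N X; have [s Xs] := hilbert_basis (idl_ideal X).
pose coefs := flatten [seq [seq mcoeff m a | m <- msupp a] | a <- s].
have [f [h [fh hf fk]]] := kP coefs.
pose g := CAuto fh hf; exists g.
suff [code codeE] : exists code, map (decode_mpoly kinf N) code = map (@conj_mpoly R N g) s.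
  by exists code; rewrite codeE; apply: igen_conj.
have : forall a, a \in s -> exists l, decode_mpoly kinf N l = conj_mpoly g a.
  move=> a as_; apply: decode_mpoly_surj => m; rewrite conj_mpolyE => mm.
  rewrite mcoeff_map_mpoly; apply: fk; apply/flattenP.
  exists [seq mcoeff m a | m <- msupp a]; first exact: map_f.
  apply: map_f; move: mm; rewrite !mcoeff_msupp mcoeff_map_mpoly.
  by rewrite fmorph_eq0.
elim: s {Xs coefs fk} => [|a s IH] H; first by exists [::].
have [code codeE] : exists code, map (decode_mpoly kinf N) code = map (@conj_mpoly R N g) s.
  by apply: IH => b bs; apply: H; rewrite inE bs orbT.
have [l lE] := H a (mem_head _ _).
by exists (l :: code); rewrite /= codeE lE.
Qed.

(** * The countable family of functions *)

Theorem theoremB (R : realType) (n rho : nat) (n_ge1 : (1 <= n)%N)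
    (rho_ge1 : (1 <= rho)%N) :
  exists f : nat -> 'rV[R]_rho -> R,
    (forall j x, 0 <= f j x) /\
    forall (N : nat) (X : pvar R N),
      pdim X = n -> picard_number X = (rho%:R)%:E ->
      exists pi : {linear 'rV[R]_rho -> N1 X},
        [/\ bijective pi,
            forall z : 'rV[int]_rho, N1Z (pi (map_mx intr z)) &
            exists j : nat, vol X \o pi = f j].
Proof.
have [kinf models] := countable_models R.
(* The condition on the Picard number sits under the existential quantifier, so that one choice
   function covers all varieties; trivial divisors fill the remaining cases. *)
have basis N (X : pvar R N) : exists D : 'I_rho -> cartier X,
    picard_number X = (rho%:R)%:E ->
    basis_mod [set: N1 X] [set 0] (fun i => cartier_class (D i)).
  have [/N1_basis[D DP]|nX] := pselect (picard_number X = (rho%:R)%:E); first by exists D.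
  by exists (fun=> cartier_one X).
pose D N X := sval (cid (basis N X)); have DP N X := svalP (cid (basis N X)).
pose pi N (X : pvar R N) : {linear 'rV[R]_rho -> N1 X} :=
  lincomb (fun i => cartier_class (D N X i)).
pose model N code (X : pvar R N) := idl X = igen [set` map (decode_mpoly kinf N) code].
(* A variety is determined by its ideal, so a code has at most one model and [F] depends on the code
   alone. Codes without a model receive the zero function. *)
pose F (c : nat * seq (seq (nat * seq nat))) : 'rV[R]_rho -> R :=
  if pselect (exists X, @model c.1 c.2 X) is left ex
  then vol (sval (cid ex)) \o pi _ (sval (cid ex)) else fun=> 0.
exists (fun j => if choice.unpickle j is Some c then F c else fun=> 0); split.
  move=> j x; case: choice.unpickle => // c; rewrite /F; case: pselect => // ex.
  exact: vol_ge0.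
move=> N X _ Xrho; have [g [code codeE]] := models N X.
set Y := conj_pvar g X in codeE.
have [h Kh hK] := conj_N1_bij g X.
have Yrho : picard_number Y = (rho%:R)%:E.
  rewrite -Xrho; apply: (@ldim_semilinear R R idfun (N1 X) (N1 Y) (conj_N1 g (X := X))).
  - by exists idfun.
  - by move=> y; exists (h y); apply: hK.
  - exact: linearD.
  - exact: linear0.
  - by move=> c x; rewrite linearZ.
  - by [].
  - by move=> x /=; split=> [->|E]; rewrite ?linear0 // -(Kh x) E linear0.
(* The basis chosen on the model [Y] is carried back to [X] by [h], the inverse of conjugation on
   numerical classes. *)
exists (h \o pi N Y : {linear 'rV[R]_rho -> N1 X}); split.
- apply: bij_comp; first by exists (@conj_N1 _ _ g X).
  by apply: lincomb_bij; apply: (DP N Y).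
- move=> z; have [E _ EE] : N1Z (pi N Y (map_mx intr z)).
    rewrite /pi /= /lincomb; under eq_bigr do rewrite mxE.
    by apply: N1Z_lincomb => i; exists (D N Y i).
  have [E' E'E] := conj_cartier_surj E.
  by exists E' => //=; rewrite -EE -E'E -conj_N1_class Kh.
- exists (choice.pickle (N, code)); rewrite choice.pickleK /F.
  case: pselect => [ex|[]]; last by exists Y.
  have -> : sval (cid ex) = Y.
    by apply: pvar_eq; apply: (etrans (svalP (cid ex))); rewrite -codeE.
  by rewrite -(vol_conj g X); apply/funext => x /=; rewrite hK.
Qed.
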